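(* Let $G$ be an Ahlfors regular set of dimension $s\in(0,1]$, and let $\nu$ satisfy $1\leq\nu\leq\frac{1}{1-s}$ (any $\nu\geq 1$ if $s=1$). For a sequence $(q_n)_{n\in\mathbb{N}}$ and $x\in[0,1]$ put $$E\big((q_n),x,\nu\big)=\Big\{\delta\in[0,1]:\ \|\delta-q_nx\|\leq\frac{1}{n^{\nu}}\text{ for infinitely many } n\in\mathbb{N}\Big\}.$$ Then for Lebesgue-almost every $x\in[0,1]$ one has $$\dim_{\mathrm{H}}\big(E((q_n),x,\nu)\cap G\big)=\frac{1}{\nu}+\dim_{\mathrm{H}}(G)-1$$ for each of the following choices of $(q_n)_{n\in\mathbb{N}}$: (i) (prime powers) $q_n=p_n^d$ for any $d\geq\nu$, $d\in\mathbb{N}$, where $p_n$ is the $n$-th prime; (ii) (monomials) $q_n=n^d$ for any $d>\nu$, $d\in\mathbb{N}$; (iii) (polynomials) $q_n=P(n)$ for $P\in\mathbb{Z}[x]$ with $\deg P>\nu+1$.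
   Context: $\|y\|$ denotes the distance from $y\in\mathbb{R}$ to the nearest integer; $\dim_{\mathrm{H}}$ is Hausdorff dimension. Ahlfors regular set: a non-empty compact set $G\subseteq\mathbb{T}=\mathbb{R}/\mathbb{Z}$ (identified with $[0,1)$) is called Ahlfors regular with dimension $s\in(0,1]$ if there exists a real number $c>0$ such that for all $x\in G$ and all $0<r\leq\frac12$ one has $\frac{r^s}{c}\leq\mathcal{H}^s(G\cap B(x,r))\leq c\,r^s$, where $B(x,r)$ is the open arc centered at $x$ of length $2r$ and $\mathcal{H}^s$ is the $s$-dimensional Hausdorff measure. *)

(* Defs.v *)
From HB Require Import structures.
From mathcomp Require Import all_boot all_order all_algebra.
From mathcomp Require Import all_classical all_reals all_analysis.

Set Implicit Arguments.
Unset Strict Implicit.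
Unset Printing Implicit Defensive.

Import Order.TTheory GRing.Theory Num.Theory.
Import numFieldNormedType.Exports.

Local Open Scope classical_set_scope.
Local Open Scope ring_scope.

(** * Distance to the nearest integer *)

Section dist_int.
Context {R : realType}.
Implicit Types (x y : R) (k : int).

Definition dist_int y : R := inf [set `|y - k%:~R| | k in [set: int]].

Lemma dist_int_le y k : dist_int y <= `|y - k%:~R|.
Proof.
by apply: ge_inf; [exists 0 => _ [j _ <-]; exact: normr_ge0 | exists k].
Qed.

Lemma dist_int_ge0 y : 0 <= dist_int y.
Proof.
apply: lb_le_inf; first by exists `|y - 0%:~R|; exists 0.
by move=> _ [k _ <-]; exact: normr_ge0.
Qed.

Lemma dist_int_adherent y (e : R) :
  0 < e -> exists k, `|y - k%:~R| < dist_int y + e.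
Proof.
move=> e0; have hi : has_inf [set `|y - k%:~R| | k in [set: int]].
  split; first by exists `|y - 0%:~R|; exists 0.
  by exists 0 => _ [j _ <-]; exact: normr_ge0.
by have [_ [k _ <-] h] := inf_adherent e0 hi; exists k.
Qed.

Lemma dist_int0 : dist_int 0 = 0.
Proof.
apply/eqP; rewrite eq_le dist_int_ge0 andbT.
by rewrite (le_trans (dist_int_le 0 0))// subr0 normr0.
Qed.

Lemma dist_intN y : dist_int (- y) = dist_int y.
Proof.
wlog suff H : y / dist_int (- y) <= dist_int y.
  by apply/eqP; rewrite eq_le H/= -{1}(opprK y) H.
apply/ler_addgt0Pr => e /(dist_int_adherent y)[k /ltW yk].
apply: le_trans (dist_int_le _ (- k)) _.
by rewrite mulrNz -opprD normrN.
Qed.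

Lemma dist_intD x y : dist_int (x + y) <= dist_int x + dist_int y.
Proof.
apply/ler_addgt0Pr => e e0; have e20 : 0 < e / 2 by rewrite divr_gt0.
have [k /ltW xk] := dist_int_adherent x e20.
have [j /ltW yj] := dist_int_adherent y e20.
apply: le_trans (dist_int_le _ (k + j)) _.
rewrite intrD opprD addrACA (le_trans (ler_normD _ _))//.
by rewrite (le_trans (lerD xk yj))// addrACA -splitr.
Qed.

Lemma dist_int_eq0 y : `|y| < 1 -> dist_int y = 0 -> y = 0.
Proof.
move=> y1 y0; apply/normr0_eq0/eqP; rewrite eq_le normr_ge0 andbT.
apply/ler_addgt0Pr => e e0; rewrite add0r leNgt; apply/negP => ey.
have m0 : 0 < Num.min e (1 - `|y|) by rewrite lt_min e0 subr_gt0.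
have [k] := dist_int_adherent y m0; rewrite y0 add0r lt_min => /andP[yke yk1].
have k1 : (`|k|%:~R : R) < 1.
  rewrite intr_norm -(subrK y k%:~R) (le_lt_trans (ler_normD _ _))//.
  by rewrite -ltrBrDr distrC.
have k0 : k = 0.
  by apply/eqP; rewrite -normr_le0 -ltzD1 add0r -(ltr_int R).
by move: yke; rewrite k0 subr0 ltNge (ltW ey).
Qed.

End dist_int.

(** * The circle R/Z *)

(** Each class of R/Z is represented by its element of [0, 1); the topology is
    that of R/Z, not the one induced by R. *)
Record circle (R : realType) :=
  Circle { circle_val :> R ; circle_valP : 0 <= circle_val < 1 }.

Section circle.
Context {R : realType}.
Implicit Types x y z : circle R.

HB.instance Definition _ := [isSub for @circle_val R].
HB.instance Definition _ := [Choice of circle R by <:].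

Definition circle_dist x y : R := dist_int ((x : R) - (y : R)).

Let circle_distxx x : circle_dist x x = 0.
Proof. by rewrite /circle_dist subrr dist_int0. Qed.

Let circle_dist_positivity x y : circle_dist x y = 0 -> x = y.
Proof.
move=> xy0; apply/val_inj/eqP; rewrite -subr_eq0; apply/eqP.
apply: dist_int_eq0 xy0.
have /andP[x0 x1] := circle_valP x; have /andP[y0 y1] := circle_valP y.
rewrite ltr_norml ltrBrDl (lt_le_trans _ x0) ?subr_lt0//=.
by rewrite (le_lt_trans _ x1)// gerBl.
Qed.

Let circle_dist_sym x y : circle_dist x y = circle_dist y x.
Proof. by rewrite /circle_dist -dist_intN opprB. Qed.

Let circle_dist_triangle y x z :
  circle_dist x z <= circle_dist x y + circle_dist y z.
Proof. by rewrite (le_trans _ (dist_intD _ _))// addrA subrK. Qed.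

HB.instance Definition _ := isMetric.Build R (circle R)
  circle_distxx circle_dist_positivity circle_dist_sym circle_dist_triangle.

End circle.

(** * Hausdorff measure and dimension *)

Section hausdorff.
Context {R : realType} {T : metricType R}.
Implicit Types (A U : set T) (F : nat -> set T).

(** The diameter of the empty set is [-oo]. *)
Definition diam U : \bar R :=
  ereal_sup [set (mdist p.1 p.2)%:E | p in U `*` U].

(** The empty set costs nothing and a singleton costs [0 `^ t], which is [1] for
    [t = 0]. *)
Definition diam_pow (t : R) U : \bar R :=
  if `[< U = set0 >] then 0%E else poweR (diam U) t.

Definition hausdorff_content (t e : R) A : \bar R :=
  ereal_inf [set (\sum_(0 <= k <oo) diam_pow t (F k))%E |
    F in [set F | A `<=` \bigcup_k F k /\
                  forall k, (diam (F k) <= e%:E)%E]].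

Definition hausdorff_measure (t : R) A : \bar R :=
  ereal_sup [set hausdorff_content t e A | e in [set e : R | 0 < e]].

(** In particular the empty set has dimension [0]. *)
Definition hausdorff_dim A : \bar R :=
  ereal_inf [set t%:E | t in [set t : R | 0 <= t /\
                                hausdorff_measure t A = 0%E]].

End hausdorff.

Definition ahlfors_regular (R : realType) (s : R) (G : set (circle R)) : Prop :=
  [/\ G !=set0, compact G &
    exists2 c : R, 0 < c &
      forall (x : circle R) (r : R), G x -> 0 < r <= 1 / 2 ->
        ((r `^ s / c)%:E <= hausdorff_measure s (G `&` ball x r) <=
         (c * r `^ s)%:E)%E].

Definition shrinking_targets (R : realType) (q : nat -> int) (x nu : R) :
    set R :=
  [set delta | 0 <= delta <= 1 /\
    infinite_set [set n : nat | (0 < n)%N /\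
      dist_int (delta - (q n)%:~R * x) <= 1 / n%:R `^ nu]].

(** * Prime numbers in increasing order *)

Lemma next_prime_subproof (m : nat) : exists p, prime p && (m < p)%N.
Proof. by have [p mp pp] := prime_above m; exists p; rewrite pp mp. Qed.

Definition next_prime (m : nat) : nat := ex_minn (next_prime_subproof m).

(** Numbering starts at [1]: [nth_prime 1 = 2], [nth_prime 2 = 3]; the value
    [nth_prime 0 = 0] is not a prime. *)
Definition nth_prime (n : nat) : nat := iter n next_prime 0%N.

(* Main.v *)
Require Import Defs.
From mathcomp Require Import all_boot all_order all_algebra.
From mathcomp Require Import all_classical all_reals all_analysis.
From mathcomp Require Import ring lra zify.

(** Put [t0 = 1 / nu + s - 1]. An Ahlfors regular set [G] has dimension [s], since
    it meets about [2 ^ (j * s)] of the [2 ^ j] dyadic cells of level [j]. It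
    remains to compare the [t]-dimensional Hausdorff measure of the intersection
    with [0] for countably many [t] on either side of [t0]. The indices are grouped
    into blocks [2 ^ k <= n < 2 ^ (k + 1)], whose targets have radius about
    [2 ^ (- k * nu)].

    For almost every [x] both bounds come from averages over [x], and these are
    taken over finite grids. If [L] is a multiple of all [q n * 2 ^ j] with [n] in
    the block, then [x] may be replaced by the point of the grid of step [1 / L]
    below it. On the grid, [q n * x] visits all cells of level [j] equally often
    ([dcell_uniform]).

    Upper bound, [t0 < t]. By uniformity, of the [2 ^ k] targets of a block at most
    about [2 ^ (k * (1 - nu * (1 - s)))] meet [G] on average. By Markov's inequality and
    the Borel-Cantelli lemma, for almost every [x] the number is, from some block
    on, at most [2 ^ (k * eps)] times larger. Covering the intersection by these
    targets gives total cost
    [\sum_k 2 ^ (k * (1 - nu * (1 - s) - nu * t + eps))], which converges for small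
    [eps], so that the Hausdorff measure is [0].

    Lower bound, [0 < t < tau < t0]. A block puts a weight on the cells of [G] of
    level [j], about [k * nu], that the orbit visits. Its distance to the natural
    weight of [G] is measured by a dyadic energy of exponent [tau], the
    [discrepancy]. Two facts are combined.

    - [hausdorff_limsup_neq0] is deterministic: if the discrepancy is arbitrarily
      small in infinitely many blocks, then no cover of the part of [G] that lies
      in infinitely many targets has small [t]-dimensional cost. Given a cheap
      cover, one descends through cells of [G] near which it stays cheap. Such
      cells exist at every step by an average over the weight, which satisfies a
      Frostman condition after a few overloaded cells are discarded. The limit
      point is in infinitely many targets and is not covered.

    - [second_moment] bounds the average of the discrepancy over [x]. The terms
      with [n] alone are small because [tau < t0]. For a pair [(n, m)], given
      [q n * x] the point [q m * x] is uniform on a coset of the group of order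
      [b = |q n| / gcd (q n) (q m)], so that the pair is almost independent when
      [b] is large. For powers of primes, [b] is [p ^ d] with [p] the [n]-th prime,
      and the [n]-th prime divided by [n] tends to infinity
      ([nth_prime_superlinear]). For a polynomial [P] of degree [D > nu], a divisor
      [g] of [P n] divides few other values in the block: the roots modulo [g] lie
      in few classes modulo a number of order [g] to the power [1 / D]
      ([poly_root_count]), and there are few divisors ([divisor_weight_bound]).
      Monomials are a special case.

    Hence the average discrepancy tends to [0], and for almost every [x] it is
    arbitrarily small in infinitely many blocks. *)

Set Implicit Arguments.
Unset Strict Implicit.
Unset Printing Implicit Defensive.

Import Order.TTheory GRing.Theory Num.Theory.
Import numFieldNormedType.Exports.

Local Open Scope classical_set_scope.
Local Open Scope ring_scope.

Lemma le_of_eq {d} {T : porderType d} (x y : T) : x = y -> (x <= y)%O.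
Proof. by move=> ->. Qed.

(** * Hausdorff measures *)

Section hausdorff_facts.
Context {R : realType} {T : metricType R}.
Implicit Types (A B U : set T) (F : nat -> set T) (t e : R).

Lemma nneseries_le_bound (f : nat -> \bar R) (B : \bar R) :
  (forall k, (0 <= f k)%E) -> (forall n, (\sum_(0 <= k < n) f k <= B)%E) ->
  (\sum_(0 <= k <oo) f k <= B)%E.
Proof.
move=> f0 fB; apply: lime_le; first exact: is_cvg_nneseries.
by near=> n; exact: fB.
Unshelve. all: by end_near. Qed.

Lemma diam_set0 : diam (@set0 T) = -oo%E.
Proof.
rewrite /diam (_ : [set _ | _ in _] = set0) ?ereal_sup0//.
by apply/seteqP; split => // x [[y z] [[]]].
Qed.

Lemma mdist_le_diam U x y : U x -> U y -> ((mdist x y)%:E <= diam U)%E.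
Proof. by move=> Ux Uy; apply: ereal_sup_ubound; exists (x, y). Qed.

Lemma diam_le U (e : \bar R) :
  (forall x y, U x -> U y -> ((mdist x y)%:E <= e)%E) -> (diam U <= e)%E.
Proof. by move=> h; apply: ge_ereal_sup => _ [[x y] [/= Ux Uy] <-]; exact: h. Qed.

Lemma diam_pow_ge0 t U : (0 <= diam_pow t U)%E.
Proof. by rewrite /diam_pow; case: ifP => // _; exact: poweR_ge0. Qed.

Lemma diam_pow_set0 t : diam_pow t (@set0 T) = 0%E.
Proof. by rewrite /diam_pow asboolT. Qed.

Lemma diam_ge0 U : U !=set0 -> (0 <= diam U)%E.
Proof.
by move=> [x Ux]; rewrite (le_trans _ (mdist_le_diam Ux Ux))// lee_fin mdist_ge0.
Qed.

Lemma diam_pow_le t U (r : R) : 0 <= t -> 0 <= r ->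
  (forall x y, U x -> U y -> mdist x y <= r) ->
  (diam_pow t U <= (r `^ t)%:E)%E.
Proof.
move=> t0 r0 h; rewrite /diam_pow; case: asboolP => [_|/eqP/set0P U0].
  by rewrite lee_fin powR_ge0.
have d0 := diam_ge0 U0.
have dr : (diam U <= r%:E)%E by apply: diam_le => x y Ux Uy; rewrite lee_fin h.
rewrite -poweR_EFin; move: (diam U) d0 dr => [d| |]//; rewrite !lee_fin => d0 dr.
by rewrite ge0_ler_powR.
Qed.

Lemma mdist_pow_le t U x y : 0 <= t -> U x -> U y ->
  ((mdist x y `^ t)%:E <= diam_pow t U)%E.
Proof.
move=> t0 Ux Uy; rewrite /diam_pow asboolF; last by move=> U0; rewrite U0 in Ux.
have := mdist_le_diam Ux Uy; have := diam_ge0 (ex_intro _ _ Ux).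
case: (diam U) => [d| |]//; rewrite ?lee_fin => d0 md.
  by rewrite ge0_ler_powR// nnegrE mdist_ge0.
have [->|tn0] := eqVneq t 0; first by rewrite !poweRe0 powRr0.
by rewrite poweRyr// leey.
Qed.

Lemma hausdorff_content_le t e A F : A `<=` \bigcup_k F k ->
  (forall k, (diam (F k) <= e%:E)%E) ->
  (hausdorff_content t e A <= \sum_(0 <= k <oo) diam_pow t (F k))%E.
Proof. by move=> AF Fe; apply: ereal_inf_lbound; exists F. Qed.

Lemma hausdorff_content_ge t e A (b : \bar R) :
  (forall F, A `<=` \bigcup_k F k -> (forall k, (diam (F k) <= e%:E)%E) ->
    (b <= \sum_(0 <= k <oo) diam_pow t (F k))%E) ->
  (b <= hausdorff_content t e A)%E.
Proof. by move=> h; apply: le_ereal_inf_tmp => _ [F [AF Fe] <-]; exact: h. Qed.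

Lemma hausdorff_content_ge0 t e A : (0 <= hausdorff_content t e A)%E.
Proof.
apply: hausdorff_content_ge => F _ _; apply: nneseries_ge0 => k _ _.
exact: diam_pow_ge0.
Qed.

Lemma content_le_measure t e A : 0 < e ->
  (hausdorff_content t e A <= hausdorff_measure t A)%E.
Proof. by move=> e0; apply: ereal_sup_ubound; exists e. Qed.

Lemma hausdorff_measure_le t A (b : \bar R) :
  (forall e, 0 < e -> (hausdorff_content t e A <= b)%E) ->
  (hausdorff_measure t A <= b)%E.
Proof. by move=> h; apply: ge_ereal_sup => _ [e e0 <-]; exact: h. Qed.

Lemma hausdorff_measure_ge0 t A : (0 <= hausdorff_measure t A)%E.
Proof.
exact: le_trans (hausdorff_content_ge0 t 1 A) (content_le_measure _ _ ltr01).
Qed.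

Lemma hausdorff_content_mono t e A B : A `<=` B ->
  (hausdorff_content t e A <= hausdorff_content t e B)%E.
Proof.
move=> AB; apply: hausdorff_content_ge => F BF Fe.
by apply: hausdorff_content_le => //; exact: subset_trans BF.
Qed.

Lemma hausdorff_measure_mono t A B : A `<=` B ->
  (hausdorff_measure t A <= hausdorff_measure t B)%E.
Proof.
move=> AB; apply: hausdorff_measure_le => e e0.
exact: le_trans (hausdorff_content_mono _ _ AB) (content_le_measure _ _ e0).
Qed.

Lemma hausdorff_content_anti t e e' A : e <= e' ->
  (hausdorff_content t e' A <= hausdorff_content t e A)%E.
Proof.
move=> ee; apply: hausdorff_content_ge => F AF Fe.
by apply: hausdorff_content_le => // k; rewrite (le_trans (Fe k))// lee_fin.
Qed.

(** A set of diameter below the gaps meets at most one of the pieces, so one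
    cover of the union splits into disjoint covers of the pieces. *)
Lemma hausdorff_content_superadd t e (I : finType) (A : I -> set T) B :
  (forall i j x y, i != j -> A i x -> A j y -> e < mdist x y) ->
  (forall i, A i `<=` B) ->
  (\sum_i hausdorff_content t e (A i) <= hausdorff_content t e B)%E.
Proof.
move=> sep AB; apply: hausdorff_content_ge => F BF Fe.
pose F' i k := if `[< F k `&` A i !=set0 >] then F k else set0.
have cov i : A i `<=` \bigcup_k F' i k.
  move=> x Ax; have [k _ Fk] := BF _ (AB _ _ Ax).
  by exists k => //; rewrite /F' asboolT//; exists x.
have diamF' i k : (diam (F' i k) <= e%:E)%E.
  by rewrite /F'; case: ifP => // _; rewrite diam_set0 leNye.
apply: (@le_trans _ _ (\sum_i \sum_(0 <= k <oo) diam_pow t (F' i k))%E).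
  by apply: lee_sum => i _; exact: hausdorff_content_le.
rewrite -nneseries_sum; last by move=> *; exact: diam_pow_ge0.
apply: lee_nneseries => k.
  by move=> _ _; apply: sume_ge0 => *; exact: diam_pow_ge0.
move=> _; have [[i [x [Fx Ax]]]|none] := pselect (exists i, F k `&` A i !=set0).
  rewrite (bigD1 i)//= big1 ?adde0.
    by rewrite /F'; case: ifP => // _; rewrite diam_pow_set0 diam_pow_ge0.
  move=> j ji; rewrite /F' asboolF ?diam_pow_set0// => -[y [Fy Ay]].
  have := sep _ _ _ _ ji Ay Ax; apply/negP; rewrite -leNgt -lee_fin.
  exact: le_trans (mdist_le_diam Fy Fx) (Fe k).
rewrite big1 ?diam_pow_ge0// => i _; rewrite /F' asboolF ?diam_pow_set0// => h.
by apply: none; exists i.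
Qed.

(** Pieces at distance more than [d] from each other share no covering set of
    diameter below [d]. For such pieces this stands in for the countable
    additivity of the measure on Borel sets. *)
Lemma hausdorff_measure_superadd t (d a : R) (I : finType) (A : I -> set T) B :
  0 < d -> (forall i j x y, i != j -> A i x -> A j y -> d < mdist x y) ->
  (forall i, A i `<=` B) -> (forall i, (a%:E <= hausdorff_measure t (A i))%E) ->
  ((#|I|%:R * a)%:E <= hausdorff_measure t B)%E.
Proof.
move=> d0 sep AB Aa.
have key a' : a' < a -> ((#|I|%:R * a')%:E <= hausdorff_measure t B)%E.
  move=> a'a.
  have /choice[f fP] i : exists e, 0 < e /\ (a'%:E < hausdorff_content t e (A i))%E.
    have : (a'%:E < hausdorff_measure t (A i))%E.
      by rewrite (lt_le_trans _ (Aa i))// lte_fin.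
    by move/ereal_sup_gt => [_ [e e0 <-] h]; exists e.
  pose e := \big[Num.min/d]_i f i.
  have e0 : 0 < e by apply: lt_bigmin => // i _; case: (fP i).
  apply: le_trans (content_le_measure t B e0).
  apply: (@le_trans _ _ (\sum_i hausdorff_content t e (A i))%E); last first.
    apply: hausdorff_content_superadd => // i j x y ij Ax Ay.
    by rewrite (le_lt_trans _ (sep _ _ _ _ ij Ax Ay))// bigmin_le_id.
  rewrite mulr_natl -sumr_const -sumEFin; apply: lee_sum => i _.
  apply: le_trans (ltW (fP i).2) _; apply: hausdorff_content_anti.
  exact: bigmin_le_cond.
apply/lee_addgt0Pr => h h0.
have [I0|I0] := posnP #|I|.
  by rewrite I0 mul0r (le_trans (hausdorff_measure_ge0 t B))// leeDl// lee_fin ltW.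
have I0' : 0 < #|I|%:R :> R by rewrite ltr0n.
have := key (a - h / #|I|%:R).
rewrite ltrBlDr ltrDl divr_gt0// => /(_ isT); rewrite -leeBlDr// -EFinB; apply: le_trans.
by rewrite lee_fin mulrBr mulrCA divff ?mulr1// gt_eqF.
Qed.

Lemma hausdorff_content_setU t e A B :
  (hausdorff_content t e (A `|` B) <=
   hausdorff_content t e A + hausdorff_content t e B)%E.
Proof.
apply/lee_addgt0Pr => h h0; have h20 : 0 < h / 2 by rewrite divr_gt0.
have [->|Ay] := eqVneq (hausdorff_content t e A) +oo%E.
  by rewrite addye ?leey// gt_eqF// (lt_le_trans _ (hausdorff_content_ge0 _ _ _))// ltNye.
have [->|By] := eqVneq (hausdorff_content t e B) +oo%E.
  by rewrite addey ?leey// gt_eqF// (lt_le_trans _ (hausdorff_content_ge0 _ _ _))// ltNye.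
have fA : hausdorff_content t e A \is a fin_num.
  by rewrite ge0_fin_numE ?hausdorff_content_ge0// ltey.
have fB : hausdorff_content t e B \is a fin_num.
  by rewrite ge0_fin_numE ?hausdorff_content_ge0// ltey.
have [_ [F [AF Fe] <-] hF] := lb_ereal_inf_adherent h20 fA.
have [_ [F' [BF Fe'] <-] hF'] := lb_ereal_inf_adherent h20 fB.
(* The two covers are interleaved. *)
pose H k := if odd k then F' k./2 else F k./2.
apply: (@le_trans _ _ (\sum_(0 <= k <oo) diam_pow t (F k) +
                       \sum_(0 <= k <oo) diam_pow t (F' k))%E); last first.
  by rewrite (splitr h) EFinD addeACA leeD// ltW.
apply: (@le_trans _ _ (\sum_(0 <= k <oo) diam_pow t (H k))%E).
  apply: hausdorff_content_le => [x [/AF|/BF] [k _ Fk]|k].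
  - by exists k.*2 => //; rewrite /H odd_double doubleK.
  - by exists k.*2.+1 => //; rewrite /H /= odd_double/= uphalf_double.
  - by rewrite /H; case: ifP.
have H0 k : (0 <= diam_pow t (H k))%E by exact: diam_pow_ge0.
apply: nneseries_le_bound => // n.
apply: (@le_trans _ _ (\sum_(0 <= k < n.*2) diam_pow t (H k))%E).
  by apply: lee_sum_nneg_natr => //; rewrite -addnn leq_addr.
have -> : (\sum_(0 <= k < n.*2) diam_pow t (H k) =
   \sum_(0 <= k < n) diam_pow t (F k) + \sum_(0 <= k < n) diam_pow t (F' k))%E.
  elim: n => [|n IH]; first by rewrite !big_geq// adde0.
  rewrite doubleS !big_nat_recr//= IH -addeA addeACA; congr (_ + _)%E.
  - by rewrite /H odd_double doubleK.
  - by rewrite /H /= odd_double /= uphalf_double.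
by apply: leeD; apply: nneseries_lim_ge => *; exact: diam_pow_ge0.
Qed.

Lemma hausdorff_measure_setU t A B :
  (hausdorff_measure t (A `|` B) <=
   hausdorff_measure t A + hausdorff_measure t B)%E.
Proof.
apply: hausdorff_measure_le => e e0.
by rewrite (le_trans (hausdorff_content_setU _ _ _ _))// leeD// content_le_measure.
Qed.

Lemma hausdorff_measure_set0 t : hausdorff_measure t (@set0 T) = 0%E.
Proof.
apply/eqP; rewrite eq_le hausdorff_measure_ge0 andbT.
apply: hausdorff_measure_le => e e0.
apply: le_trans (@hausdorff_content_le t e set0 (fun=> set0) _ _) _ => //.
  by move=> k; rewrite diam_set0 leNye.
by rewrite eseries0// => k _ _; rewrite diam_pow_set0.
Qed.

Lemma hausdorff_measure_bigsetU t (a : R) (I : Type) (r : seq I) (P : pred I)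
    (A : I -> set T) :
  (forall i, P i -> (hausdorff_measure t (A i) <= a%:E)%E) ->
  (hausdorff_measure t (\big[setU/set0]_(i <- r | P i) A i) <=
   (\sum_(i <- r | P i) a)%:E)%E.
Proof.
move=> Aa; elim/big_ind2 : _ => [|X x Y y Xx Yy|i Pi].
- by rewrite hausdorff_measure_set0.
- by rewrite (le_trans (hausdorff_measure_setU _ _ _))// EFinD leeD.
- exact: Aa.
Qed.

(** When distances are at most [1], no diameter exceeds [1] and its powers
    decrease with the exponent. *)
Lemma hausdorff_measure_le_dim t t' A :
  0 <= t <= t' -> (forall x y : T, mdist x y <= 1) ->
  (hausdorff_measure t' A <= hausdorff_measure t A)%E.
Proof.
move=> /andP[t0 tt'] le1.
have mono (U : set T) : (diam_pow t' U <= diam_pow t U)%E.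
  rewrite /diam_pow; case: asboolP => // /eqP/set0P U0.
  have d0 := diam_ge0 U0.
  have : (diam U <= 1%:E)%E by apply: diam_le => x y _ _; rewrite lee_fin.
  move: (diam U) d0 => [d| |]//; rewrite !lee_fin => d0 d1.
  have [->|dn0] := eqVneq d 0.
    have [->|tn0] := eqVneq t 0; last first.
      by rewrite !powR0// gt_eqF// (lt_le_trans _ tt')// lt_neqAle eq_sym tn0.
    by rewrite powRr0; case: (eqVneq t' 0) => [->|?]; rewrite ?powRr0 ?powR0.
  by rewrite /powR (negbTE dn0) ler_expR ler_wnM2r// ln_le0.
apply: hausdorff_measure_le => e e0; apply: le_trans (content_le_measure t A e0).
apply: hausdorff_content_ge => F AF Fe.
apply: le_trans (hausdorff_content_le t' AF Fe) _.
by apply: lee_nneseries => k *; [exact: diam_pow_ge0|exact: mono].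
Qed.

End hausdorff_facts.

(** * Dyadic cells of the circle *)

(** Scales, masses and probabilities below are all powers of [2] up to
    constants, so that most estimates reduce to comparing exponents. *)
Definition pow2 {R : realType} (x : R) : R := 2 `^ x.

Section pow2.
Context {R : realType}.
Implicit Types x y : R.

Lemma pow2_gt0 x : 0 < pow2 x.
Proof. by rewrite powR_gt0. Qed.

Lemma pow2_ge0 x : 0 <= pow2 x. Proof. exact: ltW (pow2_gt0 x). Qed.

Lemma pow2D x y : pow2 (x + y) = pow2 x * pow2 y.
Proof. by rewrite /pow2 powRD// pnatr_eq0 implybT. Qed.

Lemma pow2N x : pow2 (- x) = (pow2 x)^-1.
Proof. by rewrite /pow2 powRN. Qed.

Lemma pow2B x y : pow2 (x - y) = pow2 x / pow2 y.
Proof. by rewrite pow2D pow2N. Qed.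

Lemma pow20 : pow2 0 = 1 :> R. Proof. exact: powRr0. Qed.

Lemma pow21 : pow2 1 = 2 :> R. Proof. exact: powRr1. Qed.

Lemma pow2_nat n : pow2 n%:R = 2 ^+ n :> R.
Proof. exact: powR_mulrn. Qed.

Lemma pow2_natV n : pow2 (- n%:R) = 2 ^- n :> R.
Proof. by rewrite pow2N pow2_nat. Qed.

Lemma pow2_le x y : x <= y -> pow2 x <= pow2 y.
Proof. by move=> xy; rewrite ler_powR// ler1n. Qed.

Lemma pow2_ge1 x : 0 <= x -> 1 <= pow2 x.
Proof. by move=> x0; rewrite -pow20 pow2_le. Qed.

Lemma pow2_le1 x : x <= 0 -> pow2 x <= 1.
Proof. by move=> x0; rewrite -pow20 pow2_le. Qed.

Lemma pow2M x y : pow2 (x * y) = pow2 x `^ y.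
Proof. exact: powRrM. Qed.

Lemma pow2_lt x y : x < y -> pow2 x < pow2 y.
Proof. by move=> xy; rewrite /pow2 /powR pnatr_eq0/= ltr_expR ltr_pM2r// ln_gt0// ltr1n. Qed.

End pow2.

Section cells.
Context {R : realType}.
Implicit Types (y z : circle R).

Definition cell (i : nat) y : nat := `|Num.floor (2 ^+ i * (y : R))|%N.

Lemma cell_itv i y : (cell i y)%:R <= 2 ^+ i * (y : R) < (cell i y)%:R + 1.
Proof.
have /andP[y0 y1] := circle_valP y.
have h : (cell i y)%:R = (Num.floor (2 ^+ i * (y : R)))%:~R :> R.
  rewrite /cell natr_absz ger0_norm//.
  by rewrite floor_ge_int mulr_ge0// exprn_ge0.
rewrite h; have /andP[-> ] := floor_itv (2 ^+ i * (y : R)).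
by rewrite intrD.
Qed.

Lemma cell_lt i y : (cell i y < 2 ^ i)%N.
Proof.
have /andP[y0 y1] := circle_valP y; have /andP[h _] := cell_itv i y.
by rewrite -(ltr_nat R) natrX (le_lt_trans h)// gtr_pMr// exprn_gt0.
Qed.

Lemma cell_uniq i y (n : nat) : n%:R <= 2 ^+ i * (y : R) < n%:R + 1 -> cell i y = n.
Proof.
move=> /andP[h1 h2]; have /andP[h3 h4] := cell_itv i y.
apply/eqP; rewrite eqn_leq -[(_ <= n)%N]ltnS -[(n <= _)%N]ltnS -!(ltr_nat R) -!natr1.
by rewrite (le_lt_trans h3 h2) (le_lt_trans h1 h4).
Qed.

Lemma cell_div i j y : (i <= j)%N -> (cell j y %/ 2 ^ (j - i))%N = cell i y.
Proof.
move=> ij; apply/esym/cell_uniq.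
have /andP[h1 h2] := cell_itv j y.
have e : 2 ^+ j = 2 ^+ i * 2 ^+ (j - i) :> R by rewrite -exprD subnKC.
have d0 : 0 < 2 ^+ (j - i) :> R by rewrite exprn_gt0.
set m := cell j y in h1 h2 *; set d := (2 ^ (j - i))%N.
have dR : d%:R = 2 ^+ (j - i) :> R by rewrite natrX.
rewrite e -mulrA mulrCA -dR in h1 h2; rewrite -dR in d0.
have dN : (0 < d)%N by rewrite -(ltr_nat R).
apply/andP; split.
  rewrite -(ler_pM2l d0) (le_trans _ h1)// -natrM ler_nat.
  by rewrite mulnC leq_divM.
rewrite -(ltr_pM2l d0) (lt_le_trans h2)// natr1 natr1 -natrM ler_nat.
by rewrite mulnC ltn_ceil.
Qed.

Lemma dist_int_le_norm (x : R) : dist_int x <= `|x|.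
Proof. by rewrite (le_trans (dist_int_le x 0))// subr0. Qed.

Lemma mdistE y z : mdist y z = dist_int ((y : R) - (z : R)).
Proof. by []. Qed.

Lemma mdist_le1 y z : mdist y z <= 1.
Proof.
have /andP[y0 y1] := circle_valP y; have /andP[z0 z1] := circle_valP z.
rewrite mdistE (le_trans (dist_int_le_norm _))// ler_norml; lra.
Qed.

Lemma cell_mdist i y z : cell i y = cell i z -> mdist y z < 2 ^- i.
Proof.
move=> yz; rewrite mdistE (le_lt_trans (dist_int_le_norm _))//.
have := cell_itv i y; rewrite yz; have := cell_itv i z.
move: (cell i z)%:R => n /andP[h1 h2] /andP[h3 h4].
have p0 : 0 < 2 ^+ i :> R by rewrite exprn_gt0.
rewrite -(ltr_pM2l p0) divff ?gt_eqF// -(ger0_norm (ltW p0)) -normrM mulrBr.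
by rewrite ltr_norml; lra.
Qed.

Lemma mdist_adherent y z (r : R) : mdist y z < r ->
  exists k : int, `|(y : R) - (z : R) - k%:~R| < r.
Proof.
rewrite mdistE => h.
have [|k hk] := @dist_int_adherent R ((y : R) - (z : R)) (r - dist_int ((y : R) - (z : R))).
  by rewrite subr_gt0.
by exists k; rewrite (lt_le_trans hk)// addrC subrK.
Qed.

(** Cells wrap around the circle: adding [(2 ^ i).-1 * m] modulo [2 ^ i] amounts
    to subtracting [m] without leaving the natural numbers. *)
Definition near_cells (i m u : nat) : seq nat :=
  [seq ((u + (2 ^ i).-1 * m + j) %% 2 ^ i)%N | j <- iota 0 (m.*2.+1)].

Lemma size_near_cells i m u : size (near_cells i m u) = m.*2.+1.
Proof. by rewrite size_map size_iota. Qed.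

Lemma near_cellsP i m y z : mdist y z < m%:R * 2 ^- i ->
  cell i z \in near_cells i m (cell i y).
Proof.
move=> /mdist_adherent[k hk].
have p0 : 0 < 2 ^+ i :> R by rewrite exprn_gt0.
have {hk} : `|2 ^+ i * (y : R) - 2 ^+ i * (z : R) - 2 ^+ i * k%:~R| < m%:R.
  rewrite -!mulrBr normrM (gtr0_norm p0) -ltr_pdivlMl// mulrC.
  by rewrite -[ltRHS]mulrC mulrC.
have := cell_itv i y; have := cell_itv i z.
have := cell_lt i y; have := cell_lt i z.
set b := cell i z; set a := cell i y => b2 a2 /andP[z1 z2] /andP[y1 y2].
rewrite ltr_norml => /andP[l1 l2].
have d1 : (a%:Z - b%:Z - (2 ^ i)%N%:Z * k <= m%:Z)%R.
  rewrite -ltzD1 -(ltr_int R) !rmorphB/= rmorphD/= rmorphM/= -!pmulrn natrX/=; lra.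
have d2 : (- m%:Z <= a%:Z - b%:Z - (2 ^ i)%N%:Z * k)%R.
  rewrite -ltzD1 -(ltr_int R) rmorphD/= rmorphN/= !rmorphB/= rmorphM/= -!pmulrn natrX/=; lra.
apply/mapP; exists (absz (m%:Z - (a%:Z - b%:Z - (2 ^ i)%N%:Z * k))%R).
  by rewrite mem_iota; lia.
have P : (0 < 2 ^ i)%N by rewrite expn_gt0.
set j := absz _.
have jE : j%:Z = m%:Z - (a%:Z - b%:Z - (2 ^ i)%N%:Z * k) by rewrite /j; lia.
apply/eqP; rewrite -eqz_nat -modz_nat; apply/eqP.
have -> : (a + (2 ^ i).-1 * m + j)%N%:Z = (k + m%:Z) * (2 ^ i)%N%:Z + b%:Z.
  rewrite !PoszD jE PoszM.
  have -> : (2 ^ i).-1%:Z = (2 ^ i)%N%:Z - 1 by lia.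
  by ring.
by rewrite modzMDl modz_nat modn_small.
Qed.

(** For [0 < i] the number of cells is even, so that two distinct cells of the
    same parity are separated by a whole cell on both sides. *)
Lemma cell_sep i y z : cell i y != cell i z -> odd (cell i y) = odd (cell i z) ->
  2 ^- i <= mdist y z.
Proof.
wlog yz : y z / (cell i y < cell i z)%N.
  move=> H ne; case: (ltngtP (cell i y) (cell i z)) (ne) => // h _ od.
    exact: H.
  by rewrite metric_sym; apply: H => //; rewrite eq_sym.
move=> _ od.
have := cell_itv i y; have := cell_itv i z.
have := cell_lt i y; have := cell_lt i z.
set b := cell i z in yz od *; set a := cell i y in yz od * => b2 a2 /andP[z1 z2] /andP[y1 y2].
have p0 : 0 < 2 ^+ i :> R by rewrite exprn_gt0.
rewrite mdistE; apply: lb_le_inf; first by exists `|(y : R) - (z : R) - 0%:~R|; exists 0.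
move=> _ [k _ <-]; rewrite -(ler_pM2l p0) divff ?gt_eqF//.
rewrite -{1}(gtr0_norm p0) -normrM !mulrBr.
have ab : (a.+2 <= b)%N by lia.
have ba : (b.+2 <= a + 2 ^ i)%N.
  have := oddX 2 i; case: eqP => [i0|_]/=; first by move: b2; rewrite i0 expn0; lia.
  by move: (2 ^ i)%N b2 a2 => p b2 a2 op; move: od ab; lia.
have {}ab : a%:R + 2 <= b%:R :> R by rewrite -natrD ler_nat addn2.
have {}ba : b%:R + 2 <= a%:R + 2 ^+ i :> R by rewrite -natrX -!natrD ler_nat addn2.
have [k0|k0] := leP 0 k.
  have : 0 <= k%:~R :> R by rewrite ler0z.
  move: (k%:~R : R) => K K0; have := mulr_ge0 (ltW p0) K0 => h.
  by rewrite ler0_norm; lra.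
have : k%:~R <= -1 :> R by rewrite -[-1]/((-1)%:~R) ler_int; lia.
move: (k%:~R : R) => K K0; have : 2 ^+ i * K <= - 2 ^+ i by rewrite -[leRHS]mulrN1 ler_pM2l.
by move=> h; rewrite ger0_norm; lra.
Qed.

End cells.

(** * Counting the cells of an Ahlfors regular set *)

Lemma in_bigsetU {T : Type} {I : eqType} (r : seq I) (P : pred I)
    (F : I -> set T) i x :
  i \in r -> P i -> F i x -> (\big[setU/set0]_(j <- r | P j) F j) x.
Proof. by move=> ir Pi Fx; rewrite (big_rem i)//= Pi; left. Qed.

Section ahlfors.
Context {R : realType}.
Variables (G : set (circle R)) (s c0 : R).

Definition gcell (i v : nat) : bool := `[< exists2 y, G y & cell i y = v >].

Definition gcount (j i u : nat) : nat :=
  (\sum_(v < 2 ^ j | gcell j v && (v %/ 2 ^ (j - i) == u)%N) 1)%N.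

Lemma gcell_cell i y : G y -> gcell i (cell i y).
Proof. by move=> Gy; apply/asboolP; exists y. Qed.

Lemma gcell_parent i j v : (i <= j)%N -> gcell j v -> gcell i (v %/ 2 ^ (j - i)).
Proof.
by move=> ij /asboolP[y Gy <-]; apply/asboolP; exists y => //; rewrite cell_div.
Qed.

Lemma gcell_lt i v : gcell i v -> (v < 2 ^ i)%N.
Proof. by case/asboolP => y _ <-; exact: cell_lt. Qed.

Hypotheses (hs : 0 < s <= 1) (c0_gt0 : 0 < c0).
Hypothesis hA : forall (x : circle R) (r : R), G x -> 0 < r <= 1 / 2 ->
  ((r `^ s / c0)%:E <= hausdorff_measure s (G `&` ball x r) <= (c0 * r `^ s)%:E)%E.

Let s0 : 0 <= s. Proof. by have /andP[/ltW] := hs. Qed.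

Let ballE (x y : circle R) r : ball x r y = (mdist x y < r) :> Prop.
Proof. by rewrite ballEmdist. Qed.

Lemma pow2_natVs (i : nat) : (2 ^- i) `^ s = pow2 (- (i%:R * s)) :> R.
Proof. by rewrite -pow2_natV -pow2M mulNr. Qed.

Lemma natV_itv (i : nat) : (0 < i)%N -> 0 < (2 ^- i : R) <= 1 / 2.
Proof.
move=> i0; rewrite invr_gt0 exprn_gt0//= div1r lef_pV2 ?posrE ?exprn_gt0//.
by rewrite -[leLHS]expr1 ler_eXn2l// ltr1n.
Qed.

Lemma hausdorff_cell_le i v : (0 < i)%N ->
  (hausdorff_measure s (G `&` [set y | cell i y = v]) <=
   (c0 * pow2 (- (i%:R * s)))%:E)%E.
Proof.
move=> i0; have [[g [Gg gv]]|none] := pselect (exists g, G g /\ cell i g = v).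
  have /andP[_] := hA Gg (natV_itv i0); rewrite pow2_natVs; apply: le_trans.
  apply: hausdorff_measure_mono => y [Gy yv]; split=> //.
  by rewrite ballE; apply: cell_mdist; rewrite gv yv.
rewrite (_ : _ `&` _ = set0) ?hausdorff_measure_set0 ?lee_fin ?mulr_ge0 ?pow2_ge0 ?ltW//.
by apply/seteqP; split => // y [Gy yv]; apply: none; exists y.
Qed.

Lemma hausdorff_G_le : (hausdorff_measure s G <= (2 * c0)%:E)%E.
Proof.
apply: (@le_trans _ _ (hausdorff_measure s
  (\big[setU/set0]_(v < 2 ^ 1) (G `&` [set y | cell 1 y = v])))).
  apply: hausdorff_measure_mono => y Gy.
  by apply: (in_bigsetU (i := Ordinal (cell_lt 1 y))); rewrite ?mem_index_enum.
apply: (@le_trans _ _ (\sum_(v < 2 ^ 1) c0)%:E).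
  apply: hausdorff_measure_bigsetU => v _.
  apply: le_trans (hausdorff_cell_le _ _) _ => //.
  by rewrite lee_fin ler_piMr ?(ltW c0_gt0)// pow2_le1// mul1r oppr_le0.
by rewrite sumr_const card_ord expn1 mulr_natl.
Qed.

(** The balls of radius [2 ^- j / 4] around points of [G] in distinct cells of
    the same parity are separated. Each has measure of order [2 ^- j `^ s], and
    all lie in a ball of radius [2 ^- i.-1], of measure of order
    [2 ^- i `^ s]. *)
Lemma gcount_parity j i u (b : bool) : (i <= j)%N ->
  ((\sum_(v < 2 ^ j | (gcell j v && (v %/ 2 ^ (j - i) == u)) && (odd v == b)) 1)%N)%:R
   <= 16 * c0 ^+ 2 * pow2 ((j%:R - i%:R) * s) :> R.
Proof.
move=> ij; rewrite sum1_card.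
pose P := [pred v : 'I_(2 ^ j) | (gcell j v && (v %/ 2 ^ (j - i) == u)%N) && (odd v == b)].
pose I : finType := {v | P v}.
rewrite (_ : #|_| = #|I|); last by rewrite card_sig; apply: eq_card.
have /choice[g gP] (v : I) : exists y, G y /\ cell j y = val (val v).
  by case: v => v /= /andP[/andP[/asboolP[y Gy yv]]]; exists y.
pose r : R := 2 ^- j / 4.
have q0 : 0 < 2 ^- j :> R by rewrite invr_gt0 exprn_gt0.
have q1 : 2 ^- j <= 1 :> R by rewrite invf_le1 ?exprn_gt0// exprn_ege1// ler1n.
have r0 : 0 < r <= 1 / 2 by rewrite /r; lra.
have rE : r `^ s = pow2 (- ((j%:R + 2) * s)).
  rewrite -mulNr pow2M -natrD pow2_natV /r; congr (_ `^ _).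
  by rewrite exprD invfM; congr (_ * _^-1); rewrite expr2; lra.
pose A (v : I) := G `&` ball (g v) r.
have [I0|] := posnP #|I|; last move=> /card_gt0P[v0 _].
  by rewrite I0 !mulr_ge0 ?pow2_ge0 ?exprn_ge0 ?(ltW c0_gt0).
have key (B : set (circle R)) : (forall v, A v `<=` B) ->
    (hausdorff_measure s B <= (2 * c0 * pow2 ((1 - i%:R) * s))%:E)%E ->
    #|I|%:R <= 16 * c0 ^+ 2 * pow2 ((j%:R - i%:R) * s) :> R.
  move=> AB Bs.
  have sep v w x y : v != w -> A v x -> A w y -> r < mdist x y.
    move=> vw [_]; rewrite ballE => xv [_]; rewrite ballE => yw.
    have := @cell_sep R j (g v) (g w).
    rewrite (gP v).2 (gP w).2 => /(_ vw).
    have /andP[_ /eqP ->] := valP v; have /andP[_ /eqP ->] := valP w => /(_ erefl).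
    have := metric_triangle (g v) x (g w); have := metric_triangle x y (g w).
    rewrite (metric_sym y (g w)); rewrite /r in xv yw *; lra.
  have Ar v : ((r `^ s / c0)%:E <= hausdorff_measure s (A v))%E.
    by have /andP[] := hA (gP v).1 r0.
  have /andP[r00 _] := r0.
  have := le_trans (hausdorff_measure_superadd r00 sep AB Ar) Bs.
  rewrite lee_fin rE => h.
  have -> : 16 * c0 ^+ 2 * pow2 ((j%:R - i%:R) * s) =
     2 * c0 ^+ 2 * 8 * pow2 ((j%:R - i%:R) * s) by ring.
  apply: (@le_trans _ _ (2 * c0 ^+ 2 * pow2 ((3 + (j%:R - i%:R)) * s))); last first.
    rewrite [(3 + _) * s]mulrDl pow2D mulrA ler_wpM2r ?pow2_ge0// ler_wpM2l ?mulr_ge0 ?(ltW c0_gt0)//.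
    have -> : 8 = pow2 3 :> R by rewrite -[3]/(3%:R) pow2_nat; ring.
    by rewrite pow2_le// ler_piMr//; have /andP[] := hs.
  have -> : (3 + (j%:R - i%:R)) * s = (1 - i%:R) * s + (j%:R + 2) * s by ring.
  rewrite pow2D -[(j%:R + 2) * s]opprK [pow2 (- - _)]pow2N.
  set p := pow2 (- ((j%:R + 2) * s)) in h *; set a := pow2 ((1 - _) * s) in h *.
  have p0 : 0 < p := pow2_gt0 _.
  set N := #|I|%:R in h *.
  have -> : N = (N * (p / c0)) * (c0 / p) by field; rewrite ?gt_eqF.
  have -> : 2 * c0 ^+ 2 * (a / p) = (2 * c0 * a) * (c0 / p) by field; rewrite gt_eqF.
  by rewrite ler_wpM2r// divr_ge0// ltW.
(* For [i < 2] the radius [2 ^- i.-1] is too large, and the whole of [G] takes the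
   place of the enclosing ball. *)
have [i2|i2] := leqP 2 i; last first.
  apply: (key G) => [v x []//|]; apply: le_trans hausdorff_G_le _.
  rewrite lee_fin ler_peMr ?mulr_ge0 ?(ltW c0_gt0)// pow2_ge1// mulr_ge0//.
  by rewrite subr_ge0 (ler_nat _ i 1).
apply: (key (G `&` ball (g v0) (2 ^- i.-1))).
  move=> v x [Gx]; rewrite ballE => xv; split => //; rewrite ballE.
  apply: le_lt_trans (metric_triangle _ (g v) _) _.
  have h1 : mdist (g v0) (g v) < 2 ^- i.
    apply: cell_mdist; rewrite -!(cell_div _ ij) (gP v).2 (gP v0).2.
    have /andP[/andP[_ /eqP ->] _] := valP v.
    by have /andP[/andP[_ /eqP ->] _] := valP v0.
  have h2 : 2 ^- j <= 2 ^- i :> R by rewrite lef_pV2 ?posrE ?exprn_gt0// ler_eXn2l ?ltr1n.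
  have h3 : 2 ^- i.-1 = 2 * 2 ^- i :> R.
    by rewrite -[in RHS](prednK (ltnW i2)) exprS invfM mulrA divff ?mul1r.
  by rewrite h3; rewrite /r in xv; lra.
have := hA (gP v0).1 (natV_itv (_ : 0 < i.-1)%N).
rewrite -subn1 subn_gt0 => /(_ i2) /andP[_]; move/le_trans; apply.
rewrite lee_fin pow2_natVs -mulNr natrB ?(ltnW i2)// opprB.
by rewrite ler_wpM2r ?pow2_ge0// ler_peMl ?(ltW c0_gt0)// ler1n.
Qed.

Lemma gcount_le j i u : (i <= j)%N ->
  (gcount j i u)%:R <= 32 * c0 ^+ 2 * pow2 ((j%:R - i%:R) * s) :> R.
Proof.
move=> ij; rewrite /gcount (bigID (fun v : 'I_(2 ^ j) => odd v == true))/= natrD.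
have := gcount_parity u true ij; have := gcount_parity u false ij => h1 h2.
rewrite [X in _ + X](_ : _ = (\sum_(v < 2 ^ j |
    (gcell j v && (v %/ 2 ^ (j - i) == u)) && (odd v == false)) 1)%N%:R); last first.
  by congr (_%:R); apply: eq_bigl => v; case: (odd v).
lra.
Qed.

(** The set [G] may touch a cell near its boundary only and leave it almost
    empty. The heavy cells are those in which the count of [gcount_le] is sharp
    at all finer levels. *)
Definition heavy (i u : nat) := forall j, (i <= j)%N ->
  (6 * c0 ^+ 2)^-1 * pow2 ((j%:R - i%:R) * s) <= (gcount j i u)%:R :> R.

(** The ball of radius [2 ^- i] around [g] has measure of order [2 ^- i `^ s] and
    is covered by five cells of level [i], one of which has a fixed share of it.
    Since a cell of level [j] has measure at most [c0 * 2 ^- j `^ s], this one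
    has many subcells meeting [G]. *)
Lemma heavy_near i g : (0 < i)%N -> G g ->
  exists2 h, G h /\ mdist g h < 2 ^- i & heavy i (cell i h).
Proof.
move=> i0 Gg; have /andP[+ _] := hA Gg (natV_itv i0); rewrite pow2_natVs => mass.
have c0' := ltW c0_gt0.
pose W := near_cells i 2 (cell i g).
pose A v := G `&` ball g (2 ^- i) `&` [set y | cell i y = v].
have [[w ww]|none] := pselect (exists w,
    ((pow2 (- (i%:R * s)) / (6 * c0))%:E <= hausdorff_measure s (A w))%E).
  have [[h [[Gh]]]|no] := pselect (A w !=set0); last first.
    suff A0 : A w = set0.
      by move: ww; rewrite A0 hausdorff_measure_set0 lee_fin leNgt divr_gt0 ?pow2_gt0 ?mulr_gt0.
    by apply/seteqP; split => // y Ay; apply: no; exists y.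
  rewrite ballE => gh /= hw; exists h => //; rewrite hw => j ij.
  have j0 : (0 < j)%N := leq_trans i0 ij.
  have : (hausdorff_measure s (A w) <=
      ((gcount j i w)%:R * (c0 * pow2 (- (j%:R * s))))%:E)%E.
    apply: (@le_trans _ _ (hausdorff_measure s (\big[setU/set0]_(v < 2 ^ j |
        gcell j v && (v %/ 2 ^ (j - i) == w)%N) (G `&` [set y | cell j y = v])))).
      apply: hausdorff_measure_mono => y [[Gy _] /= yw].
      apply: (in_bigsetU (i := Ordinal (cell_lt j y))); rewrite ?mem_index_enum//=.
      by rewrite gcell_cell// cell_div// yw eqxx.
    apply: (@le_trans _ _ (\sum_(v < 2 ^ j | gcell j v && (v %/ 2 ^ (j - i) == w)%N)
        c0 * pow2 (- (j%:R * s)))%:E).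
      by apply: hausdorff_measure_bigsetU => v _; exact: hausdorff_cell_le.
    by rewrite lee_fin /gcount natr_sum mulr_suml; apply: ler_sum => v _; rewrite mul1r.
  move=> /(le_trans ww); rewrite lee_fin => h1.
  have -> : (j%:R - i%:R) * s = - (i%:R * s) + j%:R * s by ring.
  rewrite pow2D pow2N in h1 *; rewrite [pow2 (- (j%:R * s))]pow2N in h1.
  set p := pow2 (j%:R * s) in h1 *; set a := (pow2 (i%:R * s))^-1 in h1 *.
  have p0 : 0 < p := pow2_gt0 _; set N := (gcount j i w)%:R in h1 *.
  have -> : N = (N * (c0 * p^-1)) * (p / c0).
    by field; rewrite !gt_eqF.
  have -> : (6 * c0 ^+ 2)^-1 * (a * p) = (a / (6 * c0)) * (p / c0).
    by field; rewrite gt_eqF.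
  by rewrite ler_wpM2r// divr_ge0// ltW.
exfalso; apply: none; apply: contrapT => none.
have none' v : (hausdorff_measure s (A v) <= (pow2 (- (i%:R * s)) / (6 * c0))%:E)%E.
  by rewrite leNgt; apply/negP => h; apply: none; exists v; exact: ltW.
have : (hausdorff_measure s (G `&` ball g (2 ^- i)) <=
        (5 * (pow2 (- (i%:R * s)) / (6 * c0)))%:E)%E.
  apply: (@le_trans _ _ (hausdorff_measure s (\big[setU/set0]_(v <- W) A v))).
    apply: hausdorff_measure_mono => y [Gy]; rewrite ballE => gy.
    have Ay : A (cell i y) y by split=> //; split=> //; rewrite ballE.
    apply: in_bigsetU Ay => //.
    apply: near_cellsP; rewrite (lt_trans gy)// -[ltLHS]mul1r ltr_pM2r ?ltr1n//.
  apply: (@le_trans _ _ (\sum_(v <- W) pow2 (- (i%:R * s)) / (6 * c0))%:E).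
    by apply: hausdorff_measure_bigsetU => v _; exact: none'.
  rewrite lee_fin big_const_seq count_predT size_near_cells iter_addr_0.
  by rewrite -[leLHS]mulr_natl.
move=> /(le_trans mass); rewrite lee_fin leNgt => /negP; apply.
have := pow2_gt0 (- (i%:R * s)); set a := pow2 _ => a0.
have -> : 5 * (a / (6 * c0)) = (5 / 6) * (a / c0) by field; rewrite gt_eqF.
by rewrite gtr_pMl ?divr_gt0//; lra.
Qed.

End ahlfors.

(** * A criterion for positive Hausdorff measure *)

Lemma pow2_small {R : realType} (a x : R) : 0 < a -> 0 < x ->
  exists l0 : nat, forall l, (l0 <= l)%N -> pow2 (- (l%:R * a)) < x.
Proof.
move=> a0 x0.
have [n hn] : exists n : nat, x^-1 < 2 ^+ n.
  exists (Num.bound x^-1); rewrite (lt_le_trans (archi_boundP _)) ?invr_ge0 ?ltW//.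
  by rewrite -natrX ltr_nat ltn_expl.
pose l0 := Num.bound (n%:R / a); exists l0 => l ll.
rewrite pow2N invf_plt ?posrE ?pow2_gt0// (lt_le_trans hn)// -pow2_nat pow2_le//.
rewrite -ler_pdivrMr// (le_trans (ltW (archi_boundP _))) ?ler_nat//.
by rewrite divr_ge0// ltW.
Qed.

Section mass.
Context {R : realType}.
Implicit Types (f g : nat -> R).

Definition mass f (j i u : nat) : R :=
  \sum_(v < 2 ^ j | (v %/ 2 ^ (j - i) == u)%N) f v.

Lemma mass_partition f (P : pred nat) j i : (i <= j)%N ->
  \sum_(v < 2 ^ j | P (v %/ 2 ^ (j - i))%N) f v =
  \sum_(u < 2 ^ i | P u) mass f j i u.
Proof.
move=> ij.
have lt (v : 'I_(2 ^ j)) : (v %/ 2 ^ (j - i) < 2 ^ i)%N.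
  by rewrite ltn_divLR ?expn_gt0// -expnD addnC subnK.
rewrite (partition_big (fun v => Ordinal (lt v)) (fun u : 'I_(2 ^ i) => P u))//=.
apply: eq_bigr => u Pu; apply: eq_bigl => v.
by rewrite -val_eqE/= andbC; case: eqP => [->|].
Qed.

Lemma sum_mem_le (I : finType) (P : pred I) (f : I -> R) (h : I -> nat) (r : seq nat) :
  (forall v, 0 <= f v) ->
  \sum_(v | P v && (h v \in r)) f v <= \sum_(w <- r) \sum_(v | P v && (h v == w)) f v.
Proof.
move=> f0; elim: r => [|w r IH].
  by rewrite big_nil big1// => v; rewrite in_nil andbF.
rewrite big_cons (le_trans _ (lerD (lexx _) IH))//.
rewrite !(big_mkcond (fun v => _ && _)) -big_split/=; apply: ler_sum => v _.
rewrite in_cons; case: (P v) => //=; rewrite ?addr0//.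
case: eqP => _ /=; last by rewrite add0r.
by rewrite lerDl; case: ifP.
Qed.

End mass.

Section energy.
Context {R : realType}.
Variables (G : set (circle R)) (s tau : R).

(** The natural weight of [G], spread evenly over the cells that meet it. By
    [gcount_le] its total stays bounded as the level grows. *)
Definition cell_weight (j v : nat) : R := pow2 (- (j%:R * s)) * (gcell G j v)%:R.

(** A dyadic form of the [tau]-dimensional Riesz energy of the difference between
    [w] and the natural weight of [G]. *)
Definition discrepancy (w : nat -> R) (j : nat) : R :=
  \sum_(i < j.+1) pow2 (i%:R * tau) *
    \sum_(u < 2 ^ i) (mass w j i u - mass (cell_weight j) j i u) ^+ 2.

Lemma mass_cell_weight j i u :
  mass (cell_weight j) j i u = pow2 (- (j%:R * s)) * (gcount G j i u)%:R.
Proof.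
rewrite /mass /gcount natr_sum mulr_sumr [RHS]big_mkcondl/=.
by apply: eq_bigr => v _; rewrite /cell_weight; case: gcell; rewrite ?mulr0.
Qed.

Lemma discrepancy_term w j i u : (i <= j)%N -> (u < 2 ^ i)%N ->
  pow2 (i%:R * tau) * (mass w j i u - mass (cell_weight j) j i u) ^+ 2
    <= discrepancy w j.
Proof.
move=> ij ui; rewrite /discrepancy.
rewrite (bigD1 (Ordinal (ij : (i < j.+1)%N)))//= (bigD1 (Ordinal ui))//=.
rewrite mulrDr -addrA lerDl addr_ge0//.
  by rewrite mulr_ge0 ?pow2_ge0// sumr_ge0// => *; exact: sqr_ge0.
by apply: sumr_ge0 => l _; rewrite mulr_ge0 ?pow2_ge0// sumr_ge0// => *; exact: sqr_ge0.
Qed.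

End energy.

Section lower.
Context {R : realType}.
Variables (G : set (circle R)) (s c0 t tau : R).
Hypotheses (hs : 0 < s <= 1) (c0_gt0 : 0 < c0).
Hypothesis hA : forall (x : circle R) (r : R), G x -> 0 < r <= 1 / 2 ->
  ((r `^ s / c0)%:E <= hausdorff_measure s (G `&` ball x r) <= (c0 * r `^ s)%:E)%E.
Hypotheses (t_gt0 : 0 < t) (t_tau : t < tau) (tau_s : tau <= s).

Let Cu : R := 32 * c0 ^+ 2.
Let ch : R := (6 * c0 ^+ 2)^-1.
(** Small enough for the two error terms of [child_cell] to add up to less than
    the weight of the good cells. *)
Let kappa : R := Num.min 1 (ch / (18 * (18 * Cu))).

Let Cu0 : 0 < Cu. Proof. by rewrite mulr_gt0// exprn_gt0. Qed.
Let ch0 : 0 < ch. Proof. by rewrite invr_gt0 mulr_gt0// exprn_gt0. Qed.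
Let kappa0 : 0 < kappa.
Proof. by rewrite lt_min ltr01 divr_gt0// mulr_gt0// mulr_gt0. Qed.

Lemma mass_cell_weight_le j i u : (i <= j)%N ->
  mass (cell_weight G s j) j i u <= Cu * pow2 (- (i%:R * s)).
Proof.
move=> ij; rewrite mass_cell_weight mulrC -ler_pdivlMr ?pow2_gt0//.
apply: le_trans (gcount_le hs c0_gt0 hA u ij) _.
by rewrite -[leRHS]mulrA ler_wpM2l ?(ltW Cu0)// -pow2B pow2_le// mulrBl addrC opprK.
Qed.

Lemma mass_cell_weight_heavy j i u : (i <= j)%N -> heavy G s c0 i u ->
  ch * pow2 (- (i%:R * s)) <= mass (cell_weight G s j) j i u.
Proof.
move=> ij /(_ j ij) h; rewrite mass_cell_weight [leRHS]mulrC -ler_pdivrMr ?pow2_gt0//.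
apply: le_trans h.
by rewrite -[leLHS]mulrA ler_wpM2l ?(ltW ch0)// -pow2B pow2_le// mulrBl addrC opprK.
Qed.

(** Twice the bound of [mass_cell_weight_le] for a cell of level [i] inside one of
    level [i0], with the decay in [i] relaxed from exponent [s] to exponent
    [tau]. *)
Let theta (i0 i : nat) : R := 2 * Cu * pow2 (- (i%:R * tau)) * pow2 (- (i0%:R * (s - tau))).

Let theta_gt0 i0 i : 0 < theta i0 i.
Proof. by rewrite !mulr_gt0 ?pow2_gt0. Qed.

Let mass_le_theta j i i0 u : (i0 <= i <= j)%N ->
  mass (cell_weight G s j) j i u <= theta i0 i / 2.
Proof.
move=> /andP[i0i ij]; apply: le_trans (mass_cell_weight_le u ij) _.
have -> : theta i0 i / 2 = Cu * (pow2 (- (i%:R * tau)) * pow2 (- (i0%:R * (s - tau)))).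
  by rewrite /theta; field.
rewrite ler_wpM2l ?(ltW Cu0)// -pow2D pow2_le//.
have : i0%:R * (s - tau) <= i%:R * (s - tau).
  by rewrite ler_wpM2r ?subr_ge0// ler_nat.
lra.
Qed.

(** Discarding these cells leaves a weight that satisfies a Frostman condition
    of exponent [tau] at all scales below [i0]. *)
Definition killed (w : nat -> R) (j i0 v : nat) : bool :=
  [exists i : 'I_j.+1, (i0 <= i)%N && (theta i0 i < mass w j i (v %/ 2 ^ (j - i)))].

(** A cell whose mass [m] exceeds [theta i0 i] has natural mass at most
    [theta i0 i / 2], so it contributes at least [m ^+ 2 / 4], hence at least
    [m * theta i0 i / 4], to the discrepancy. *)
Lemma killed_mass w j i0 : (forall v, 0 <= w v) -> (i0 <= j)%N ->
  \sum_(v < 2 ^ j | killed w j i0 v) w v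
    <= 2 / Cu * pow2 (i0%:R * (s - tau)) * discrepancy G s tau w j.
Proof.
move=> w0 i0j.
apply: (@le_trans _ _ (\sum_(i < j.+1 | (i0 <= i)%N)
    \sum_(v < 2 ^ j | theta i0 i < mass w j i (v %/ 2 ^ (j - i))) w v)).
  rewrite (exchange_big_dep predT)//= big_mkcond/=; apply: ler_sum => v _.
  case: ifPn => [/existsP[i /andP[i0i bad]]|_].
    by rewrite (bigD1 i) ?i0i//= lerDl sumr_ge0.
  by rewrite sumr_ge0.
rewrite /discrepancy mulr_sumr big_mkcond/=; apply: ler_sum => i _.
case: ifPn => [i0i|_]; last first.
  apply: mulr_ge0; first by rewrite mulr_ge0 ?pow2_ge0// divr_ge0// ltW.
  by rewrite mulr_ge0 ?pow2_ge0// sumr_ge0// => *; exact: sqr_ge0.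
have ij : (i <= j)%N by rewrite -ltnS ltn_ord.
rewrite (mass_partition w (fun u => theta i0 i < mass w j i u) ij) big_mkcond/=.
rewrite mulrA mulr_sumr; apply: ler_sum => u _.
set m := mass w j i u; set l := mass (cell_weight _ _ _) _ _ _.
have C0 : 2 / Cu * pow2 (i0%:R * (s - tau)) * pow2 (i%:R * tau) = 4 / theta i0 i.
  rewrite /theta !pow2N; field.
  by rewrite !gt_eqF ?pow2_gt0.
rewrite C0; have th0 := theta_gt0 i0 i.
case: ifPn => [bad|_]; last by rewrite mulr_ge0 ?sqr_ge0// divr_ge0// ltW.
rewrite mulrAC ler_pdivlMr//.
have hl : l <= theta i0 i / 2 by apply: mass_le_theta; rewrite i0i.
have m0 : 0 < m by exact: lt_trans bad.
have h2 : m / 2 <= m - l by lra.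
have h3 : (m / 2) ^+ 2 <= (m - l) ^+ 2 by rewrite ler_sqr// ?nnegrE ?divr_ge0//; lra.
apply: (@le_trans _ _ (m * m)); first by rewrite ler_pM2l// ltW.
have -> : m * m = 4 * (m / 2) ^+ 2 by field.
by rewrite ler_wpM2l.
Qed.

(** Cells are half open. Their closed neighbourhoods still contain the limits of
    points chosen in a nested sequence of cells. *)
Definition cell_nbhd (i u : nat) : set (circle R) :=
  [set y | exists2 z, cell i z = u & mdist y z <= 2 ^- i].

Variables (A : nat -> set (circle R)).
(** At arbitrarily fine levels, a weight close to the natural one lives on cells
    of [G] whose neighbourhoods are contained in some [A k]. *)
Hypothesis hD : forall (eta : R) (M : nat), 0 < eta -> exists k j w,
  [/\ (M <= k)%N, (M <= j)%N, (forall v, 0 <= w v),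
   (forall v, 0 < w v -> gcell G j v /\
     forall y z, cell j y = v -> mdist y z <= 2 ^- j -> A k z) &
   discrepancy G s tau w j < eta].

Section cover.
(** A cover by sets [F k], with [a k] an upper bound for the [t]-th power of the
    diameter of [F k]. *)
Variables (F : nat -> set (circle R)) (a : nat -> R).
Hypothesis a_gt0 : forall k, 0 < a k.
Hypothesis Fa : forall k y z, F k y -> F k z -> mdist y z <= a k `^ t^-1.

Let meets k i u : bool := `[< F k `&` cell_nbhd i u !=set0 >].

Definition cost (n i u : nat) : R := \sum_(k < n | meets k i u) a k.

Lemma cost_mono m n i u : (m <= n)%N -> cost m i u <= cost n i u.
Proof.
move=> mn; rewrite /cost (big_ord_widen_cond _ (fun k => meets k i u) a mn).
rewrite big_mkcondr; apply: ler_sum => k _; case: ifP => // _; exact: ltW.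
Qed.

Lemma cost_term k n i u : (k < n)%N -> meets k i u -> a k <= cost n i u.
Proof.
move=> kn mk; rewrite /cost (bigD1 (Ordinal kn))//= lerDl sumr_ge0// => *.
exact: ltW.
Qed.

(** The dyadic scale of a length [u], where lengths below [2 ^- j] are treated as
    if they were [2 ^- j]. *)
Let level_of (j i0 : nat) (u : R) : (i0 <= j)%N -> u <= 2 ^- i0 ->
  exists i, [/\ (i0 <= i <= j)%N, u <= 2 ^- i & i = j \/ 2 ^- i < 2 * u].
Proof.
move=> i0j ui0; pose P i := (i0 <= i <= j)%N && (u <= 2 ^- i).
have exP : exists i, P i by exists i0; rewrite /P leqnn i0j.
have ub i : P i -> (i <= j)%N by case/andP => /andP[].
case: (ex_maxnP exP ub) => i /andP[/andP[i0i ij] ui] imax.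
exists i; rewrite i0i ij ui; split => //.
move: ij; rewrite leq_eqVlt => /orP[/eqP|ij]; [by left|right].
rewrite ltNge; apply/negP => h.
have /imax : P i.+1.
  rewrite /P (leq_trans i0i)//= ij/=.
  by rewrite -(ler_pM2l (ltr0n R 2)) exprS invfM mulrA divff// mul1r.
by rewrite ltnn.
Qed.

(** The step of the construction: a heavy cell near which the cover is cheap has
    a much smaller heavy cell with the same property, inside some [A k]. The
    candidates are the heavy cells [gh v] of level [j.+2] next to the good cells
    [v]. If near each of them the cover cost more than the permitted amount [K],
    then the average over the good cells of the sum of [Num.min (a m) K] would be
    at least [K]. But by the Frostman condition the good cells met by [F m] weigh
    at most about the [tau]-th power of its diameter. Since [t < tau], this is
    small compared with [a m], and the sum of the [a m] is itself small by the
    assumption on the larger cell. *)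
Lemma child_cell i0 Q M : heavy G s c0 i0 Q -> (Q < 2 ^ i0)%N ->
  (forall n, cost n i0 Q <= kappa * pow2 (- (i0%:R * t))) ->
  exists k i1 h, [/\ (M <= k)%N, (i0 < i1)%N, G h,
    heavy G s c0 i1 (cell i1 h) /\
    (forall n, cost n i1 (cell i1 h) <= kappa * pow2 (- (i1%:R * t))) &
    forall y z, cell_nbhd i1 (cell i1 h) z -> mdist z y <= 2 ^- i1 ->
      cell_nbhd i0 Q y /\ A k y].
Proof.
move=> hQ Qlt costQ.
pose B := pow2 (- (i0%:R * s)).
have B0 : 0 < B by exact: pow2_gt0.
have Cu0' := ltW Cu0; have K0' := ltW kappa0;
have C18 : 0 <= 18 * Cu by rewrite mulr_ge0.
have C36 : 0 <= 36 * Cu by rewrite mulr_ge0.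
have B0' := ltW B0; have ch0' := ltW ch0.
pose e1 : R := pow2 (i0%:R * tau) * (ch / 2 * B) ^+ 2.
pose e2 : R := ch / 4 * B / (2 / Cu * pow2 (i0%:R * (s - tau))).
have e10 : 0 < e1 by rewrite mulr_gt0 ?pow2_gt0// exprn_gt0// mulr_gt0// divr_gt0.
have q20 : 0 < 2 / Cu * pow2 (i0%:R * (s - tau)) by rewrite mulr_gt0 ?pow2_gt0// divr_gt0.
have e20 : 0 < e2 by rewrite divr_gt0// mulr_gt0// divr_gt0.
have tt0 : 0 < tau - t by rewrite subr_gt0.
have x0 : 0 < ch / (18 * (36 * Cu)) by rewrite divr_gt0// mulr_gt0// mulr_gt0.
have [l0 hl0] := pow2_small tt0 x0.
have e0 : 0 < Num.min e1 e2 by rewrite lt_min e10.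
have [k [j [w [Mk Mj w0 wG]]]] := hD (maxn M (i0 + l0)) e0.
rewrite lt_min => /andP[D1 D2].
have i0j : (i0 <= j)%N by clear -Mj; lia.
have l0j : (l0 <= j - i0)%N by clear -Mj; lia.
(* The discrepancy being below [e1], the cell [Q] has about its natural mass. *)
have lowQ : ch / 2 * B <= mass w j i0 Q.
  have h1 := mass_cell_weight_heavy i0j hQ.
  have := le_lt_trans (discrepancy_term G s tau w i0j Qlt) D1.
  rewrite ltr_pM2l ?pow2_gt0// => h2.
  have {h2} : `|mass w j i0 Q - mass (cell_weight G s j) j i0 Q| < ch / 2 * B.
    rewrite -(ltr_pXn2r (_ : (0 < 2)%N)) ?nnegrE ?normr_ge0//.
      by rewrite real_normK ?num_real.
    by rewrite mulr_ge0 ?(ltW B0)// divr_ge0.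
  rewrite ltr_norml -/B in h1 * => /andP[h2 _].
  have -> : ch / 2 * B = ch * B - ch / 2 * B by field.
  lra.
pose good (v : 'I_(2 ^ j)) := [&& (v %/ 2 ^ (j - i0) == Q)%N, ~~ killed w j i0 v & 0 < w v].
(* The discrepancy being below [e2], at most half of it is discarded. *)
have goodmass : ch / 4 * B <= \sum_(v | good v) w v.
  have h1 : mass w j i0 Q <= \sum_(v | good v) w v + \sum_(v < 2 ^ j | killed w j i0 v) w v.
    rewrite /mass !(big_mkcond (fun v => good v)) (big_mkcond (fun v => killed _ _ _ _)).
    rewrite (big_mkcond (fun v => _ == _)) -big_split/=; apply: ler_sum => v _.
    rewrite /good; case: eqP => _ /=; last by case: ifP; rewrite add0r.
    case: (killed _ _ _ _) => /=; first by rewrite add0r.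
    by rewrite addr0; case: ltP.
  have h2 := killed_mass w0 i0j.
  have h3 : 2 / Cu * pow2 (i0%:R * (s - tau)) * discrepancy G s tau w j <= ch / 4 * B.
    by rewrite mulrC -ler_pdivlMr// ltW.
  have -> : ch / 4 * B = ch / 2 * B - ch / 4 * B by field.
  lra.
have c : circle R by exists 0; rewrite lexx ltr01.
(* [gh v] is a pair: a point of the cell [v], and a nearby point of [G] in a heavy
   cell two levels down. *)
have /choice[gh ghP] (v : 'I_(2 ^ j)) : exists gh : circle R * circle R, good v ->
    [/\ cell j gh.1 = v, G gh.2, mdist gh.1 gh.2 < 2 ^- j.+2 & heavy G s c0 j.+2 (cell j.+2 gh.2)].
  have [/and3P[_ _ wv]|_] := boolP (good v); last by exists (c, c).
  have [/asboolP[g Gg gv] _] := wG _ wv.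
  by have [h [Gh gh] hh] := heavy_near c0_gt0 hA (ltn0Sn j.+1) Gg; exists (g, h).
have qj : 2 ^- j = 4 * 2 ^- j.+2 :> R.
  by rewrite !exprS !invfM; lra.
have q0 : 0 < 2 ^- j.+2 :> R by rewrite invr_gt0 exprn_gt0.
have incl v y z : good v -> cell_nbhd j.+2 (cell j.+2 (gh v).2) z -> mdist z y <= 2 ^- j.+2 ->
    mdist (gh v).1 y < 2 ^- j.
  move=> /ghP[_ _ gh1 _] [z' /cell_mdist z'h zz'] zy.
  have := metric_triangle (gh v).1 (gh v).2 y.
  have := metric_triangle (gh v).2 z' y; have := metric_triangle z' z y.
  rewrite (metric_sym z' z) (metric_sym (gh v).2 z'); rewrite qj; lra.
have qi0 : 2 ^- j <= 2 ^- i0 :> R by rewrite lef_pV2 ?posrE ?exprn_gt0// ler_eXn2l ?ltr1n.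
have inQ v y : good v -> mdist (gh v).1 y < 2 ^- j -> cell_nbhd i0 Q y.
  move=> gv gy; exists (gh v).1; last by rewrite metric_sym (le_trans (ltW gy)).
  by rewrite -(cell_div _ i0j); have [-> _ _ _] := ghP v gv; have /and3P[/eqP] := gv.
pose K := kappa * pow2 (- (j.+2%:R * t)).
have K0 : 0 < K by rewrite mulr_gt0 ?pow2_gt0.
apply: contrapT => none.
have /choice[nn nnP] (v : 'I_(2 ^ j)) : exists n, good v -> K < cost n j.+2 (cell j.+2 (gh v).2).
  have [gv|_] := boolP (good v); last by exists 0%N.
  apply: contrapT => no; apply: none; exists k, j.+2, (gh v).2.
  have [gvj Ghv gh1 hh] := ghP v gv; split => //.
  - by clear -Mk; lia.
  - by clear -i0j; lia.
  - split=> // n; rewrite leNgt; apply/negP => h; apply: no; by exists n.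
  - move=> y z nz zy; have gy := incl _ _ _ gv nz zy; split; first exact: inQ gy.
    have /and3P[_ _ wv] := gv; have [_ hAk] := wG _ wv.
    by apply: hAk gvj _; exact: ltW.
pose n := (\max_v nn v)%N.
have {}nnP v : good v -> K < cost n j.+2 (cell j.+2 (gh v).2).
  by move=> gv; rewrite (lt_le_trans (nnP _ gv))// cost_mono// leq_bigmax.
pose meet (m : 'I_n) v := meets m j.+2 (cell j.+2 (gh v).2).
(* One [F m] of cost at least [K] suffices, or all costs are below [K]. *)
have step1 v : good v -> K <= \sum_(m < n | meet m v) Num.min (a m) K.
  move=> gv; have [[m mm Kam]|small] := pselect (exists2 m, meet m v & K <= a m).
    rewrite (bigD1 m)//= (elimT min_idPr Kam) lerDl sumr_ge0// => m' _.
    by rewrite le_min !ltW.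
  rewrite (eq_bigr (fun m : 'I_n => a m)); first exact/ltW/nnP.
  move=> m mm; apply/min_idPl; rewrite leNgt; apply/negP => /ltW h.
  by apply: small; exists m.
pose X : R := 18 * Cu * pow2 (- (j%:R * tau)) * pow2 (- (i0%:R * (s - tau))) +
    K * (36 * Cu * (B * pow2 (i0%:R * t))).
have X1 : 0 <= 18 * Cu * pow2 (- (j%:R * tau)) * pow2 (- (i0%:R * (s - tau))).
  by rewrite mulr_ge0 ?pow2_ge0// mulr_ge0 ?pow2_ge0.
have X2 : 0 <= K * (36 * Cu * (B * pow2 (i0%:R * t))).
  by rewrite mulr_ge0 ?(ltW K0)// mulr_ge0// mulr_ge0// pow2_ge0.
(* The bound is linear in [a m], so that it can be summed over [m]. The first
   term of [X] serves the covering sets smaller than [2 ^- j], the second one the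
   larger ones. *)
have step2 (m : 'I_n) : Num.min (a m) K * \sum_(v | good v && meet m v) w v
    <= (if meets m i0 Q then a m else 0) * X.
  have [[v0 /andP[gv0 mv0]]|no] := pselect (exists v, good v && meet m v); last first.
    rewrite big1 ?mulr0; last by move=> v gmv; exfalso; apply: no; exists v.
    by rewrite mulr_ge0 ?addr_ge0//; case: ifP => // _; exact: ltW.
  have /asboolP[y0 [Fy0 ny0]] := mv0.
  have gy0 : mdist (gh v0).1 y0 < 2 ^- j by apply: incl ny0 _; rewrite // mdistxx ltW.
  have mQ : meets m i0 Q by apply/asboolP; exists y0; split => //; exact: inQ gy0.
  rewrite mQ.
  have am : a m <= kappa * pow2 (- (i0%:R * t)).
    exact: le_trans (cost_term (ltnSn m) mQ) (costQ _).
  have am' : a m <= pow2 (- (i0%:R * t)).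
    by rewrite (le_trans am)// ler_piMl ?pow2_ge0// ge_min lexx.
  pose u := a m `^ t^-1.
  have u0 : 0 < u by rewrite powR_gt0.
  have ut : u `^ t = a m.
    by rewrite /u -powRrM mulVf ?gt_eqF// powRr1// ltW.
  have ui0 : u <= 2 ^- i0.
    rewrite -pow2_natV.
    have -> : - i0%:R = - (i0%:R * t) * t^-1 :> R by rewrite mulNr mulfK ?gt_eqF.
    rewrite pow2M; apply: ge0_ler_powR; rewrite ?invr_ge0 ?nnegrE ?pow2_ge0//; exact: ltW.
  have [i [/andP[i0i ij] ui iu]] := level_of i0j ui0.
  have qij : 2 ^- j <= 2 ^- i :> R by rewrite lef_pV2 ?posrE ?exprn_gt0// ler_eXn2l ?ltr1n.
  have th := theta_gt0 i0 i.
  have th9 : 0 <= 9 * theta i0 i by rewrite mulr_ge0// ltW.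
  have am0 := ltW (a_gt0 m); have K0l := ltW K0.
  (* All good cells met by [F m] lie in the nine cells of level [i] around the
     one of [v0], and none of these nine is overloaded if it contains a good
     cell. *)
  have mk : \sum_(v | good v && meet m v) w v <= 9 * theta i0 i.
    pose r := near_cells i 4 (cell i (gh v0).1).
    apply: (@le_trans _ _ (\sum_(v | good v && ((v %/ 2 ^ (j - i))%N \in r)) w v)).
      rewrite big_mkcond [leRHS]big_mkcond; apply: ler_sum => v _.
      case: ifPn => [/andP[gv /asboolP[y [Fy ny]]]|_]; last by case: ifP.
      suff -> : (v %/ 2 ^ (j - i))%N \in r by rewrite gv.
      have [<- _ _ _] := ghP v gv; rewrite cell_div//; apply: near_cellsP.
      have gy : mdist (gh v).1 y < 2 ^- j by apply: incl ny _; rewrite // mdistxx ltW.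
      have := Fa Fy0 Fy; rewrite -/u => yy.
      have := metric_triangle (gh v0).1 y0 (gh v).1; have := metric_triangle y0 y (gh v).1.
      rewrite (metric_sym y (gh v).1).
      have : 0 < 2 ^- i :> R by rewrite invr_gt0 exprn_gt0.
      by rewrite -[4%:R]/(4 : R); lra.
    apply: le_trans (sum_mem_le _ _ _ _) _ => //.
    apply: (@le_trans _ _ (\sum_(x <- r) theta i0 i)).
      apply: ler_sum => x _.
      have [[v1 /andP[gv1 /eqP pv1]]|no] :=
          pselect (exists v, good v && (v %/ 2 ^ (j - i) == x)%N); last first.
        by rewrite big1 ?ltW// => v gv; exfalso; apply: no; exists v.
      apply: (@le_trans _ _ (mass w j i x)).
        rewrite /mass big_mkcondl/=; apply: ler_sum => v _; by case: ifP.
      rewrite leNgt; apply/negP => bad; have /and3P[_ /negP[]] := gv1.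
      by apply/existsP; exists (Ordinal (ij : (i < j.+1)%N)); rewrite /= i0i pv1.
    rewrite big_const_seq count_predT size_near_cells iter_addr_0.
    by rewrite -[leLHS]mulr_natl.
  apply: le_trans (ler_wpM2l _ mk) _; first by rewrite le_min !ltW.
  case: iu => [ij'|iu].
    apply: (@le_trans _ _ (a m * (9 * theta i0 i))).
      by rewrite ler_wpM2r// ge_min lexx.
    rewrite ler_wpM2l// /X -[leLHS]addr0; apply: lerD => //.
    by rewrite ij' /theta !mulrA ler_wpM2r ?pow2_ge0// ler_wpM2r ?pow2_ge0//; lra.
  apply: (@le_trans _ _ (K * (9 * theta i0 i))).
    by rewrite ler_wpM2r// ge_min lexx orbT.
  have utau : pow2 (- (i%:R * tau)) <= 2 * (a m * pow2 (- (i0%:R * (tau - t)))).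
    apply: (@le_trans _ _ ((2 * u) `^ tau)).
      rewrite -mulNr pow2M pow2_natV; apply: ge0_ler_powR; rewrite ?nnegrE.
      - exact: ltW (lt_trans t_gt0 t_tau).
      - by rewrite invr_ge0 exprn_ge0.
      - by rewrite mulr_ge0// ltW.
      - exact: ltW.
    rewrite (powRM _ (ler0n R 2) (ltW u0)); apply: ler_pM; rewrite ?powR_ge0//.
      rewrite -[leRHS]powRr1// ler_powR ?ler1n//.
      by have /andP[_ s1] := hs; exact: le_trans s1.
    have {1}-> : tau = t + (tau - t) by ring.
    rewrite powRD; last by rewrite (gt_eqF u0) implybT.
    rewrite ut ler_wpM2l ?(ltW (a_gt0 m))// -mulNr pow2M pow2_natV.
    apply: ge0_ler_powR; rewrite ?nnegrE ?invr_ge0 ?exprn_ge0// ltW//.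
  apply: (@le_trans _ _ (K * (9 * (2 * Cu * (2 * (a m * pow2 (- (i0%:R * (tau - t))))) *
      pow2 (- (i0%:R * (s - tau))))))).
    rewrite ler_wpM2l ?(ltW K0)// ler_wpM2l// /theta ler_wpM2r ?pow2_ge0//.
    by rewrite ler_wpM2l// mulr_ge0.
  apply: (@le_trans _ _ (a m * (K * (36 * Cu * (B * pow2 (i0%:R * t)))))); last first.
    by rewrite ler_wpM2l// lerDr.
  have -> : B * pow2 (i0%:R * t) =
      pow2 (- (i0%:R * (tau - t))) * pow2 (- (i0%:R * (s - tau))).
    by rewrite -!pow2D; congr pow2; ring.
  move: (pow2 _) (pow2 _) => p1 p2.
  by apply/le_of_eq; ring.
have step3 : K * (ch / 4 * B) <= X * (kappa * pow2 (- (i0%:R * t))).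
  apply: (@le_trans _ _ (\sum_(v | good v) w v * K)).
    by rewrite -mulr_suml mulrC ler_wpM2r ?(ltW K0).
  apply: (@le_trans _ _ (\sum_(v | good v) w v * \sum_(m < n | meet m v) Num.min (a m) K)).
    by apply: ler_sum => v gv; rewrite ler_wpM2l ?w0 ?step1.
  under eq_bigr do rewrite mulr_sumr.
  rewrite (exchange_big_dep predT)//=.
  apply: (@le_trans _ _ (\sum_(m < n) (if meets m i0 Q then a m else 0) * X)).
    apply: ler_sum => m _; apply: le_trans (step2 m); rewrite mulr_sumr.
    by apply/le_of_eq; apply: eq_bigr => v _; rewrite mulrC.
  rewrite -mulr_suml -big_mkcond/= mulrC ler_wpM2l//.
    exact: addr_ge0.
  exact: costQ.
have kap : kappa <= ch / (18 * (18 * Cu)) by rewrite ge_min lexx orbT.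
have part2 : K * (36 * Cu * (B * pow2 (i0%:R * t))) * (kappa * pow2 (- (i0%:R * t)))
    <= K * (ch / 9 * B).
  have -> : K * (36 * Cu * (B * pow2 (i0%:R * t))) * (kappa * pow2 (- (i0%:R * t))) =
     K * (36 * Cu * B * kappa) * (pow2 (i0%:R * t) * pow2 (- (i0%:R * t))) by ring.
  rewrite -pow2D subrr pow20 mulr1 ler_wpM2l ?(ltW K0)//.
  have -> : ch / 9 * B = 36 * Cu * B * (ch / (18 * (18 * Cu))).
    by field; rewrite gt_eqF.
  by rewrite ler_wpM2l// !mulr_ge0// ltW.
have part1 : 18 * Cu * pow2 (- (j%:R * tau)) * pow2 (- (i0%:R * (s - tau))) *
    (kappa * pow2 (- (i0%:R * t))) <= K * (ch / 9 * B).
  have jE : j%:R = i0%:R + (j - i0)%:R :> R by rewrite -natrD subnKC.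
  have := hl0 _ l0j; set d := (j - i0)%:R in jE * => hd.
  have -> : 18 * Cu * pow2 (- (j%:R * tau)) * pow2 (- (i0%:R * (s - tau))) *
      (kappa * pow2 (- (i0%:R * t))) =
    (18 * Cu * kappa) * (pow2 (- (j%:R * tau)) * pow2 (- (i0%:R * (s - tau))) *
      pow2 (- (i0%:R * t))) by ring.
  have -> : pow2 (- (j%:R * tau)) * pow2 (- (i0%:R * (s - tau))) * pow2 (- (i0%:R * t)) =
     pow2 (- (d * (tau - t))) * (B * (pow2 (- (j.+2%:R * t)) * pow2 (2 * t))).
    rewrite -!pow2D; congr pow2; rewrite -addn2 natrD jE; ring.
  have t2 : pow2 (2 * t) <= 4.
    have -> : 4 = pow2 2%:R :> R by rewrite pow2_nat; ring.
    rewrite pow2_le// ler_piMr//; have /andP[_ s1] := hs.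
    exact: le_trans (ltW t_tau) (le_trans tau_s s1).
  rewrite /K; set P := pow2 (- (j.+2%:R * t)).
  have P0 : 0 < P := pow2_gt0 _.
  apply: (@le_trans _ _ (18 * Cu * kappa * (ch / (18 * (36 * Cu)) * (B * (P * 4))))).
    rewrite ler_wpM2l ?(mulr_ge0 C18 K0')//; apply: ler_pM.
    - exact: pow2_ge0.
    - by rewrite mulr_ge0// mulr_ge0 ?pow2_ge0// ltW.
    - exact: ltW.
    - by rewrite ler_wpM2l// ler_wpM2l// ltW.
  apply/le_of_eq; field; rewrite gt_eqF//.
have := lerD part1 part2; rewrite -mulrDl -/X => h.
have := le_trans step3 h; apply/negP; rewrite -ltNge -mulrDr ltr_pM2l// -mulrDl ltr_pM2r//.
have small (x : R) : 0 < x -> x / 9 + x / 9 < x / 4 by move=> ?; lra.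
exact: small.
Qed.

End cover.

Lemma cell_nbhd_self i y : cell_nbhd i (cell i y) y.
Proof. by exists y => //; rewrite mdistxx invr_ge0 exprn_ge0. Qed.

(** Otherwise there is a cover [F] of total cost below [e], so cheap that
    [child_cell] applies to a heavy cell of level [1] and can be iterated. The
    centres of the resulting cells have a cluster point [x], which is in [G] by
    compactness, in all the neighbourhoods and hence in infinitely many [A k]. So
    [x] is in some [F k], of positive cost, although the cost permitted near
    these cells tends to [0]. *)
Theorem hausdorff_limsup_neq0 : G !=set0 -> compact G ->
  hausdorff_measure t (G `&` [set y | forall M, exists2 k, (M <= k)%N & A k y]) <> 0%E.
Proof.
move=> [g0 Gg0] cG H0.
set E := G `&` _ in H0.
have [h0 [Gh0 _] hh0] := heavy_near c0_gt0 hA (ltn0Sn 0) Gg0.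
pose e : R := kappa * pow2 (- (1%:R * t)).
have e0 : 0 < e by rewrite mulr_gt0 ?pow2_gt0.
have e20 : 0 < e / 2 by rewrite divr_gt0.
have C0 : hausdorff_content t 1 E = 0%E.
  apply/eqP; rewrite eq_le hausdorff_content_ge0 andbT -H0.
  exact: content_le_measure.
have fC : hausdorff_content t 1 E \is a fin_num by rewrite C0.
have [_ [F [EF Fd] <-] hF] := lb_ereal_inf_adherent e20 fC.
have {}hF : (\sum_(0 <= k <oo) diam_pow t (F k) < (e / 2)%:E)%E.
  by apply: (lt_le_trans hF); rewrite -[X in (X + _)%E]/(hausdorff_content t 1 E) C0 add0e.
have dle n : (\sum_(0 <= k < n) diam_pow t (F k) <= (e / 2)%:E)%E.
  apply: le_trans (ltW hF); apply: nneseries_lim_ge => *; exact: diam_pow_ge0.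
have dfin k : diam_pow t (F k) \is a fin_num.
  rewrite ge0_fin_numE ?diam_pow_ge0//; apply: (@le_lt_trans _ _ (e / 2)%:E); last exact: ltry.
  apply: le_trans (dle k.+1); rewrite big_nat_recr//= leeDr// sume_ge0// => *; exact: diam_pow_ge0.
(* The second summand keeps the costs positive, also for singletons. *)
pose a k := fine (diam_pow t (F k)) + e / 2 / 2 ^+ k.+1.
have a_gt0 k : 0 < a k.
  by rewrite ltr_wpDl ?fine_ge0 ?diam_pow_ge0// !divr_gt0// exprn_gt0.
have Fa k y z : F k y -> F k z -> mdist y z <= a k `^ t^-1.
  move=> Fy Fz; have := mdist_pow_le (ltW t_gt0) Fy Fz.
  rewrite -(fineK (dfin k)) lee_fin => h.
  have h1 : mdist y z `^ t <= a k by rewrite (le_trans h)// lerDl !divr_ge0 ?exprn_ge0// ltW.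
  have -> : mdist y z = (mdist y z `^ t) `^ t^-1.
    by rewrite -powRrM mulfV ?gt_eqF// powRr1// mdist_ge0.
  by apply: ge0_ler_powR; rewrite ?invr_ge0 ?nnegrE ?powR_ge0//; exact: ltW.
have geo n : \sum_(k < n) e / 2 / 2 ^+ k.+1 = e / 2 * (1 - 2 ^- n) :> R.
  elim: n => [|n IH]; first by rewrite big_ord0 expr0 invr1 subrr mulr0.
  by rewrite big_ord_recr/= IH exprS invfM; field; rewrite expf_neq0.
have atot n i u : cost F a n i u <= e.
  apply: (@le_trans _ _ (\sum_(k < n) a k)).
    rewrite /cost big_mkcond; apply: ler_sum => k _; case: ifP => // _; exact: ltW.
  rewrite big_split/= geo [leRHS](splitr e) lerD//; last first.
    by rewrite ler_piMr ?(ltW e20)// lerBlDr lerDl invr_ge0 exprn_ge0.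
  rewrite -lee_fin; apply: le_trans (dle n); rewrite big_mkord -sumEFin.
  by apply: lee_sum => k _; rewrite fineK.
pose node := (nat * circle R)%type.
pose ok (x : node) := [/\ G x.2, heavy G s c0 x.1 (cell x.1 x.2) &
  forall n, cost F a n x.1 (cell x.1 x.2) <= kappa * pow2 (- (x.1%:R * t))].
pose link l (x x' : node) := [/\ (x.1 < x'.1)%N, ok x' &
  exists2 k, (l <= k)%N & forall y z, cell_nbhd x'.1 (cell x'.1 x'.2) z ->
    mdist z y <= 2 ^- x'.1 -> cell_nbhd x.1 (cell x.1 x.2) y /\ A k y].
have /choice[nxt nxtP] (lx : nat * node) : exists x', ok lx.2 -> link lx.1 lx.2 x'.
  case: lx => l [i y] /=; have [[/= Gy hy cy]|no] := pselect (ok (i, y)); last by exists (i, y).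
  have [k [i1 [h [lk ii Gh [hh ch'] nb]]]] := child_cell a_gt0 Fa l hy (cell_lt i y) cy.
  by exists (i1, h) => _; split=> //; exists k.
pose seqn := fix seqn l := if l is l'.+1 then nxt (l', seqn l') else (1%N, h0) : node.
have okn l : ok (seqn l).
  elim: l => [|l IH]; last by have [] := nxtP (l, seqn l) IH.
  by split => // n; exact: atot.
have lnk l : link l (seqn l) (seqn l.+1) := nxtP (l, seqn l) (okn l).
pose lev l := (seqn l).1; pose pt l := (seqn l).2.
have nest m l : (l <= m)%N -> cell_nbhd (lev l) (cell (lev l) (pt l)) (pt m).
  move=> lm; rewrite -(subnKC lm); move: (m - l)%N => d.
  suff H : forall d l : nat, cell_nbhd (lev (l + d)%N) (cell (lev (l + d)%N) (pt (l + d)%N))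
      `<=` cell_nbhd (lev l) (cell (lev l) (pt l)).
    by apply: H; exact: cell_nbhd_self.
  move=> {d lm} d {}l; elim: d => [|d IH] z; first by rewrite addn0.
  rewrite addnS => hz; apply: IH.
  have [_ _ [k _ /(_ z z hz)]] := lnk (l + d)%N.
  by rewrite mdistxx invr_ge0 exprn_ge0// => /(_ isT)[].
have ptG : (pt @ \oo) G by exists 0%N => // l _; have [] := okn l.
have [x [Gx clx]] := cG (pt @ \oo) _ ptG.
have key l : cell_nbhd (lev l) (cell (lev l) (pt l)) x /\ exists2 k, (l <= k)%N & A k x.
  have [_ _ [k lk nb]] := lnk l.
  pose r : R := 2 ^- lev l.+1.
  have r0 : 0 < r by rewrite invr_gt0 exprn_gt0.
  have A1 : (pt @ \oo) [set pt m | m in [set m | (l < m)%N]].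
    by exists l.+1 => //= m lm; exists m.
  have [_ [[m /= lm <-] bx]] := clx _ _ A1 (nbhsx_ballx x r r0).
  have [] := nb x (pt m) (nest _ _ lm).
    by rewrite metric_sym ltW//; move: bx; rewrite ballEmdist.
  by move=> nx Ax; split => //; exists k.
have Ex : E x by split=> // M; have [_] := key M.
have [k _ Fkx] := EF _ Ex.
have lv l : (l <= lev l)%N.
  by elim: l => // l IH; have [h _ _] := lnk l; exact: leq_ltn_trans IH h.
have [l0 hl0] := pow2_small t_gt0 (a_gt0 k).
have [_ _ cst] := okn l0.
have mk : `[< F k `&` cell_nbhd (lev l0) (cell (lev l0) (pt l0)) !=set0 >].
  by apply/asboolP; exists x; split => //; have [] := key l0.
have := le_trans (cost_term a_gt0 (ltnSn k) mk) (cst k.+1).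
apply/negP; rewrite -ltNge; apply: (@le_lt_trans _ _ (pow2 (- ((lev l0)%:R * t)))).
  by rewrite ler_piMl ?pow2_ge0// ge_min lexx.
exact: hl0.
Qed.

End lower.

(** * Orbits of the points of a finite grid *)

Section periodic.
Variables (V : nmodType) (L : nat) (f : nat -> V).
Hypothesis per : forall x, f (x + L)%N = f x.

Lemma sum_shift d : \sum_(x < L) f (x + d)%N = \sum_(x < L) f x.
Proof.
elim: d => [|d IH]; first by apply: eq_bigr => x _; rewrite addn0.
rewrite -[RHS]IH.
have h : \sum_(x < L.+1) f (x + d)%N = \sum_(x < L) f (x + d.+1)%N + f d.
  by rewrite big_ord_recl addrC; congr (_ + _); apply: eq_bigr => x _; rewrite /= addSnnS.
case: L per h => [|n] p h; first by rewrite !big_ord0.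
rewrite big_ord_recr [RHS]big_ord_recl [RHS]addrC /=.
congr (_ + _); first by apply: eq_bigr => x _; rewrite /= addSnnS.
by rewrite add0n -[RHS]p; congr f; lia.
Qed.

End periodic.

Section residues.
Variable L : nat.
Hypothesis L0 : (0 < L)%N.

(** Position of the multiple [z / L] of [1 / L] on the circle, in units of
    [1 / L]. *)
Definition resz (z : int) : nat := absz (z %% L%:Z)%Z.

Lemma reszE z : (resz z)%:Z = (z %% L%:Z)%Z.
Proof. by rewrite /resz gez0_abs// modz_ge0//; lia. Qed.

Lemma resz_lt z : (resz z < L)%N.
Proof. by rewrite -ltz_nat reszE ltz_pmod// ltz_nat. Qed.

Lemma reszD (z y : int) (m : nat) : (y = m%:Z %[mod L%:Z])%Z ->
  resz (z + y) = ((resz z + m) %% L)%N.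
Proof.
move=> h; apply/eqP; rewrite -eqz_nat reszE -modz_nat PoszD reszE; apply/eqP.
by rewrite modzDml -modzDmr h modzDmr.
Qed.

Lemma resz_period q x : resz (q * (x + L)%N%:Z) = resz (q * x%:Z).
Proof.
rewrite PoszD mulrDr (@reszD _ _ 0); first by rewrite addn0 modn_small// resz_lt.
by rewrite modzMl mod0z.
Qed.

(** Translating [x] by [d] moves the point [q * x / L] of the circle by [1 / m]. *)
Lemma shift_exists (q : int) m : q != 0 -> (`|q|%N * m %| L)%N -> (0 < m)%N ->
  exists d : nat, (q * d%:Z = (L %/ m)%N%:Z %[mod L%:Z])%Z.
Proof.
move=> q0 /dvdnP[k kL] m0.
have Lm : (L %/ m = k * `|q|%N)%N by rewrite kL mulnA mulnK.
rewrite Lm; have [qp|qn] := leP 0 q.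
  exists k; congr (_ %% _)%Z; rewrite PoszM mulrC; congr (_ * _).
  by rewrite gez0_abs.
exists (k * (`|q|%N * m).-1)%N.
have qa : q = - (`|q|%N%:Z) by rewrite ltz0_abs// opprK.
have qm0 : (0 < `|q|%N * m)%N by rewrite muln_gt0 m0 absz_gt0 q0.
move: (absz q) qa qm0 kL => a -> am0 kL.
have -> : - a%:Z * (k * (a * m).-1)%N%:Z = - a%:Z * L%:Z + (k * a)%N%:Z.
  rewrite kL -{2}(prednK am0) !PoszM -addn1 PoszD; ring.
by rewrite modzMDl.
Qed.

(** A coset of the subgroup of order [b] of [Z / L] has one element in each
    interval of length [L / b]; the right-hand side lists them in increasing
    order. *)
Lemma coset_reindex (V : nmodType) (F : nat -> V) b th : (b %| L)%N -> (th < L)%N ->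
  \sum_(i < b) F ((th + i * (L %/ b)) %% L)%N =
  \sum_(k < b) F (th %% (L %/ b) + k * (L %/ b))%N.
Proof.
move=> bL thL; set h := (L %/ b)%N.
have b0 : (0 < b)%N by rewrite (dvdn_gt0 L0).
have Lbh : L = (b * h)%N by rewrite mulnC divnK.
pose f k := F (th %% h + (k %% b) * h)%N.
have per x : f (x + b)%N = f x by rewrite /f modnDr.
rewrite [RHS](eq_bigr (fun k : 'I_b => f k)); last by move=> k _; rewrite /f (modn_small (ltn_ord k)).
rewrite -[RHS](sum_shift per (th %/ h)); apply: eq_bigr => i _; rewrite /f; congr F.
rewrite {1}(divn_eq th h) addnAC -mulnDl addnC.
have h0 : (0 < h)%N by rewrite divn_gt0// dvdn_leq.
rewrite {1}(divn_eq (th %/ h + i) b) mulnDl -mulnA -Lbh addnCA modnMDl [(i + _)%N]addnC.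
rewrite modn_small// {1}Lbh.
have := ltn_pmod th h0; have := ltn_pmod (th %/ h + i) b0.
move: (_ %% b)%N (_ %% h)%N => x y xb yh.
by rewrite (leq_trans (n := h + x * h))// ?ltn_add2r// -mulSn leq_mul2r xb orbT.
Qed.

Lemma interval_count b th l w : (b %| L)%N -> (2 ^ l %| L)%N ->
  (\sum_(k < b) ((th + k * (L %/ b)) %/ (L %/ 2 ^ l) == w) <= b %/ 2 ^ l + 1)%N.
Proof.
move=> bL lL; set h := (L %/ b)%N; set Hl := (L %/ 2 ^ l)%N.
have b0 : (0 < b)%N by rewrite (dvdn_gt0 L0).
have Lbh : L = (b * h)%N by rewrite mulnC divnK.
have LHl : L = (2 ^ l * Hl)%N by rewrite mulnC divnK.
have P0 : (0 < 2 ^ l)%N by rewrite expn_gt0.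
have Hl0 : (0 < Hl)%N by rewrite divn_gt0// dvdn_leq.
pose P k := ((th + k * h) %/ Hl == w)%N.
have [[k0 [k0b Pk0 k0min]]|none] : (exists k0, [/\ (k0 < b)%N, P k0 & forall k, P k -> (k0 <= k)%N])
    \/ (forall k, (k < b)%N -> ~~ P k).
  have [[k /andP[kb Pk]]|no] := pselect (exists k, (k < b)%N && P k); [left|right].
    have exP : exists k, P k by exists k.
    case: (ex_minnP exP) => k0 Pk0 k0min; exists k0; split => //.
    exact: leq_ltn_trans (k0min _ Pk) kb.
  by move=> k kb; apply/negP => Pk; apply: no; exists k; rewrite kb.
  - have key k : P k -> (k < k0 + (b %/ 2 ^ l + 1))%N.
      move=> Pk; have kk := k0min _ Pk.
      rewrite -ltn_subLR// addn1 ltnS leq_divRL//.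
      have : ((k - k0) * h < Hl)%N.
        move: Pk Pk0 => /eqP Pk /eqP Pk0.
        have := ltn_ceil (th + k * h) Hl0; have := leq_divM (th + k0 * h) Hl.
        rewrite Pk Pk0 mulSn mulnBl => h1 h2; rewrite ltn_subLR ?leq_mul2r ?kk ?orbT//.
        lia.
      move=> lt; rewrite -ltnS; suff : ((k - k0) * 2 ^ l < b)%N by move/ltnW.
      have Ll0 : (0 < h * Hl)%N by rewrite muln_gt0 Hl0 divn_gt0// dvdn_leq.
      rewrite -(ltn_pmul2r Hl0) -mulnA -LHl Lbh mulnCA ltn_pmul2l//.
    rewrite -/P (eq_bigr (fun k : 'I_b => P k : nat))//.
    apply: (@leq_trans (\sum_(k < b | (k0 <= k < k0 + (b %/ 2 ^ l + 1))%N) 1)%N).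
      rewrite [leqRHS]big_mkcond; apply: leq_sum => k _; case: (boolP (P k)) => // Pk.
      by rewrite k0min// key.
    rewrite -(big_mkord (fun k => (k0 <= k < k0 + (b %/ 2 ^ l + 1))%N) (fun=> 1%N)).
    rewrite sum1_count -size_filter.
    rewrite -[leqRHS](size_iota k0); apply: uniq_leq_size.
      by rewrite filter_uniq// /index_iota iota_uniq.
    by move=> k; rewrite mem_filter mem_iota => /andP[].
  - by rewrite big1// => k _; apply/eqP; rewrite eqb0; exact: none.
Qed.

Variable j : nat.
Hypothesis jL : (2 ^ j %| L)%N.

(** The cell of level [j] that contains the point [q * x / L] of the circle. *)
Definition dcell (q : int) (x : nat) : nat := (resz (q * x%:Z) %/ (L %/ 2 ^ j))%N.

Let H := (L %/ 2 ^ j)%N.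
Let LH : L = (2 ^ j * H)%N. Proof. by rewrite mulnC divnK. Qed.
Let H0 : (0 < H)%N. Proof. by rewrite divn_gt0 ?expn_gt0// dvdn_leq. Qed.

Lemma dcell_lt q x : (dcell q x < 2 ^ j)%N.
Proof. by rewrite /dcell ltn_divLR// -LH resz_lt. Qed.

Lemma dcell_period q x : dcell q (x + L) = dcell q x.
Proof. by rewrite /dcell resz_period. Qed.

(** Translations of [x] permute the cells cyclically, so that all cells are
    visited equally often. *)
Lemma dcell_uniform q v : q != 0 -> (`|q|%N * 2 ^ j %| L)%N -> (v < 2 ^ j)%N ->
  (2 ^ j * \sum_(x < L) (dcell q x == v) = L)%N.
Proof.
move=> q0 qL vj.
have P0 : (0 < 2 ^ j)%N by rewrite expn_gt0.
have [d hd] := shift_exists q0 qL P0.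
pose U v := (\sum_(x < L) (dcell q x == v))%N.
have step w : (w.+1 < 2 ^ j)%N -> U w = U w.+1.
  move=> wj; rewrite /U.
  rewrite -[RHS](@sum_shift _ L (fun x => dcell q x == w.+1 : nat) _ d); last first.
    by move=> x; rewrite dcell_period.
  apply: eq_bigr => x _; congr nat_of_bool.
  rewrite /dcell PoszD mulrDr (reszD _ hd) -/H.
  have := resz_lt (q * x%:Z); set r := resz _ => rL.
  have : (r %/ H < 2 ^ j)%N by rewrite ltn_divLR// -LH.
  set a := (r %/ H)%N => aj.
  have [lt|ge] := ltnP (r + H) L.
    by rewrite (modn_small lt) divnDr ?dvdnn// divnn H0 addn1 eqSS.
  have HL : (H <= L)%N by rewrite leq_div.
  have sm : (r + H - L < L)%N by clear -rL HL ge; lia.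
  have -> : ((r + H) %% L = r + H - L)%N.
    by rewrite -{1}(subnK ge) modnDr modn_small.
  rewrite divn_small; last by clear -rL HL ge; lia.
  rewrite eqn_leq; apply/negbTE; rewrite negb_and -!ltnNge; apply/orP; left.
  rewrite /a leq_divRL// -(leq_add2r H); apply: leq_trans ge.
  by rewrite LH addnC -mulSn leq_mul2r wj orbT.
have Uc w : (w < 2 ^ j)%N -> U w = U 0%N.
  by elim: w => // w IH wj; rewrite -step// IH// ltnW.
rewrite -/(U v) Uc//.
have -> : (2 ^ j * U 0 = \sum_(w < 2 ^ j) U w)%N.
  under eq_bigr do rewrite Uc//.
  by rewrite sum_nat_const card_ord.
rewrite /U exchange_big/= -[RHS](card_ord L) -sum1_card; apply: eq_bigr => x _.
rewrite (bigD1 (Ordinal (dcell_lt q x)))//= eqxx big1// => w.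
by rewrite -val_eqE/= eq_sym => /negbTE ->.
Qed.

(** Bezout coefficients give a translation of [x] that fixes the point
    [q1 * x / L] and moves [q2 * x / L] by [1 / b]. Hence, given the first point,
    the second one is uniformly distributed on a coset of the subgroup of order
    [b] of the circle. *)
Lemma pair_shift (q1 q2 : int) : q1 != 0 -> (`|q1|%N %| L)%N ->
  let b := (`|q1|%N %/ gcdn `|q1| `|q2|)%N in
  exists d : nat, (q1 * d%:Z = 0 %[mod L%:Z])%Z /\
    (q2 * d%:Z = (L %/ b)%N%:Z %[mod L%:Z])%Z.
Proof.
move=> q10 q1L.
have g0 : (0 < gcdn `|q1| `|q2|)%N by rewrite gcdn_gt0 absz_gt0 q10.
set g := gcdn _ _ in g0 *; move=> b.
have q1b : `|q1|%N = (b * g)%N by rewrite divnK// dvdn_gcdl.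
have b0 : (0 < b)%N by rewrite divn_gt0// dvdn_leq ?absz_gt0// dvdn_gcdl.
pose a := (q2 %/ g%:Z)%Z.
have q2a : q2 = a * g%:Z by rewrite divzK// /g; apply: dvdn_gcdr.
have cop : coprimez a b%:Z.
  rewrite /coprimez /gcdz eqz_nat /= -(eqn_pmul2r g0) mul1n muln_gcdl.
  rewrite -q1b; have -> : (`|a| * g = `|q2|)%N by rewrite q2a abszM.
  by rewrite gcdnC.
have /coprimezP[[u v] /= uv] := cop.
have /dvdnP[k kL] := q1L.
pose d : nat := resz (u * k%:Z).
exists d.
have dE (q : int) : (q * d%:Z = q * (u * k%:Z) %[mod L%:Z])%Z.
  by rewrite /d reszE modzMmr.
have Lb : (L %/ b = k * g)%N by rewrite kL q1b mulnCA mulKn.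
split; rewrite dE.
  have [s ->] : exists s : int, q1 * (u * k%:Z) = s * L%:Z.
    exists (u * sgz q1); rewrite kL PoszM {1}(intEsg q1).
    ring.
  by rewrite modzMl mod0z.
rewrite Lb q2a.
have -> : a * g%:Z * (u * k%:Z) = - v * L%:Z + (k * g)%N%:Z.
  have -> : a * g%:Z * (u * k%:Z) = (u * a + v * b%:Z) * (k%:Z * g%:Z) - v * (k%:Z * (b%:Z * g%:Z)).
    by ring.
  by rewrite uv kL q1b !PoszM; ring.
by rewrite modzMDl.
Qed.

End residues.

Section pairs.
Context {R : realType}.
Variables (G : set (circle R)) (L j : nat).
Hypotheses (L0 : (0 < L)%N) (jL : (2 ^ j %| L)%N).

Definition ucell (j' i u v : nat) : bool := gcell G j' v && (v %/ 2 ^ (j' - i) == u)%N.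

(** The resolution [l] is free between [i] and [j]: each cell of level [l] that
    meets [G] receives at most [b %/ 2 ^ l + 1] of the [b] equally spaced points. *)
Lemma coset_gcount b th i l u : (b %| L)%N -> (i <= l <= j)%N ->
  (\sum_(k < b) ucell j i u ((th + k * (L %/ b)) %/ (L %/ 2 ^ j)) <=
   gcount G l i u * (b %/ 2 ^ l + 1))%N.
Proof.
move=> bL /andP[il lj].
have lL : (2 ^ l %| L)%N by apply: dvdn_trans jL; exact: dvdn_exp2l.
have Hl : (L %/ 2 ^ l = (L %/ 2 ^ j) * 2 ^ (j - l))%N.
  have e : (2 ^ j = 2 ^ (j - l) * 2 ^ l)%N by rewrite -expnD subnK.
  by rewrite -{1}(divnK jL); set X := (L %/ 2 ^ j)%N; rewrite e mulnA mulnK ?expn_gt0.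
apply: (@leq_trans (\sum_(k < b) \sum_(w < 2 ^ l | ucell l i u w)
    ((th + k * (L %/ b)) %/ (L %/ 2 ^ l) == w))%N).
  apply: leq_sum => k _; set y := (th + _)%N.
  case: (boolP (ucell _ _ _ _)) => // /andP[gv /eqP vu].
  have gw := gcell_parent lj gv.
  have wE : (y %/ (L %/ 2 ^ j) %/ 2 ^ (j - l) = y %/ (L %/ 2 ^ l))%N.
    by rewrite Hl divnMA.
  rewrite wE in gw.
  rewrite (bigD1 (Ordinal (gcell_lt gw)))/=; first by rewrite eqxx leq_addr.
  rewrite /ucell gw/= -vu -wE -divnMA -expnD.
  by have -> : (j - l + (l - i) = j - i)%N by clear -il lj; lia.
rewrite exchange_big/= /gcount big_distrl/=; apply: leq_sum => w _.
by rewrite mul1n; exact: (interval_count L0 th w bL lL).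
Qed.

Lemma sum_ucell q i u : q != 0 -> (`|q|%N * 2 ^ j %| L)%N ->
  (2 ^ j * \sum_(x < L) ucell j i u (dcell L j q x) = gcount G j i u * L)%N.
Proof.
move=> q0 qL.
have -> : (\sum_(x < L) ucell j i u (dcell L j q x) =
    \sum_(v < 2 ^ j | ucell j i u v) \sum_(x < L) (dcell L j q x == v))%N.
  rewrite exchange_big/=; apply: eq_bigr => x _.
  rewrite big_mkcond (bigD1 (Ordinal (dcell_lt L0 jL q x)))//= eqxx big1 ?addn0.
    by case: ucell.
  by move=> v; rewrite -val_eqE/= eq_sym => /negbTE ->; case: ifP.
rewrite big_distrr/= /gcount big_distrl/=; apply: eq_bigr => v _.
by rewrite mul1n dcell_uniform.
Qed.

(** Average over the translations of [pair_shift], then apply [coset_gcount] to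
    the second orbit. *)
Lemma pair_bound q1 q2 b i l u : q1 != 0 -> (`|q1|%N * 2 ^ j %| L)%N ->
  (i <= l <= j)%N -> b = (`|q1|%N %/ gcdn `|q1| `|q2|)%N ->
  (b * 2 ^ j * \sum_(x < L) (ucell j i u (dcell L j q1 x) && ucell j i u (dcell L j q2 x))
   <= L * gcount G j i u * (gcount G l i u * (b %/ 2 ^ l + 1)))%N.
Proof.
move=> q10 q1L ilj bE.
have q1L' : (`|q1| %| L)%N by apply: dvdn_trans q1L; exact: dvdn_mulr.
have g0 : (0 < gcdn `|q1| `|q2|)%N by rewrite gcdn_gt0 absz_gt0 q10.
have bq : (b %| `|q1|)%N by rewrite bE; exact/dvdn_div/dvdn_gcdl.
have bL : (b %| L)%N := dvdn_trans bq q1L'.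
have [d [d1 d2]] := pair_shift L0 q2 q10 q1L'; rewrite -bE in d2.
pose f x : nat := ucell j i u (dcell L j q1 x) && ucell j i u (dcell L j q2 x).
have per x : f (x + L)%N = f x by rewrite /f !dcell_period.
have s1 k x : dcell L j q1 (x + k * d)%N = dcell L j q1 x.
  rewrite /dcell PoszD mulrDr (reszD L0 _ (m := 0)).
    by rewrite addn0 modn_small// resz_lt.
  by rewrite PoszM mulrCA -modzMmr d1 mod0z mulr0 !mod0z.
have s2 k x : dcell L j q2 (x + k * d)%N =
    (((resz L (q2 * x%:Z) + k * (L %/ b)) %% L) %/ (L %/ 2 ^ j))%N.
  rewrite /dcell PoszD mulrDr (reszD L0 _ (m := (k * (L %/ b))%N))//.
  by rewrite !PoszM mulrCA -[in LHS](modzMmr _ (q2 * _)) d2 modzMmr.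
have sumk : (b * \sum_(x < L) f x = \sum_(x < L) \sum_(k < b) f (x + k * d))%N.
  rewrite exchange_big/= [RHS](eq_bigr (fun=> \sum_(x < L) f x)%N); last first.
    by move=> k _; exact: (sum_shift per).
  by rewrite sum_nat_const card_ord.
rewrite mulnAC -/f sumk.
apply: (@leq_trans (\sum_(x < L) ucell j i u (dcell L j q1 x) *
    (gcount G l i u * (b %/ 2 ^ l + 1)) * 2 ^ j)%N).
  rewrite big_distrl/=; apply: leq_sum => x _; rewrite leq_mul2r; apply/orP; right.
  rewrite (eq_bigr (fun k : 'I_b => ucell j i u (dcell L j q1 x) * ucell j i u
      (((resz L (q2 * x%:Z) + k * (L %/ b)) %% L) %/ (L %/ 2 ^ j))))%N; last first.
    by move=> k _; rewrite /f s1 s2 mulnb.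
  rewrite -big_distrr/= leq_mul2l; apply/orP; right.
  rewrite (coset_reindex (V := nat) L0 (fun y => ucell j i u (y %/ (L %/ 2 ^ j))))//; last first.
    exact: resz_lt.
  exact: coset_gcount.
rewrite -big_distrl -big_distrl/= mulnAC [(_ * 2 ^ j)%N]mulnC (sum_ucell i u q10 q1L).
by rewrite [(_ * L)%N]mulnC.
Qed.

End pairs.

(** * The second moment of the discrepancy *)

Section geometric.
Context {R : realType}.

Lemma geometric_pow2 (a : R) n : 0 < a ->
  \sum_(i < n) pow2 (- (i%:R * a)) <= (1 - pow2 (- a))^-1.
Proof.
move=> a0; have q1 : pow2 (- a) < 1 by rewrite -pow20 pow2_lt// oppr_lt0.
have q0 := pow2_gt0 (- a); have d0 : 0 < 1 - pow2 (- a) by rewrite subr_gt0.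
have -> : \sum_(i < n) pow2 (- (i%:R * a)) = \sum_(i < n) pow2 (- a) ^+ i.
  by apply: eq_bigr => i _; rewrite mulrC -mulNr pow2M powR_mulrn ?ltW.
rewrite -(ler_pM2l d0) divff ?gt_eqF// -opprB mulNr -subrX1 opprB.
by rewrite lerBlDr lerDl exprn_ge0// ltW.
Qed.

Lemma geometric_pow2_up (a : R) j : 0 < a ->
  \sum_(i < j.+1) pow2 (i%:R * a) <= (1 - pow2 (- a))^-1 * pow2 (j%:R * a).
Proof.
move=> a0; rewrite (reindex_inj rev_ord_inj)/=.
have -> : \sum_(i < j.+1) pow2 ((j.+1 - i.+1)%:R * a) =
   (\sum_(i < j.+1) pow2 (- (i%:R * a))) * pow2 (j%:R * a).
  rewrite mulr_suml; apply: eq_bigr => i _; rewrite -pow2D subSS natrB -1?ltnS//.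
  by congr pow2; ring.
by rewrite ler_wpM2r ?pow2_ge0// geometric_pow2.
Qed.

End geometric.

Section second_moment.
Context {R : realType}.
Variables (G : set (circle R)) (s c0 tau : R).
Hypotheses (hs : 0 < s <= 1) (c0_gt0 : 0 < c0).
Hypothesis hA : forall (x : circle R) (r : R), G x -> 0 < r <= 1 / 2 ->
  ((r `^ s / c0)%:E <= hausdorff_measure s (G `&` ball x r) <= (c0 * r `^ s)%:E)%E.
Hypotheses (tau_gt0 : 0 < tau) (tau_s : tau < s).

Let Cu : R := 32 * c0 ^+ 2.
Let Cg : R := (1 - pow2 (- tau))^-1 + (1 - pow2 (- (s - tau)))^-1.

Let Cu0 : 0 <= Cu. Proof. by rewrite mulr_ge0// exprn_ge0// ltW. Qed.

Let inv_ge0 (a : R) : 0 < a -> 0 <= (1 - pow2 (- a))^-1.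
Proof. by move=> a0; rewrite invr_ge0 subr_ge0 pow2_le1// oppr_le0 ltW. Qed.

Let Cg0 : 0 <= Cg.
Proof. by rewrite addr_ge0// inv_ge0// subr_gt0. Qed.

Let geo1 j : \sum_(i < j.+1) pow2 (i%:R * tau) <= Cg * pow2 (j%:R * tau).
Proof.
apply: le_trans (geometric_pow2_up j tau_gt0) _; rewrite ler_wpM2r ?pow2_ge0//.
by rewrite lerDl inv_ge0// subr_gt0.
Qed.

Let geo2 j : \sum_(i < j.+1) pow2 (i%:R * tau) * pow2 (- (i%:R * s)) <= Cg.
Proof.
have st : 0 < s - tau by rewrite subr_gt0.
have -> : \sum_(i < j.+1) pow2 (i%:R * tau) * pow2 (- (i%:R * s)) =
   \sum_(i < j.+1) pow2 (- (i%:R * (s - tau))).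
  by apply: eq_bigr => i _; rewrite -pow2D; congr pow2; ring.
by apply: le_trans (geometric_pow2 _ st) _; rewrite lerDr inv_ge0.
Qed.

Variables (j N L : nat) (qs : 'I_N -> int).
Hypotheses (N0 : (0 < N)%N) (L0 : (0 < L)%N) (qs0 : forall n, qs n != 0).
Hypothesis qL : forall n, (`|qs n|%N * 2 ^ j %| L)%N.

Let kap : R := pow2 (j%:R * (1 - s)) / N%:R.

(** The points [qs n * x / L] of the orbit that lie in cells meeting [G], weighted
    by a factor that makes the average over [x] the natural weight of [G]. *)
Definition orbit_weight (x v : nat) : R :=
  kap * \sum_n ((dcell L j (qs n) x == v) && gcell G j v)%:R.

(** The order of the subgroup on which [qs m * x / L] is uniform once
    [qs n * x / L] is known. *)
Definition reduced_den (n m : 'I_N) : nat := (`|qs n| %/ gcdn `|qs n| `|qs m|)%N.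

Lemma reduced_den_gt0 n m : (0 < reduced_den n m)%N.
Proof.
have q0 : (0 < `|qs n|)%N by rewrite absz_gt0 qs0.
by rewrite /reduced_den divn_gt0 ?gcdn_gt0 ?q0// dvdn_leq// dvdn_gcdl.
Qed.

(** Contribution of a pair with reduced denominator [b] to the variance. The first
    bound counts at resolution [2 ^- j] and is useful for [b] well above
    [2 ^ j]. The second counts at resolution [1 / B]. *)
Definition pair_cost (b : nat) : R :=
  let B := (minn b (2 ^ j))%:R in
  Num.min (2 ^+ j / b%:R)
    (pow2 (j%:R * (1 - s)) * (pow2 (j%:R * tau) + B `^ s) / B).

Let n0 : 'I_N := Ordinal N0.

Let jL : (2 ^ j %| L)%N.
Proof. by apply: dvdn_trans (qL n0); exact: dvdn_mull. Qed.

Let chi i u n x : R := (ucell G j i u (dcell L j (qs n) x))%:R.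

Let p i u : R := (gcount G j i u)%:R * 2 ^- j.

Let kap0 : 0 < kap.
Proof. by rewrite divr_gt0 ?pow2_gt0// ltr0n. Qed.

Lemma mass_orbit_weight x i u : mass (orbit_weight x) j i u = kap * \sum_n chi i u n x.
Proof.
rewrite /mass /orbit_weight -mulr_sumr exchange_big/=; congr (_ * _).
apply: eq_bigr => n _; rewrite /chi /ucell big_mkcond/=.
rewrite (bigD1 (Ordinal (dcell_lt L0 jL (qs n) x)))//= eqxx/= big1.
  by rewrite addr0; case: eqP; rewrite ?andbF ?andbT.
by move=> v; rewrite -val_eqE/= eq_sym => /negbTE ->; case: ifP.
Qed.

Let sum_chi i u n : \sum_(x < L) chi i u n x = L%:R * p i u.
Proof.
have := sum_ucell G L0 jL i u (qs0 n) (qL n); move/(congr1 (fun m : nat => m%:R : R)).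
rewrite !natrM natr_sum /p natrX => h.
have e0 : 2 ^+ j != 0 :> R by rewrite expf_neq0.
apply: (mulfI e0); rewrite h.
by field.
Qed.

Let cell_weightE i u : mass (cell_weight G s j) j i u = kap * N%:R * p i u.
Proof.
rewrite mass_cell_weight /kap /p divfK ?pnatr_eq0 -?lt0n//.
rewrite mulrCA mulrC -pow2_natV -pow2D; congr (_ * pow2 _); ring.
Qed.

(** Expanding the square: the terms with [m = n] contribute [N * p], the others
    the excess of their correlation over the product of the means. *)
Let variance_le i u (ex : 'I_N -> 'I_N -> R) :
  (forall n m, m != n ->
    \sum_(x < L) chi i u n x * chi i u m x <= L%:R * (p i u ^+ 2 + ex n m)) ->
  \sum_(x < L) (mass (orbit_weight x) j i u - mass (cell_weight G s j) j i u) ^+ 2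
  <= L%:R * kap ^+ 2 * (N%:R * p i u + \sum_n \sum_(m | m != n) ex n m).
Proof.
move=> hex; set P := p i u.
have P0 : 0 <= P by rewrite mulr_ge0// invr_ge0 exprn_ge0.
have LR : 0 < L%:R :> R by rewrite ltr0n.
have -> : \sum_(x < L) (mass (orbit_weight x) j i u - mass (cell_weight G s j) j i u) ^+ 2 =
    kap ^+ 2 * (\sum_(x < L) (\sum_n chi i u n x) ^+ 2 - L%:R * (N%:R * P) ^+ 2).
  have S1 : \sum_(x < L) \sum_n chi i u n x = N%:R * (L%:R * P).
    rewrite exchange_big/= (eq_bigr (fun=> L%:R * P)); last by move=> n _; exact: sum_chi.
    by rewrite sumr_const card_ord -[LHS]mulr_natl.
  transitivity (kap ^+ 2 * (\sum_(x < L) (\sum_n chi i u n x) ^+ 2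
      - 2 * (N%:R * P) * (\sum_(x < L) \sum_n chi i u n x) + \sum_(x < L) (N%:R * P) ^+ 2)).
    rewrite [2 * _ * _]mulr_sumr -sumrB -big_split/= mulr_sumr; apply: eq_bigr => x _.
    by rewrite mass_orbit_weight cell_weightE -/P; ring.
  rewrite S1 sumr_const card_ord -[_ *+ L]mulr_natl; congr (_ * _); ring.
rewrite -[leRHS]mulrA [leRHS]mulrCA ler_wpM2l ?exprn_ge0 ?(ltW kap0)// lerBlDr.
have -> : \sum_(x < L) (\sum_n chi i u n x) ^+ 2 =
   \sum_n \sum_m \sum_(x < L) chi i u n x * chi i u m x.
  under eq_bigr => x _.
    rewrite expr2 mulr_suml; under eq_bigr do rewrite mulr_sumr.
    over.
  by rewrite exchange_big/=; apply: eq_bigr => n _; rewrite exchange_big.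
apply: (@le_trans _ _ (\sum_n (L%:R * P + \sum_(m | m != n) L%:R * (P ^+ 2 + ex n m)))).
  apply: ler_sum => n _; rewrite (bigD1 n)//=; apply: lerD.
    rewrite -(sum_chi i u n); apply/le_of_eq; apply: eq_bigr => x _.
    by rewrite /chi; case: ucell; rewrite ?mulr1 ?mulr0.
  by apply: ler_sum => m mn; exact: hex.
rewrite big_split/= sumr_const card_ord -[_ *+ N]mulr_natl mulrDr [L%:R * (_ * P)]mulrCA.
rewrite -addrA lerD2l mulr_sumr.
have -> : L%:R * (N%:R * P) ^+ 2 = \sum_(n < N) N%:R * (L%:R * P ^+ 2).
  by rewrite sumr_const card_ord -[_ *+ N]mulr_natl; ring.
rewrite -big_split/=; apply: ler_sum => n _.
under eq_bigr do rewrite mulrDr.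
rewrite big_split/= -[X in _ + X <= _]mulr_sumr [leRHS]addrC lerD2r sumr_const -[leLHS]mulr_natl.
rewrite ler_wpM2r ?mulr_ge0 ?exprn_ge0 ?(ltW LR)// ler_nat.
by rewrite -[leqRHS]card_ord max_card.
Qed.

Let sum_gcount i : (i <= j)%N -> \sum_(u < 2 ^ i) (gcount G j i u)%:R <= Cu * pow2 (j%:R * s).
Proof.
move=> ij; have gE i' u : (gcount G j i' u)%:R = mass (fun v => (gcell G j v)%:R : R) j i' u.
  rewrite /gcount /mass natr_sum [LHS]big_mkcondl/=; apply: eq_bigr => v _.
  by case: gcell.
under eq_bigr do rewrite gE.
have := mass_partition (fun v => (gcell G j v)%:R : R) predT ij => /= <-.
have := gcount_le hs c0_gt0 hA 0 (leq0n j); rewrite subr0 gE; apply: le_trans.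
rewrite /mass subn0 [leRHS](eq_bigl predT)// => v.
by rewrite divn_small ?eqxx.
Qed.

Let gcount_pow i u : (i <= j)%N -> (gcount G j i u)%:R <= Cu * pow2 (j%:R * s) * pow2 (- (i%:R * s)).
Proof.
move=> ij; apply: le_trans (gcount_le hs c0_gt0 hA u ij) _.
by rewrite -[leRHS]mulrA -pow2D mulrBl.
Qed.

Let S_chi i l u n m : (i <= l <= j)%N -> \sum_(x < L) chi i u n x * chi i u m x <=
   L%:R * p i u * ((gcount G l i u)%:R * ((reduced_den n m %/ 2 ^ l)%N%:R + 1) / (reduced_den n m)%:R).
Proof.
move=> il; have := pair_bound G L0 jL u (qs0 n) (qL n) il (erefl (reduced_den n m)).
have b0 : (0 < reduced_den n m)%N.
  exact: reduced_den_gt0.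
set b := reduced_den n m in b0 *.
rewrite -(ler_nat R) !natrM natr_sum natrD natrX => h.
have bR : 0 < b%:R :> R by rewrite ltr0n.
have -> : L%:R * p i u * ((gcount G l i u)%:R * ((b %/ 2 ^ l)%N%:R + 1) / b%:R) =
   L%:R * (gcount G j i u)%:R * ((gcount G l i u)%:R * ((b %/ 2 ^ l)%N%:R + 1)) / (b%:R * 2 ^+ j).
  by rewrite /p; field; rewrite (gt_eqF bR) expf_neq0.
rewrite ler_pdivlMr ?mulr_gt0 ?exprn_gt0// mulrC; apply: le_trans h; apply/le_of_eq.
by congr (_ * _); apply: eq_bigr => x _; rewrite /chi -natrM mulnb.
Qed.

(** Excess correlation at resolution [l = j]. *)
Let ex1 i u b : R := (gcount G j i u)%:R ^+ 2 * 2 ^- j / b%:R.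

Let ex1P i u n m : (i <= j)%N -> \sum_(x < L) chi i u n x * chi i u m x <=
  L%:R * (p i u ^+ 2 + ex1 i u (reduced_den n m)).
Proof.
move=> ij; apply: le_trans (S_chi u n m (_ : i <= j <= j)%N) _; first by rewrite ij leqnn.
have b0 : (0 < reduced_den n m)%N.
  exact: reduced_den_gt0.
set b := reduced_den n m in b0 *; have bR : 0 < b%:R :> R by rewrite ltr0n.
rewrite -mulrA ler_wpM2l// /p /ex1; set g := (gcount _ _ _ _)%:R.
have -> : (g * 2 ^- j) ^+ 2 + g ^+ 2 * 2 ^- j / b%:R =
    g * 2 ^- j * (g * (b%:R / 2 ^+ j + 1) / b%:R).
  by field; rewrite gt_eqF// expf_neq0.
rewrite ler_wpM2l ?mulr_ge0 ?invr_ge0 ?exprn_ge0// ler_wpM2r ?invr_ge0// ler_wpM2l//.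
by rewrite lerD2r ler_pdivlMr ?exprn_gt0// -natrX -natrM ler_nat leq_divM.
Qed.

(** Excess correlation at the resolution [2 ^- l] closest to [1 / b] among those
    with [i <= l <= j]. *)
Let ex2 i u b : R := let B := (minn b (2 ^ j))%:R in
  (gcount G j i u)%:R * 2 ^- j * (3 * Cu / B * (1 + B `^ s * pow2 (- (i%:R * s)))).

Let ex2P i u n m : (i <= j)%N -> \sum_(x < L) chi i u n x * chi i u m x <=
  L%:R * (p i u ^+ 2 + ex2 i u (reduced_den n m)).
Proof.
move=> ij.
have b0 : (0 < reduced_den n m)%N.
  exact: reduced_den_gt0.
suff [l ilj hl] : exists2 l, (i <= l <= j)%N &
   (gcount G l i u)%:R * ((reduced_den n m %/ 2 ^ l)%N%:R + 1) / (reduced_den n m)%:R <=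
   3 * Cu / (minn (reduced_den n m) (2 ^ j))%:R *
     (1 + (minn (reduced_den n m) (2 ^ j))%:R `^ s * pow2 (- (i%:R * s))).
  apply: le_trans (S_chi u n m ilj) _; rewrite -mulrA ler_wpM2l//.
  apply: (@le_trans _ _ (ex2 i u (reduced_den n m))); last by rewrite lerDr sqr_ge0.
  by rewrite /ex2 /p ler_wpM2l// mulr_ge0// invr_ge0 exprn_ge0.
set b := reduced_den n m in b0 *; have bR : 0 < b%:R :> R by rewrite ltr0n.
have s0 : 0 <= s by have /andP[/ltW] := hs.
have gl l : (i <= l)%N -> (gcount G l i u)%:R <= Cu * (pow2 (l%:R * s) * pow2 (- (i%:R * s))).
  by move=> il; have := gcount_le hs c0_gt0 hA u il; rewrite -pow2D mulrBl.
have divb l : (b %/ 2 ^ l)%N%:R * pow2 l%:R <= b%:R :> R.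
  by rewrite pow2_nat -natrX -natrM ler_nat leq_divM.
have [bj|jb] := leqP b (2 ^ j); last first.
  exists j; first by rewrite ij leqnn.
  have p0 : 0 < 2 ^+ j :> R by rewrite exprn_gt0.
  have bj : 2 ^+ j < b%:R :> R by rewrite -natrX ltr_nat.
  have h1 : ((b %/ 2 ^ j)%N%:R + 1) / b%:R <= 2 / 2 ^+ j :> R.
    rewrite ler_pdivrMr// mulrAC ler_pdivlMr//.
    by have := divb j; rewrite pow2_nat; lra.
  rewrite natrX -mulrA.
  have -> : (2 ^+ j) `^ s = pow2 (j%:R * s) :> R by rewrite pow2M pow2_nat.
  set y := pow2 (j%:R * s) * _; have y0 : 0 <= y by rewrite mulr_ge0 ?pow2_ge0.
  apply: (@le_trans _ _ (Cu * y * (2 / 2 ^+ j))).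
    by apply: ler_pM; rewrite ?gl// mulr_ge0 ?invr_ge0// addr_ge0.
  have -> : 3 * Cu / 2 ^+ j * (1 + y) = (Cu / 2 ^+ j) * (3 + 3 * y) by field; rewrite gt_eqF.
  have -> : Cu * y * (2 / 2 ^+ j) = (Cu / 2 ^+ j) * (2 * y) by field; rewrite gt_eqF.
  by rewrite ler_wpM2l ?divr_ge0 ?(ltW p0)//; lra.
have [ib|bi] := leqP (2 ^ i) b; last first.
  exists i; first by rewrite leqnn ij.
  rewrite divn_small// add0r mulr1.
  set y := b%:R `^ s * _; have y0 : 0 <= y by rewrite mulr_ge0 ?pow2_ge0 ?powR_ge0.
  have h : (gcount G i i u)%:R <= Cu.
    by have := gl i (leqnn i); rewrite -pow2D subrr pow20 mulr1.
  apply: (@le_trans _ _ (Cu / b%:R)); first by rewrite ler_wpM2r ?invr_ge0.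
  have -> : 3 * Cu / b%:R * (1 + y) = (Cu / b%:R) * (3 + 3 * y) by field; rewrite gt_eqF.
  by rewrite ler_peMr ?divr_ge0//; lra.
pose l := trunc_log 2 b.
have /andP[lb bl] := trunc_log_bounds (isT : (1 < 2)%N) b0.
have il : (i <= l)%N by rewrite trunc_log_max.
have lj : (l <= j)%N by rewrite -(@leq_exp2l 2)// (leq_trans lb).
exists l; first by rewrite il.
have h2 : ((b %/ 2 ^ l)%N%:R + 1) / b%:R <= 3 / b%:R :> R.
  rewrite ler_wpM2r ?invr_ge0//.
  have : (b %/ 2 ^ l <= 2)%N.
    by rewrite -ltnS ltn_divLR ?expn_gt0// (leq_trans bl)// expnS leq_mul2r orbT.
  by rewrite -(ler_nat R); lra.
have h3 : pow2 (l%:R * s) <= b%:R `^ s.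
  rewrite pow2M pow2_nat -natrX; apply: ge0_ler_powR; rewrite ?nnegrE//.
  by rewrite ler_nat.
rewrite -mulrA; set y := b%:R `^ s * _.
have y0 : 0 <= y by rewrite mulr_ge0 ?pow2_ge0 ?powR_ge0.
apply: (@le_trans _ _ (Cu * y * (3 / b%:R))).
  apply: ler_pM => //.
  apply: le_trans (gl l il) _; rewrite ler_wpM2l// /y ler_wpM2r ?pow2_ge0//.
have -> : 3 * Cu / b%:R * (1 + y) = (Cu / b%:R) * (3 + 3 * y) by field; rewrite gt_eqF.
have -> : Cu * y * (3 / b%:R) = (Cu / b%:R) * (3 * y) by field; rewrite gt_eqF.
by rewrite ler_wpM2l ?divr_ge0//; lra.
Qed.

Let energy_ex1 b : (0 < b)%N ->
  \sum_(i < j.+1) pow2 (i%:R * tau) * \sum_(u < 2 ^ i) kap ^+ 2 * ex1 i u b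
  <= Cu ^+ 2 * Cg * (2 ^+ j / b%:R) / N%:R ^+ 2.
Proof.
move=> b0; have bR : 0 < b%:R :> R by rewrite ltr0n.
have NR : 0 < N%:R :> R by rewrite ltr0n.
pose A := kap ^+ 2 * 2 ^- j / b%:R.
have A0 : 0 <= A.
  by rewrite mulr_ge0 ?invr_ge0 ?ler0n// mulr_ge0 ?sqr_ge0// invr_ge0 exprn_ge0.
have js0 : 0 <= pow2 (j%:R * s) := pow2_ge0 _.
apply: (@le_trans _ _ (\sum_(i < j.+1) A * (Cu ^+ 2 * pow2 (j%:R * s) ^+ 2) *
    (pow2 (i%:R * tau) * pow2 (- (i%:R * s))))).
  apply: ler_sum => i _; have ij : (i <= j)%N by rewrite -ltnS.
  rewrite [leRHS]mulrCA ler_wpM2l ?pow2_ge0//.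
  have -> : \sum_(u < 2 ^ i) kap ^+ 2 * ex1 i u b =
     A * \sum_(u < 2 ^ i) (gcount G j i u)%:R ^+ 2.
    by rewrite mulr_sumr; apply: eq_bigr => u _; rewrite /ex1 /A; ring.
  rewrite -[leRHS]mulrA ler_wpM2l//.
  apply: (@le_trans _ _ (\sum_(u < 2 ^ i) (Cu * pow2 (j%:R * s) * pow2 (- (i%:R * s))) *
     (gcount G j i u)%:R)).
    by apply: ler_sum => u _; rewrite expr2 ler_wpM2r// gcount_pow.
  rewrite -mulr_sumr; apply: le_trans (ler_wpM2l _ (sum_gcount ij)) _.
    by rewrite mulr_ge0 ?pow2_ge0// mulr_ge0.
  by apply/le_of_eq; ring.
rewrite -mulr_sumr; apply: le_trans (ler_wpM2l _ (geo2 j)) _.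
  by rewrite mulr_ge0// mulr_ge0 ?exprn_ge0.
apply/le_of_eq; rewrite /A /kap.
have -> : pow2 (j%:R * (1 - s)) = 2 ^+ j / pow2 (j%:R * s).
  by rewrite -pow2_nat -pow2B; congr pow2; ring.
field; rewrite (gt_eqF bR) (gt_eqF NR) expf_neq0// gt_eqF// pow2_gt0//.
Qed.

Let energy_ex2 b B : (0 < b)%N -> B = (minn b (2 ^ j))%:R ->
  \sum_(i < j.+1) pow2 (i%:R * tau) * \sum_(u < 2 ^ i) kap ^+ 2 * ex2 i u b
  <= 3 * Cu ^+ 2 * Cg * (pow2 (j%:R * (1 - s)) * (pow2 (j%:R * tau) + B `^ s) / B) / N%:R ^+ 2.
Proof.
move=> b0 BE; have BR : 0 < B :> R by rewrite BE ltr0n leq_min b0 expn_gt0.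
have NR : 0 < N%:R :> R by rewrite ltr0n.
pose A := kap ^+ 2 * 2 ^- j * (3 * Cu / B).
have A0 : 0 <= A.
  apply: mulr_ge0; first by rewrite mulr_ge0 ?sqr_ge0// invr_ge0 exprn_ge0.
  by rewrite divr_ge0 ?(ltW BR)// mulr_ge0.
have Bs0 : 0 <= B `^ s := powR_ge0 _ _.
have js0 : 0 <= pow2 (j%:R * s) := pow2_ge0 _.
apply: (@le_trans _ _ (\sum_(i < j.+1) A * (Cu * pow2 (j%:R * s)) *
    (pow2 (i%:R * tau) + B `^ s * (pow2 (i%:R * tau) * pow2 (- (i%:R * s)))))).
  apply: ler_sum => i _; have ij : (i <= j)%N by rewrite -ltnS.
  have -> : \sum_(u < 2 ^ i) kap ^+ 2 * ex2 i u b =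
     A * (1 + B `^ s * pow2 (- (i%:R * s))) * \sum_(u < 2 ^ i) (gcount G j i u)%:R.
    by rewrite mulr_sumr; apply: eq_bigr => u _; rewrite /ex2 /A -BE; ring.
  apply: le_trans (ler_wpM2l (pow2_ge0 _) (ler_wpM2l _ (sum_gcount ij))) _.
    by rewrite mulr_ge0// addr_ge0// mulr_ge0// pow2_ge0.
  by apply/le_of_eq; ring.
rewrite -mulr_sumr big_split/= -mulr_sumr.
apply: le_trans (ler_wpM2l _ (lerD (geo1 j) (ler_wpM2l Bs0 (geo2 j)))) _.
  by rewrite mulr_ge0// mulr_ge0.
apply/le_of_eq; rewrite /A /kap.
have -> : pow2 (j%:R * (1 - s)) = 2 ^+ j / pow2 (j%:R * s).
  by rewrite -pow2_nat -pow2B; congr pow2; ring.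
field; rewrite (gt_eqF BR) (gt_eqF NR) expf_neq0// gt_eqF// pow2_gt0//.
Qed.

(** For each pair the smaller of the two excesses is taken, uniformly in the level
    [i] and the cell [u]. The sums over [i] are geometric because
    [0 < tau < s]. *)
Lemma second_moment :
  \sum_(x < L) discrepancy G s tau (orbit_weight x) j <=
  L%:R * ((Cu + 3 * Cu ^+ 2) * Cg) * (pow2 (j%:R * (1 - s + tau)) / N%:R +
     (\sum_n \sum_(m | m != n) pair_cost (reduced_den n m)) / N%:R ^+ 2).
Proof.
have NR : 0 < N%:R :> R by rewrite ltr0n.
have b0 n m : (0 < reduced_den n m)%N.
  exact: reduced_den_gt0.
pose c1 b : R := 2 ^+ j / b%:R.
pose c2 b : R := let B := (minn b (2 ^ j))%:R in
    pow2 (j%:R * (1 - s)) * (pow2 (j%:R * tau) + B `^ s) / B.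
pose ex i u n m := let b := reduced_den n m in if c1 b <= c2 b then ex1 i u b else ex2 i u b.
have exP i u n m : (i <= j)%N -> \sum_(x < L) chi i u n x * chi i u m x <=
    L%:R * (p i u ^+ 2 + ex i u n m).
  by move=> ij; rewrite /ex; case: ifP => _; [exact: ex1P|exact: ex2P].
have exE n m : \sum_(i < j.+1) pow2 (i%:R * tau) * \sum_(u < 2 ^ i) kap ^+ 2 * ex i u n m
    <= 3 * Cu ^+ 2 * Cg * pair_cost (reduced_den n m) / N%:R ^+ 2.
  set b := reduced_den n m.
  have b1 : (0 < b)%N := reduced_den_gt0 n m.
  have br : 0 < b%:R :> R by rewrite ltr0n.
  rewrite /ex -/b /pair_cost -/(c1 b) -/(c2 b); case: (leP (c1 b) (c2 b)) => _; last first.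
    exact: energy_ex2.
  apply: le_trans (energy_ex1 b1) _; rewrite ler_wpM2r ?invr_ge0 ?exprn_ge0//.
  rewrite -/(c1 b) ler_wpM2r ?divr_ge0 ?exprn_ge0// ler_wpM2r//.
  by rewrite ler_peMl ?exprn_ge0// ler1n.
set cost := \sum_n _.
have C0 : 0 <= 3 * Cu ^+ 2 by rewrite mulr_ge0 ?exprn_ge0.
pose K2 : R := L%:R * kap ^+ 2.
have K20 : 0 <= K2 by rewrite mulr_ge0 ?sqr_ge0.
have -> : \sum_(x < L) discrepancy G s tau (orbit_weight x) j =
    \sum_(i < j.+1) pow2 (i%:R * tau) * \sum_(u < 2 ^ i) \sum_(x < L)
      (mass (orbit_weight x) j i u - mass (cell_weight G s j) j i u) ^+ 2.
  rewrite /discrepancy exchange_big/=; apply: eq_bigr => i _.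
  by rewrite -mulr_sumr exchange_big.
apply: (@le_trans _ _ (\sum_(i < j.+1) pow2 (i%:R * tau) * \sum_(u < 2 ^ i)
    (K2 * (N%:R * p i u) + \sum_n \sum_(m | m != n) K2 * ex i u n m))).
  apply: ler_sum => i _; rewrite ler_wpM2l ?pow2_ge0//; apply: ler_sum => u _.
  have ij : (i <= j)%N by rewrite -ltnS.
  apply: le_trans (variance_le (fun n m _ => exP i u n m ij)) _.
  rewrite mulrDr lerD2l mulr_sumr; apply/le_of_eq; apply: eq_bigr => n _.
  by rewrite mulr_sumr.
under eq_bigr do rewrite big_split/= mulrDr.
rewrite big_split/=.
have diag : \sum_(i < j.+1) pow2 (i%:R * tau) * \sum_(u < 2 ^ i) K2 * (N%:R * p i u)
   <= L%:R * (Cu * Cg) * (pow2 (j%:R * (1 - s + tau)) / N%:R).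
  pose A := K2 * N%:R * 2 ^- j.
  have A0 : 0 <= A by rewrite mulr_ge0 ?invr_ge0 ?exprn_ge0// mulr_ge0.
  apply: (@le_trans _ _ (\sum_(i < j.+1) A * (Cu * pow2 (j%:R * s)) * pow2 (i%:R * tau))).
    apply: ler_sum => i _; have ij : (i <= j)%N by rewrite -ltnS.
    rewrite [leRHS]mulrC ler_wpM2l ?pow2_ge0//.
    have -> : \sum_(u < 2 ^ i) K2 * (N%:R * p i u) = A * \sum_(u < 2 ^ i) (gcount G j i u)%:R.
      by rewrite mulr_sumr; apply: eq_bigr => u _; rewrite /p /A; ring.
    by rewrite ler_wpM2l// sum_gcount.
  rewrite -mulr_sumr; apply: le_trans (ler_wpM2l _ (geo1 j)) _.
    by rewrite mulr_ge0// mulr_ge0 ?pow2_ge0.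
  apply/le_of_eq; rewrite /A /K2 /kap.
  have -> : pow2 (j%:R * (1 - s)) = 2 ^+ j / pow2 (j%:R * s).
    by rewrite -pow2_nat -pow2B; congr pow2; ring.
  have -> : pow2 (j%:R * (1 - s + tau)) = 2 ^+ j * pow2 (j%:R * tau) / pow2 (j%:R * s).
    by rewrite -pow2_nat -pow2D -pow2B; congr pow2; ring.
  field; rewrite (gt_eqF NR) expf_neq0// gt_eqF// pow2_gt0//.
have off : \sum_(i < j.+1) pow2 (i%:R * tau) *
      \sum_(u < 2 ^ i) \sum_n \sum_(m | m != n) K2 * ex i u n m
   <= L%:R * (3 * Cu ^+ 2 * Cg) * (cost / N%:R ^+ 2).
  have -> : \sum_(i < j.+1) pow2 (i%:R * tau) *
      \sum_(u < 2 ^ i) \sum_n \sum_(m | m != n) K2 * ex i u n m =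
    \sum_n \sum_(m | m != n) L%:R * \sum_(i < j.+1) pow2 (i%:R * tau) *
       \sum_(u < 2 ^ i) kap ^+ 2 * ex i u n m.
    under eq_bigr => i _.
      rewrite exchange_big/= mulr_sumr.
      under eq_bigr do rewrite exchange_big/= mulr_sumr.
      over.
    rewrite exchange_big/=; apply: eq_bigr => n _.
    rewrite exchange_big/=; apply: eq_bigr => m _.
    rewrite mulr_sumr; apply: eq_bigr => i _; rewrite !mulr_sumr; apply: eq_bigr => u _.
    by rewrite /K2; ring.
  have -> : L%:R * (3 * Cu ^+ 2 * Cg) * (cost / N%:R ^+ 2) = \sum_n \sum_(m | m != n)
      L%:R * (3 * Cu ^+ 2 * Cg * pair_cost (reduced_den n m) / N%:R ^+ 2).
    have -> : L%:R * (3 * Cu ^+ 2 * Cg) * (cost / N%:R ^+ 2) =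
       (L%:R * (3 * Cu ^+ 2 * Cg) / N%:R ^+ 2) * cost by ring.
    rewrite /cost mulr_sumr; apply: eq_bigr => n _; rewrite mulr_sumr; apply: eq_bigr => m _.
    by ring.
  by apply: ler_sum => n _; apply: ler_sum => m _; rewrite ler_wpM2l.
apply: le_trans (lerD diag off) _.
have cost0 : 0 <= cost.
  apply: sumr_ge0 => n _; apply: sumr_ge0 => m _; rewrite /pair_cost le_min.
  rewrite !divr_ge0 ?exprn_ge0// mulr_ge0 ?pow2_ge0// addr_ge0 ?pow2_ge0 ?powR_ge0//.
set y := cost / _; set x := pow2 _ / _.
have y0 : 0 <= y by rewrite divr_ge0 ?exprn_ge0.
have x0 : 0 <= x by rewrite divr_ge0 ?pow2_ge0.
have -> : L%:R * ((Cu + 3 * Cu ^+ 2) * Cg) * (x + y) =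
   (L%:R * (Cu * Cg) * x + L%:R * (3 * Cu ^+ 2 * Cg) * y) +
   (L%:R * (3 * Cu ^+ 2 * Cg) * x + L%:R * (Cu * Cg) * y) by ring.
have LCg (a : R) : 0 <= a -> 0 <= L%:R * (a * Cg) by move=> a0; rewrite mulr_ge0// mulr_ge0.
by rewrite lerDl addr_ge0// mulr_ge0// LCg.
Qed.

End second_moment.

(** * The growth of the primes *)

Lemma prime_powers_prod_dvd (r : seq nat) (f : nat -> nat) m : uniq r -> all prime r ->
  (forall p, p \in r -> (p ^ f p %| m)%N) -> (\prod_(p <- r) p ^ f p %| m)%N.
Proof.
elim: r => [|p r IH] /=; first by rewrite big_nil dvd1n.
move=> /andP[pr ur] /andP[pp ar] h; rewrite big_cons Gauss_dvd; last first.
  rewrite big_seq; elim/big_rec : _ => [|q x qr cx]; first by rewrite coprimen1.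
  rewrite coprimeMr cx andbT coprimeXl// coprimeXr// prime_coprime// dvdn_prime2//.
    by apply: contraNneq pr => ->.
  exact: (allP ar).
rewrite h ?mem_head//= IH// => q qr; apply: h.
by rewrite in_cons qr orbT.
Qed.

Section prime_counting.

Definition primepi (n : nat) : nat := count prime (iota 0 n.+1).

Lemma prime_dvd_fact p n : prime p -> (p %| n`!)%N -> (p <= n)%N.
Proof.
move=> pp; elim: n => [|n IH]; first by rewrite fact0 dvdn1 => /eqP p1; rewrite p1 in pp.
rewrite factS Euclid_dvdM// => /orP[/dvdn_leq -> //|/IH].
exact: leqW.
Qed.

Lemma bin_le_expn n k : ('C(n, k) <= 2 ^ n)%N.
Proof.
elim: n k => [|n IH] [|k]; rewrite ?bin0 ?expn_gt0// binS expnS mul2n -addnn.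
by rewrite leq_add.
Qed.

(** The primes between [n] and [2 * n] divide the central binomial coefficient. *)
Lemma prod_primes_le n :
  (\prod_(p <- [seq p <- iota n.+1 n | prime p]) p <= 4 ^ n)%N.
Proof.
have h : (\prod_(p <- [seq p <- iota n.+1 n | prime p]) p ^ 1 %| 'C(n + n, n))%N.
  apply: prime_powers_prod_dvd; first by rewrite filter_uniq// iota_uniq.
    exact: filter_all.
  move=> p; rewrite mem_filter mem_iota => /andP[pp /andP[np pn]]; rewrite expn1.
  have : (p %| (n + n)`!)%N by rewrite dvdn_fact// prime_gt0//=; lia.
  rewrite -(@bin_fact (n + n) n) ?leq_addr// addnK !Euclid_dvdM//.
  by case/orP => // /orP[] /(prime_dvd_fact pp); rewrite leqNgt np.
have := dvdn_leq _ h; rewrite bin_gt0 leq_addr => /(_ isT).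
under eq_bigr do rewrite expn1.
move/leq_trans; apply; apply: leq_trans (bin_le_expn _ _) _.
by rewrite -[4%N]/(2 ^ 2)%N -expnM mul2n addnn.
Qed.

Lemma primepi_double j : (j * (primepi (2 ^ j.+1) - primepi (2 ^ j)) <= 2 ^ j.+1)%N.
Proof.
set n := (2 ^ j)%N.
have -> : (primepi (2 ^ j.+1) - primepi n = size [seq p <- iota n.+1 n | prime p])%N.
  rewrite /primepi expnS mul2n -addnn -addSn iotaD count_cat addKn add0n.
  by rewrite size_filter.
have h := prod_primes_le n.
have h2 : (n ^ size [seq p <- iota n.+1 n | prime p] <=
    \prod_(p <- [seq p <- iota n.+1 n | prime p]) p)%N.
  have : all (fun p => n <= p)%N [seq p <- iota n.+1 n | prime p].
    by apply/allP => p; rewrite mem_filter mem_iota => /andP[_ /andP[/ltnW]].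
  elim: [seq p <- _ | _] => [|p r IH] /=; first by rewrite big_nil.
  by move=> /andP[np ar]; rewrite big_cons expnS leq_mul// IH.
have := leq_trans h2 h; rewrite -[4%N]/(2 ^ 2)%N /n -!expnM leq_exp2l//.
by rewrite expnS.
Qed.

(** Chebyshev's bound at the powers of [2], by summing [primepi_double]. *)
Lemma primepi_le j : (0 < j)%N -> (j * primepi (2 ^ j) <= 6 * 2 ^ j)%N.
Proof.
elim: j => // -[_ _|j /(_ isT) IH _]; first by [].
have [->|j0] := posnP j; first by [].
have h := primepi_double j.+1.
set a := primepi (2 ^ j.+1) in IH h; set b := primepi (2 ^ j.+2) in h *.
have ab : (a <= b)%N.
  by rewrite /a /b /primepi [in leqRHS]expnS [in leqRHS]mul2n -addnn -addSn iotaD count_cat leq_addr.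
rewrite [in leqRHS]expnS; rewrite expnS in h.
set x := (2 ^ j.+1)%N in IH h *.
have h1 : (j.+1 * b <= 8 * x)%N by move: h IH; rewrite mulnBr; lia.
have : (j.+2 * (j.+1 * b) <= j.+1 * (12 * x))%N.
  apply: (@leq_trans (j.+2 * (8 * x))); first by rewrite leq_mul2l h1 orbT.
  by rewrite !mulnA leq_mul2r; apply/orP; right; lia.
by rewrite mulnCA leq_pmul2l// mulnA.
Qed.

Lemma next_primeP m : prime (next_prime m) /\ (m < next_prime m)%N.
Proof. by rewrite /next_prime; case: ex_minnP => p /andP[]. Qed.

Lemma nth_prime_prime n : (0 < n)%N -> prime (nth_prime n).
Proof. by case: n => // n _; have [] := next_primeP (nth_prime n). Qed.

Lemma nth_prime_ltS n : (nth_prime n < nth_prime n.+1)%N.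
Proof. by have [] := next_primeP (nth_prime n). Qed.

Lemma nth_prime_lt m n : (m < n)%N -> (nth_prime m < nth_prime n)%N.
Proof.
elim: n => // n IH; rewrite ltnS leq_eqVlt => /orP[/eqP ->|/IH h].
  exact: nth_prime_ltS.
exact: ltn_trans h (nth_prime_ltS n).
Qed.

Lemma nth_prime_inj : injective nth_prime.
Proof.
move=> m n; case: (ltngtP m n) => // /nth_prime_lt + e; by rewrite e ltnn.
Qed.

Lemma leq_primepi_nth_prime n x : (nth_prime n <= x)%N -> (n <= primepi x)%N.
Proof.
move=> nx; rewrite /primepi -size_filter -[leqLHS](size_iota 1).
rewrite -(size_map nth_prime); apply: uniq_leq_size.
  by rewrite map_inj_uniq ?iota_uniq//; exact: nth_prime_inj.
move=> p /mapP[k]; rewrite mem_iota => /andP[k1 kn] ->.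
rewrite mem_filter nth_prime_prime// mem_iota/= ltnS (leq_trans _ nx)//.
by move: kn; rewrite ltnS leq_eqVlt => /orP[/eqP ->|/nth_prime_lt/ltnW].
Qed.

(** The primes have density zero, so the [n]-th prime is eventually larger than
    any multiple of [n]. *)
Lemma nth_prime_superlinear c k n : (6 * 2 ^ c < k)%N -> (2 ^ k <= n)%N ->
  (2 ^ (k + c) < nth_prime n)%N.
Proof.
move=> ck kn; rewrite ltnNge; apply/negP => /leq_primepi_nth_prime h.
have kc0 : (0 < k + c)%N by rewrite addn_gt0 (leq_ltn_trans _ ck).
have := primepi_le kc0; rewrite leqNgt => /negP; apply.
apply: (@leq_trans ((k + c) * 2 ^ k)); last first.
  by rewrite leq_mul2l (leq_trans kn h) orbT.
rewrite expnD mulnCA mulnC ltn_mul2r expn_gt0/=.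
exact: leq_trans ck (leq_addr _ _).
Qed.

End prime_counting.

(** * Values of polynomials at the integers *)

Section congruences.

Lemma pfactor_cancel (p e k : nat) (x y : int) : prime p -> (k <= e)%N ->
  (p ^ e %| absz (x * y)%R)%N -> ~~ (p ^ k.+1 %| absz y)%N -> (p ^ (e - k) %| absz x)%N.
Proof.
move=> pp ke; rewrite abszM; have [->|x0] := eqVneq x 0; first by rewrite absz0 dvdn0.
have [->|y0] := eqVneq y 0; first by rewrite absz0 dvdn0.
rewrite !pfactor_dvdn ?muln_gt0 ?absz_gt0 ?x0 ?y0// lognM ?absz_gt0//.
lia.
Qed.

(** Lagrange's bound on the number of roots, modulo a prime power: each
    division by a linear factor costs at most [k] powers of [p], because the
    remaining roots differ from the divided one modulo [p ^ k.+1]. *)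
Lemma size_roots_mod_prime_power (p k D e : nat) (P : {poly int}) (r : seq int) :
  prime p -> (size P <= D.+1)%N -> (D * k <= e)%N ->
  ~~ (p ^ (e - D * k) %| absz (P`_D)%R)%N ->
  pairwise (fun a b => ~~ (p ^ k.+1 %| absz (a - b)%R)%N) r ->
  all (fun a => p ^ e %| absz (P.[a])%R)%N r -> (size r <= D)%N.
Proof.
move=> pp; elim: D e P r => [|D IH] e P [|a r]//.
  move=> /size1_polyC ->; rewrite mul0n subn0 coefC /= => _ h _ /andP[+ _].
  by rewrite hornerC (negbTE h).
move=> sP De lc /= /andP[ar pr] /andP[Pa Pr].
have /factor_theorem[Q PQ] : root (P - P.[a]%:P) a.
  by rewrite /root !hornerE subrr.
have {}PQ : P = Q * ('X - a%:P) + P.[a]%:P by rewrite -PQ subrK.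
have sQ : (size Q <= D.+1)%N.
  have [->|Q0] := eqVneq Q 0; first by rewrite size_poly0.
  have <- : (size (Q * ('X - a%:P))).-1 = size Q.
    by rewrite (size_Mmonic Q0 (monicXsubC a)) size_XsubC addn2.
  have -> : Q * ('X - a%:P) = P - P.[a]%:P by rewrite {1}PQ addrK.
  rewrite -subn1 leq_subLR add1n (leq_trans (size_polyD _ _))// geq_max sP.
  by rewrite size_polyN (leq_trans (size_polyC_leq1 _)).
have cQ : P`_D.+1 = Q`_D.
  rewrite PQ coefD coefC addr0 mulrBr coefB coefMX coefMC /=.
  by rewrite (nth_default _ sQ) mul0r subr0.
have ke : (k <= e)%N by apply: leq_trans De; rewrite leq_pmull.
rewrite ltnS; apply: (IH (e - k)%N Q) => //.
- by rewrite leq_subRL// -mulSn.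
- by move: lc; rewrite cQ -subnDA -mulSn.
apply/allP => b br.
have ab := allP ar _ br.
apply: (pfactor_cancel (y := b - a) pp ke); last by rewrite -opprB abszN.
have -> : Q.[b] * (b - a) = P.[b] - P.[a].
  by rewrite {1}PQ !hornerE; ring.
rewrite -[(_ %| _)%N]/((p ^ e)%N%:Z %| (P.[b] - P.[a])%R)%Z; apply: rpredB => //.
by have := allP Pr _ br.
Qed.

Lemma size_congruent_interval (A : seq nat) a N Q : (0 < Q)%N -> uniq A ->
  (forall x, x \in A -> (a <= x < a + N)%N) ->
  (forall x y, x \in A -> y \in A -> x = y %[mod Q]) -> (size A <= N %/ Q + 1)%N.
Proof.
move=> Q0 uA rng cong; case: A uA rng cong => [//|x0 A'] uA rng cong.
set A := x0 :: A' in uA rng cong *.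
have [m mA mmin] : exists2 m, m \in A & forall x, x \in A -> (m <= x)%N.
  have exP : exists m, m \in A by exists x0; rewrite mem_head.
  by case: (ex_minnP exP) => m mA mmin; exists m.
rewrite -(size_map (fun x => (x - m) %/ Q)%N) -[leqRHS](size_iota 0).
apply: uniq_leq_size.
  rewrite map_inj_in_uniq// => x y xA yA /= e.
  have dx z : z \in A -> (Q %| z - m)%N.
    by move=> zA; rewrite -eqn_mod_dvd ?mmin//; apply/eqP; exact: cong.
  have : ((x - m) = (y - m))%N by rewrite -(divnK (dx _ xA)) e divnK// dx.
  by have := mmin _ xA; have := mmin _ yA; lia.
move=> _ /mapP[x xA ->]; rewrite mem_iota /= add0n addn1 ltnS.
by apply: leq_div2r; have /andP[_ +] := rng _ xA; have /andP[+ _] := rng _ mA; lia.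
Qed.

(** Choosing a class modulo each [mu p] confines [A] to a single class modulo their
    product, by the Chinese remainder theorem. The modulus [Q] collects the
    choices already made. *)
Lemma size_sieved_interval (D : nat) (r : seq nat) (mu : nat -> nat) (A : seq nat) a N Q :
  (0 < Q)%N -> uniq A -> (forall x, x \in A -> (a <= x < a + N)%N) ->
  (forall x y, x \in A -> y \in A -> x = y %[mod Q]) ->
  all (fun p => 0 < mu p)%N r -> all (fun p => coprime Q (mu p)) r ->
  pairwise (fun p q => coprime (mu p) (mu q)) r ->
  (forall p, p \in r -> (size (undup [seq (x %% mu p)%N | x <- A]) <= D)%N) ->
  (size A <= D ^ size r * (N %/ (Q * \prod_(p <- r) mu p) + 1))%N.
Proof.
elim: r A Q => [|p r IH] A Q Q0 uA rng cong.
  by move=> _ _ _ _; rewrite big_nil muln1 mul1n; exact: size_congruent_interval rng cong.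
move=> /= /andP[mp mr] /andP[cp cr] /andP[cpr pr] small.
set C := undup [seq (x %% mu p)%N | x <- A].
have -> : size A = (\sum_(c <- C) size [seq x <- A | x %% mu p == c])%N.
  under eq_bigr do rewrite size_filter -sum1_count big_mkcond.
  rewrite exchange_big/= -sum1_size big_seq [RHS]big_seq; apply: eq_bigr => x xA.
  rewrite -big_mkcond/= (big_rem (x %% mu p)%N)/=; last first.
    by rewrite mem_undup; apply/mapP; exists x.
  rewrite eqxx big_seq_cond big1 // => c.
  by case/andP => + /eqP e; rewrite -e mem_rem_uniqF// undup_uniq.
apply: (@leq_trans (\sum_(c <- C) D ^ size r * (N %/ (Q * \prod_(q <- p :: r) mu q) + 1))%N).
  apply: leq_sum => c _; rewrite big_cons mulnA.
  apply: IH => //.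
  - by rewrite muln_gt0 Q0.
  - exact: filter_uniq.
  - by move=> x; rewrite mem_filter => /andP[_]; exact: rng.
  - move=> x y; rewrite !mem_filter => /andP[/eqP xc xA] /andP[/eqP yc yA].
    by apply/eqP; rewrite chinese_remainder// xc yc eqxx andbT; apply/eqP/cong.
  - apply/allP => q qr; rewrite coprimeMl (allP cr)//=.
    exact: (allP cpr).
  - move=> q qr; apply: leq_trans (small q _); last by rewrite in_cons qr orbT.
    apply: uniq_leq_size; first exact: undup_uniq.
    move=> y; rewrite !mem_undup => /mapP[x]; rewrite mem_filter => /andP[_ xA] ->.
    by apply/mapP; exists x.
rewrite big_const_seq count_predT iter_addn_0 expnS mulnC -mulnA leq_mul2r.
by rewrite (small p) ?orbT// mem_head.
Qed.

(** Modulo a prime power [p ^ e] the roots of [P] can cluster, but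
    [size_roots_mod_prime_power] leaves at most [D] classes modulo a power of [p]
    with exponent about [e / D]. The product [g'] of these powers is of order at
    least [g] to the power [1 / D], and the classes modulo different primes are
    combined by sieving. *)
Lemma poly_root_count (P : {poly int}) (D a N g : nat) :
  (0 < D)%N -> size P = D.+1 -> (0 < g)%N ->
  exists g', [/\ (0 < g')%N, (g <= absz (lead_coef P) * g' ^ D)%N &
    (size [seq m <- iota a N | (g %| absz (P.[m%:Z])%R)%N]
      <= D ^ size (primes g) * (N %/ g' + 1))%N].
Proof.
move=> D0 sP g0; set A := [seq m <- _ | _].
have cE : lead_coef P = P`_D by rewrite lead_coefE sP.
have c0 : (0 < absz (lead_coef P))%N.
  by rewrite absz_gt0 lead_coef_eq0 -size_poly_eq0 sP.
set c := absz (lead_coef P) in c0 *.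
(* The power of [p] in the leading coefficient is lost. If it exceeds the one in
   [g] then the prime [p] gives no condition. *)
pose v p := logn p c; pose e p := logn p g.
pose k p := if (v p < e p)%N then ((e p - v p).-1 %/ D).+1 else 0%N.
exists (\prod_(p <- primes g) p ^ k p)%N.
have pr p : p \in primes g -> prime p by rewrite mem_primes => /andP[].
split.
- rewrite big_seq prodn_cond_gt0// => p /pr pp; by rewrite expn_gt0 prime_gt0.
- rewrite {1}(prod_prime_decomp g0) prime_decompE big_map /=.
  apply: (@leq_trans ((\prod_(p <- primes g) p ^ v p) * (\prod_(p <- primes g) p ^ k p) ^ D)%N).
    rewrite unstable.expn_prod -big_split/= big_seq [leqRHS]big_seq.
    apply: leq_prod => p /pr pp.
    rewrite -expnM -expnD leq_pexp2l ?prime_gt0// -/(e p) /k; case: ltnP => [ve|ev].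
      by have := ltn_ceil (e p - v p).-1 D0; move: (_ * D)%N => x; move: ve; clear; lia.
    by rewrite mul0n addn0.
  rewrite leq_mul2r; apply/orP; right; apply: dvdn_leq => //.
  apply: prime_powers_prod_dvd; first exact: primes_uniq.
    by apply/allP => p /pr.
  by move=> p _; rewrite pfactor_dvdnn.
have uA : uniq A by rewrite filter_uniq// iota_uniq.
have rng x : x \in A -> (a <= x < a + N)%N by rewrite mem_filter mem_iota => /andP[].
have := @size_sieved_interval D (primes g) (fun p => p ^ k p)%N A a N 1 isT uA rng.
rewrite mul1n; apply.
- by move=> x y _ _; rewrite !modn1.
- by apply/allP => p /pr pp; rewrite expn_gt0 prime_gt0.
- by apply/allP => p _; rewrite coprime1n.
- have := primes_uniq g; rewrite uniq_pairwise.
  apply: (@sub_in_pairwise _ prime); last by apply/allP => p /pr.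
  move=> p q pp pq /= npq; apply: coprimeXl; apply: coprimeXr.
  by rewrite prime_coprime// dvdn_prime2.
move=> p pg; have pp := pr _ pg.
have [ve|ev] := ltnP (v p) (e p); last first.
  rewrite /k ltnNge ev /= expn0; apply: leq_trans D0.
  apply: (@leq_trans (size [:: 0%N])) => //; apply: uniq_leq_size; first exact: undup_uniq.
  by move=> y; rewrite mem_undup => /mapP[x _ ->]; rewrite modn1 inE.
rewrite /k ve; set kk := ((e p - v p).-1 %/ D)%N; set mu := (p ^ kk.+1)%N.
set s := undup _.
pose rep y := nth 0%N A (index y [seq (x %% mu)%N | x <- A]).
have repP y : y \in s -> rep y \in A /\ (rep y %% mu)%N = y.
  rewrite mem_undup => yA.
  have lt : (index y [seq (x %% mu)%N | x <- A] < size A)%N by rewrite -(size_map (modn^~ mu)) index_mem.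
  split; first exact: mem_nth.
  by rewrite -[LHS](nth_map 0%N 0%N (modn^~ mu) lt) nth_index.
have h1 : (D * kk <= e p)%N.
  apply: (@leq_trans (e p - v p).-1); first by rewrite mulnC leq_divM.
  by apply: leq_trans (leq_pred _) _; exact: leq_subr.
rewrite -(size_map (fun y => (rep y)%:Z)).
apply: (size_roots_mod_prime_power pp (e := e p) (k := kk) (P := P)) => //.
- by rewrite sP.
- rewrite -cE -/c pfactor_dvdn// -ltnNge -/(v p).
  have : (D * kk <= (e p - v p).-1)%N by rewrite mulnC leq_divM.
  by move: ve; clear; lia.
- rewrite pairwise_map; have := undup_uniq [seq (x %% mu)%N | x <- A]; rewrite uniq_pairwise -/s.
  apply: (@sub_in_pairwise _ (mem s)); last by apply/allP.
  move=> y z /repP[_ ry] /repP[_ rz] /= yz; apply: contraNN yz => dv.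
  rewrite -ry -rz -eqz_nat -!modz_nat eqz_mod_dvd.
  exact: dv.
- apply/allP => _ /mapP[y ys ->]; have [+ _] := repP y ys.
  rewrite mem_filter => /andP[+ _]; apply: dvdn_trans; exact: pfactor_dvdnn.
Qed.

Lemma size_divisors n : (0 < n)%N -> size (divisors n) = (\prod_(p <- primes n) (logn p n).+1)%N.
Proof.
move=> n0; rewrite /divisors prime_decompE; elim: (primes n) => [|p r IH] /=; first by rewrite big_nil.
rewrite big_cons -IH.
set d := foldr _ _ _; move: (logn p n) => e.
have h (add : seq nat -> seq nat) : (forall l, size (add l) = size l + size d)%N ->
    size (iter e add d) = (e.+1 * size d)%N.
  by move=> sa; elim: e => [|e' IHe] /=; rewrite ?mul1n// sa IHe [RHS]mulSn addnC.
by apply: h => l; rewrite size_merge size_cat size_map addnC.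
Qed.

(** Both factors of the base are multiplicative in [n]. A prime [p] at least [B]
    satisfies [((e + 1) * D) ^ K <= p ^ e] for every exponent [e > 0]. The smaller
    primes are bounded in number and each costs at most the factor [M]. *)
Lemma divisor_weight_bound (D K : nat) : (0 < D)%N -> (0 < K)%N ->
  exists C : nat, forall n, (0 < n)%N ->
    ((size (divisors n) * D ^ size (primes n)) ^ K <= C * n)%N.
Proof.
move=> D0 K0; pose B := ((2 * D) ^ K)%N; pose M := ((D * K) ^ K)%N.
exists (M ^ B)%N => n n0.
have M0 : (0 < M)%N by rewrite expn_gt0 muln_gt0 D0 K0.
pose f p := if (p < B)%N then M else 1%N.
have step p : p \in primes n -> (((logn p n).+1 * D) ^ K <= f p * p ^ logn p n)%N.
  move=> pn; have pp : prime p by move: pn; rewrite mem_primes => /andP[].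
  have e0 : (0 < logn p n)%N by rewrite logn_gt0.
  set e := logn p n in e0 *; rewrite /f; case: (ltnP p B) => pB; last first.
    rewrite mul1n; apply: (@leq_trans (((2 * D) ^ e) ^ K)%N); last first.
      by rewrite expnAC leq_exp2r.
    rewrite leq_exp2r// expnMn; apply: leq_mul; first exact: ltn_expl.
    by rewrite -{1}[D]expn1 leq_pexp2l.
  apply: (@leq_trans (M * 2 ^ e)%N); last by rewrite leq_mul2l leq_exp2r ?prime_gt1 ?orbT.
  apply: (@leq_trans ((D * K * 2 ^ (e %/ K)) ^ K)%N).
    rewrite leq_exp2r// mulnC -mulnA leq_mul2l; apply/orP; right.
    apply: (@leq_trans (K * (e %/ K).+1)); last by rewrite leq_mul2l ltn_expl ?orbT.
    by rewrite mulnC ltn_ceil.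
  by rewrite expnMn leq_mul2l -expnM leq_exp2l// leq_divM orbT.
apply: (@leq_trans (\prod_(p <- primes n) (f p * p ^ logn p n))%N).
  rewrite size_divisors//.
  have -> : (D ^ size (primes n) = \prod_(p <- primes n) D)%N.
    by rewrite big_const_seq count_predT iter_muln_1.
  rewrite -big_split/= unstable.expn_prod big_seq [leqRHS]big_seq; apply: leq_prod => p pn; exact: step.
rewrite big_split/= leq_mul//; last first.
  by rewrite [leqRHS](prod_prime_decomp n0) prime_decompE big_map.
rewrite /f -big_mkcond/= big_const_seq iter_muln_1 leq_pexp2l//.
rewrite -size_filter -[leqRHS](size_iota 0); apply: uniq_leq_size.
  by rewrite filter_uniq// primes_uniq.
by move=> p; rewrite mem_filter mem_iota => /andP[].
Qed.

End congruences.

Section growth.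
Variables (P : {poly int}) (D : nat).
Hypotheses (sP : size P = D.+1) (D0 : (0 < D)%N).

Lemma poly_growth : exists C : nat, (0 < C)%N /\ exists n0 : nat, forall n, (n0 <= n)%N ->
  (absz (P.[n%:Z])%R <= C * n ^ D)%N /\ (n ^ D <= C * absz (P.[n%:Z])%R)%N.
Proof.
pose S := (\sum_(i < D.+1) absz (P`_i)%R)%N.
have hP (n : nat) : P.[n%:Z] = \sum_(i < D) P`_i * n%:Z ^+ i + P`_D * n%:Z ^+ D.
  by rewrite horner_coef sP big_ord_recr.
have absM (i n : nat) : absz (P`_i * n%:Z ^+ i)%R = (absz (P`_i)%R * n ^ i)%N.
  by rewrite abszM abszX absz_nat.
have abs_sum (n : nat) : (0 < n)%N ->
    (absz (\sum_(i < D) P`_i * n%:Z ^+ i)%R <= S * n ^ D.-1)%N.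
  move=> n0; apply: (@leq_trans (\sum_(i < D) absz (P`_i)%R * n ^ i)%N).
    elim/big_ind2 : _ => // [x a y b xa yb|i _]; last by rewrite absM.
    by clear -xa yb; lia.
  rewrite /S big_ord_recr/= mulnDl big_distrl/= -[leqLHS]addn0 leq_add// leq_sum// => i _.
  by rewrite leq_mul2l leq_pexp2l ?orbT//; rewrite -ltnS prednK.
have lc1 : (0 < absz (P`_D)%R)%N.
  by rewrite absz_gt0 -[D]/(D.+1.-1) -sP -lead_coefE lead_coef_eq0 -size_poly_eq0 sP.
exists (S + 2)%N; split; first by rewrite addn2.
exists (2 * S + 1)%N => n nn.
have n0 : (0 < n)%N by rewrite (leq_trans _ nn)// addn1.
have nD : (n ^ D = n * n ^ D.-1)%N by rewrite -expnS prednK.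
have hs1 := abs_sum n n0; rewrite hP.
set x := \sum_(i < D) _ in hs1 *; have xn := absM D n.
set y := (_ * _)%R in xn *.
have PDS : (absz (P`_D)%R <= S)%N by rewrite /S big_ord_recr/= leq_addl.
have SX : (2 * (S * n ^ D.-1) <= n ^ D)%N.
  by rewrite mulnA nD leq_mul2r (leq_trans _ nn) ?orbT// leq_addr.
have yS : (absz y <= S * n ^ D)%N by rewrite xn leq_mul2r PDS orbT.
have yl : (n ^ D <= absz y)%N by rewrite xn leq_pmull.
have e1 : ((S + 2) * n ^ D = S * n ^ D + 2 * n ^ D)%N by rewrite mulnDl.
rewrite e1.
have e2 : (2 * absz (x + y)%R <= (S + 2) * absz (x + y)%R)%N by rewrite leq_mul2r leq_addl orbT.
split.
  move: (S * n ^ D)%N (S * n ^ D.-1)%N (n ^ D)%N hs1 SX yS yl => *; lia.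
apply: leq_trans e2.
move: (S * n ^ D)%N (S * n ^ D.-1)%N (n ^ D)%N hs1 SX yS yl => *; lia.
Qed.

End growth.

(** * The cost of the pairs in a dyadic block *)

Definition block (q : nat -> int) k (n : 'I_(2 ^ k)) : int := q (2 ^ k + n)%N.

(** Cells of this level are smaller than the targets of the block
    [2 ^ k <= n < 2 ^ k.+1]. *)
Definition lvl {R : realType} (nu : R) (k : nat) : nat := (Num.truncn (k.+1%:R * nu)).+3.

(** Together with [q n != 0] for large [n], all that the lower bound requires of
    the sequence [q]. *)
Definition small_pair_cost {R : realType} (s tau nu : R) (q : nat -> int) : Prop :=
  forall eta : R, 0 < eta -> exists k0 : nat, forall k, (k0 <= k)%N ->
  \sum_(n < 2 ^ k) \sum_(m < 2 ^ k | m != n)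
    pair_cost s tau (lvl nu k) (reduced_den (@block q k) n m)
  <= eta * (2 ^ k)%N%:R ^+ 2.

Section block_costs.
Context {R : realType}.
Variables (s tau nu : R).
Local Notation lvl := (lvl nu).
Hypotheses (hs : 0 < s <= 1) (tau_gt0 : 0 < tau) (nu1 : 1 <= nu).
Hypothesis hnu : nu * (1 - s + tau) < 1.

Let nu0 : 0 <= nu. Proof. exact: le_trans ler01 nu1. Qed.

Lemma lvl_ge k : k.+1%:R * nu + 2 <= (lvl k)%:R.
Proof.
have := truncnS_gt (k.+1%:R * nu); rewrite /lvl -!natr1; lra.
Qed.

Lemma lvl_le k : (lvl k)%:R <= k%:R * nu + (nu + 3).
Proof.
have h : 0 <= k.+1%:R * nu by rewrite mulr_ge0.
have : (Num.truncn (k.+1%:R * nu))%:R <= k.+1%:R * nu by rewrite truncn_le.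
rewrite /lvl -!natr1; lra.
Qed.

Lemma leq_lvl k : (k <= lvl k)%N.
Proof.
rewrite -(ler_nat R); apply: le_trans (lvl_ge k); rewrite -natr1.
have : k%:R <= k%:R * nu by rewrite ler_peMr.
have := nu0; nra.
Qed.

Lemma pow2_decay (C a A eta : R) : 0 < a -> 0 < eta -> 0 <= C ->
  exists k0 : nat, forall k, (k0 <= k)%N -> C * pow2 (A - k%:R * a) <= eta.
Proof.
move=> a0 eta0 C0.
have d0 : 0 < C * pow2 A + 1 by rewrite ltr_wpDl ?mulr_ge0 ?pow2_ge0.
have x0 : 0 < eta / (C * pow2 A + 1) by rewrite divr_gt0.
have [l0 hl] := pow2_small a0 x0; exists l0 => k /hl h.
rewrite pow2D mulrA; apply: (@le_trans _ _ (C * pow2 A * (eta / (C * pow2 A + 1)))).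
  by rewrite ler_wpM2l ?mulr_ge0 ?pow2_ge0// ltW.
by rewrite mulrA ler_pdivrMr// mulrC ler_wpM2l ?(ltW eta0)// lerDl.
Qed.

(** This is where [tau < 1 / nu + s - 1] enters: the block has [2 ^ k] terms and
    [2 ^ lvl k] is of order [2 ^ (k * nu)]. *)
Lemma diagonal_cost eta : 0 < eta ->
  exists k0 : nat, forall k, (k0 <= k)%N -> pow2 ((lvl k)%:R * (1 - s + tau)) / (2 ^ k)%N%:R <= eta.
Proof.
move=> eta0; set sg := 1 - s + tau; have hnu' : nu * sg < 1 := hnu.
have sg0 : 0 <= sg by have /andP[_ s1] := hs; rewrite /sg; have := tau_gt0; lra.
have a0 : 0 < 1 - nu * sg by rewrite subr_gt0.
have [k0 h] := pow2_decay ((nu + 3) * sg) a0 eta0 ler01.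
exists k0 => k /h; apply: le_trans; rewrite mul1r natrX -pow2_nat -pow2B pow2_le//.
have := ler_wpM2r sg0 (lvl_le k); lra.
Qed.

Let pc := @pair_cost R s tau.

Section primes.
Variables (d : nat) (q : nat -> int).
Hypothesis nud : nu <= d%:R.
Hypothesis hq : forall n, (0 < n)%N -> q n = (nth_prime n ^ d)%N%:Z.

(** Powers of distinct primes are coprime, so the reduced denominator is [p ^ d]
    for the [n]-th prime [p], and [2 ^ lvl k] is at most of order [n ^ d]. Their
    ratio tends to [0] because [p] outgrows every multiple of [n]. *)
Lemma prime_power_cost : small_pair_cost s tau nu q.
Proof.
move=> eta eta0.
have d0 : (0 < d)%N by rewrite -(ltr_nat R); apply: lt_le_trans (le_trans nu1 nud).
have [c hc] : exists c : nat, pow2 (d%:R + 3 - c%:R) <= eta.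
  have [c hc] := pow2_decay (d%:R + 3) ltr01 eta0 ler01.
  by exists c; have := hc c (leqnn c); rewrite mul1r mulr1.
exists (6 * 2 ^ c).+1%N => k kc.
have red n m : n != m -> reduced_den (@block q k) n m =
    (nth_prime (2 ^ k + n) ^ d)%N.
  move=> nm; have pos (i : 'I_(2 ^ k)) : (0 < 2 ^ k + i)%N by rewrite addn_gt0 expn_gt0.
  rewrite /reduced_den /block !hq// !absz_nat.
  have -> : gcdn (nth_prime (2 ^ k + n) ^ d) (nth_prime (2 ^ k + m) ^ d) = 1%N.
    apply/eqP; rewrite -/(coprime _ _); apply: coprimeXl; apply: coprimeXr.
    rewrite prime_coprime ?nth_prime_prime// dvdn_prime2 ?nth_prime_prime//.
    by apply: contra nm => /eqP/nth_prime_inj/addnI/val_inj ->.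
  by rewrite divn1.
apply: (@le_trans _ _ (\sum_(n < 2 ^ k) \sum_(m < 2 ^ k) eta)); last first.
  rewrite !sumr_const card_ord -[_ *+ _ *+ _]mulr_natl -[_ *+ _]mulr_natl.
  by apply/le_of_eq; ring.
apply: ler_sum => n _; rewrite big_mkcond; apply: ler_sum => m _.
case: ifPn => [mn|_]; last exact: ltW.
rewrite red 1?eq_sym// /pc /pair_cost ge_min; apply/orP; left.
apply: le_trans hc.
have pn : (2 ^ (k + c) < nth_prime (2 ^ k + n))%N.
  exact: nth_prime_superlinear kc (leq_addr _ _).
have p0 : 0 < (nth_prime (2 ^ k + n) ^ d)%N%:R :> R.
  by rewrite ltr0n expn_gt0 (leq_ltn_trans _ pn).
rewrite ler_pdivrMr//.
apply: (@le_trans _ _ (pow2 (d%:R + 3 - c%:R) * pow2 ((k + c) * d)%N%:R)).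
  rewrite -pow2D -pow2_nat pow2_le// natrM natrD.
  have d1 : 1 <= d%:R :> R by rewrite ler1n.
  have := lvl_le k; have := nud.
  have : k%:R * nu <= k%:R * d%:R by rewrite ler_wpM2l.
  have : c%:R <= c%:R * d%:R :> R by rewrite ler_peMr.
  lra.
rewrite ler_wpM2l ?pow2_ge0// pow2_nat -natrX ler_nat expnM leq_exp2r//.
exact: ltnW.
Qed.

End primes.

Section polynomials.
Variables (P : {poly int}) (D : nat) (q : nat -> int).
Hypotheses (sP : size P = D.+1) (nuD : nu < D%:R).
Hypothesis hq : forall n, (0 < n)%N -> q n = P.[n%:Z].

Let D0 : (0 < D)%N.
Proof. by rewrite -(ltr_nat R); apply: le_lt_trans nuD. Qed.

(** On the right each [m] is counted under every common divisor of [M] and [f m],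
    in particular under their gcd. *)
Lemma sum_gcd_le (M : nat) (F : nat -> R) (r : seq nat) (f : nat -> nat) : (0 < M)%N ->
  (forall b, 0 <= F b) ->
  \sum_(m <- r) F (M %/ gcdn M (f m))%N <=
  \sum_(g <- divisors M) F (M %/ g)%N * (size [seq m <- r | (g %| f m)%N])%:R.
Proof.
move=> M0 F0.
apply: (@le_trans _ _ (\sum_(m <- r) \sum_(g <- divisors M | (g %| f m)%N) F (M %/ g)%N)).
  apply: ler_sum => m _.
  have gM : gcdn M (f m) \in divisors M by rewrite -dvdn_divisors// dvdn_gcdl.
  by rewrite (big_rem _ gM)/= dvdn_gcdr lerDl sumr_ge0.
rewrite (exchange_big_dep predT)//=; apply: ler_sum => g _.
rewrite size_filter -sum1_count natr_sum mulr_sumr; apply: ler_sum => m _.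
by rewrite mulr1.
Qed.

(** Since [nu * sigma < 1], the exponent [eps] measures the room left in
    [polynomial_cost]. *)
Let sigma : R := Num.max D%:R^-1 (1 - s + tau).
Let eps : R := (1 - nu * sigma) / 4.

Let sigma0 : 0 <= sigma.
Proof. by rewrite le_max invr_ge0 ler0n. Qed.

Let eps0 : 0 < eps.
Proof.
have DR : 0 < D%:R :> R by rewrite ltr0n.
have h : nu * sigma < 1.
  rewrite /sigma; case: (leP D%:R^-1 (1 - s + tau)) => _; first exact: hnu.
  by rewrite ltr_pdivrMr// mul1r.
by rewrite /eps divr_gt0// subr_gt0.
Qed.

(** The second bound of [pair_cost]. *)
Let second (j b : nat) : R := let B := (minn b (2 ^ j))%:R in
  pow2 (j%:R * (1 - s)) * (pow2 (j%:R * tau) + B `^ s) / B.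

(** Up to the loss in the divisor bound, [b `^ D^-1] bounds the number of [m] that
    give the reduced denominator [b]. *)
Let second_le j b X : (0 < b)%N -> 0 <= X -> b%:R <= pow2 (j%:R + X) ->
  second j b * b%:R `^ (D%:R^-1) <= 2 * pow2 (j%:R * sigma) * pow2 X.
Proof.
move=> b0 X0 bX; rewrite /second; set B := (minn b (2 ^ j))%:R.
have b1 : 1 <= b%:R :> R by rewrite ler1n.
have B1 : 1 <= B :> R by rewrite ler1n leq_min b0 expn_gt0.
have B0 : 0 < B := lt_le_trans ltr01 B1.
have D1 : D%:R^-1 <= 1 :> R by rewrite invf_le1 ?ltr0n// ler1n.
have Di0 : 0 <= D%:R^-1 :> R by rewrite invr_ge0.
have pX1 : 1 <= pow2 X by exact: pow2_ge1.
have pj : pow2 j%:R = (2 ^ j)%N%:R :> R by rewrite pow2_nat natrX.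
have bB : b%:R <= B * pow2 X.
  rewrite /B /minn; case: ltnP => _; first by rewrite ler_peMr.
  by rewrite -pj -pow2D.
have Bj : B <= pow2 j%:R by rewrite pj ler_nat geq_minr.
have bD : b%:R `^ (D%:R^-1) <= B `^ (D%:R^-1) * pow2 X.
  apply: (@le_trans _ _ ((B * pow2 X) `^ (D%:R^-1))).
    by apply: ge0_ler_powR; rewrite ?nnegrE// mulr_ge0 ?pow2_ge0// ltW.
  rewrite powRM ?pow2_ge0 ?(ltW B0)// ler_wpM2l ?powR_ge0// -[leRHS]powRr1 ?pow2_ge0//.
  by rewrite ler_powR.
apply: (@le_trans _ _ (pow2 (j%:R * (1 - s)) * (pow2 (j%:R * tau) + B `^ s) / B *
    (B `^ (D%:R^-1) * pow2 X))).
  rewrite ler_wpM2l// divr_ge0 ?(ltW B0)// mulr_ge0 ?pow2_ge0// addr_ge0 ?pow2_ge0 ?powR_ge0//.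
rewrite mulrA ler_wpM2r ?pow2_ge0//.
set Y := B `^ (D%:R^-1).
have -> : pow2 (j%:R * (1 - s)) * (pow2 (j%:R * tau) + B `^ s) / B * Y =
   pow2 (j%:R * (1 - s)) * pow2 (j%:R * tau) * (Y / B) +
   pow2 (j%:R * (1 - s)) * (B `^ s / B) * Y by ring.
have s1 : 0 <= 1 - s by have /andP[_] := hs; rewrite subr_ge0.
have jn : 0 <= j%:R :> R by [].
have t1 : pow2 (j%:R * (1 - s)) * pow2 (j%:R * tau) * (Y / B) <= pow2 (j%:R * sigma).
  rewrite -pow2D -mulrDr; apply: (@le_trans _ _ (pow2 (j%:R * (1 - s + tau)))).
    rewrite ler_piMr ?pow2_ge0// ler_pdivrMr// mul1r -[leRHS]powRr1 ?(ltW B0)//.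
    by rewrite ler_powR.
  by rewrite pow2_le// ler_wpM2l// le_max lexx orbT.
have t2 : pow2 (j%:R * (1 - s)) * (B `^ s / B) * Y <= pow2 (j%:R * sigma).
  have jB : 1 <= pow2 j%:R / B by rewrite ler_pdivlMr// mul1r.
  have -> : pow2 (j%:R * (1 - s)) * (B `^ s / B) = (pow2 j%:R / B) `^ (1 - s).
    rewrite powRM ?pow2_ge0 ?invr_ge0 ?(ltW B0)// -pow2M; congr (_ * _).
    have -> : B^-1 = B `^ (- 1) by rewrite powR_inv1// ltW.
    rewrite -powRrM -powRD; last by rewrite (gt_eqF B0) implybT.
    by congr (_ `^ _); ring.
  apply: (@le_trans _ _ ((pow2 j%:R / B) `^ sigma * B `^ sigma)).
    apply: ler_pM; rewrite ?powR_ge0//.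
      by rewrite ler_powR// le_max; apply/orP; right; rewrite lerDl ltW.
    by rewrite ler_powR// le_max lexx.
  rewrite -powRM ?divr_ge0 ?pow2_ge0 ?(ltW B0)// divfK ?gt_eqF// -pow2M.
  exact: lexx.
have -> : 2 * pow2 (j%:R * sigma) = pow2 (j%:R * sigma) + pow2 (j%:R * sigma) by ring.
exact: lerD.
Qed.

Lemma pow_root_le (A x : R) (K : nat) : (0 < K)%N -> 1 <= A -> 0 <= x ->
  forall y : R, 0 <= y -> y ^+ K <= A * x ^+ K -> y <= A * x.
Proof.
move=> K0 A1 x0 y y0 h; rewrite -(ler_pXn2r K0) ?nnegrE//; last first.
  by rewrite mulr_ge0// (le_trans ler01).
apply: le_trans h _; rewrite exprMn ler_wpM2r ?exprn_ge0//.
by rewrite -[leLHS]expr1 ler_weXn2l.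
Qed.

Let c := absz (lead_coef P).

(** In [poly_root_count] the length [2 ^ k] of the block is at most [n], and
    [n ^ D] is of order [M]. So the quotient of the length by the modulus is at
    most of order [M %/ g] to the power [1 / D]. *)
Let root_count (C k : nat) n g : (2 ^ k <= n)%N ->
  (n ^ D <= C * absz (P.[n%:Z])%R)%N -> (g %| absz (P.[n%:Z])%R)%N ->
  let M := absz (P.[n%:Z])%R in
  (size [seq m <- iota (2 ^ k) (2 ^ k) | (g %| absz (P.[m%:Z])%R)%N])%:R
    <= (D ^ size (primes M))%N%:R * ((C * c).+1%:R * (M %/ g)%N%:R `^ (D%:R^-1)) :> R.
Proof.
move=> kn nC gM; set M := absz _ in nC gM *; move=> /=.
have n0 : (0 < n)%N by rewrite (leq_trans _ kn)// expn_gt0.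
have nD0 : (0 < n ^ D)%N by rewrite expn_gt0 n0.
have M0 : (0 < M)%N by rewrite lt0n; apply: contraTneq nC => ->; rewrite muln0 -ltnNge.
have C0 : (0 < C)%N by rewrite lt0n; apply: contraTneq nC => ->; rewrite mul0n -ltnNge.
have c0 : (0 < c)%N by rewrite absz_gt0 lead_coef_eq0 -size_poly_eq0 sP.
have g0 : (0 < g)%N by exact: dvdn_gt0 gM.
have [g' [g'0 gc le]] := poly_root_count (2 ^ k) (2 ^ k) D0 sP g0.
rewrite -/c in gc.
set b := (M %/ g)%N; have b0 : (0 < b)%N by rewrite divn_gt0// dvdn_leq.
have Mb : M = (b * g)%N by rewrite divnK.
set y := (2 ^ k %/ g')%N in le.
have yD : (y ^ D <= C * c * b)%N.
  rewrite -(leq_pmul2r (_ : 0 < g' ^ D)%N) ?expn_gt0 ?g'0// -expnMn.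
  apply: (@leq_trans ((2 ^ k) ^ D)); first by rewrite leq_exp2r// leq_divM.
  apply: (@leq_trans (n ^ D)); first by rewrite leq_exp2r.
  apply: (leq_trans nC); rewrite Mb -!mulnA leq_mul2l; apply/orP; right.
  by rewrite mulnCA leq_mul2l gc orbT.
have Di0 : 0 <= D%:R^-1 :> R by rewrite invr_ge0.
have DR : D%:R != 0 :> R by rewrite pnatr_eq0 -lt0n.
pose x := b%:R `^ (D%:R^-1) : R.
have x1 : 1 <= x.
  have -> : 1 = 1 `^ (D%:R^-1) :> R by rewrite powR1.
  by apply: ge0_ler_powR; rewrite ?nnegrE// ler1n.
have xD : x ^+ D = b%:R.
  by rewrite -powR_mulrn ?powR_ge0// -powRrM mulVf// powRr1.
have yx : y%:R <= (C * c).+1%:R * x - x.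
  have C1 : 1 <= (C * c)%:R :> R.
    by rewrite ler1n muln_gt0 C0.
  rewrite -natr1 mulrDl mul1r addrK.
  apply: (pow_root_le D0 C1) => //; first exact: le_trans x1.
  rewrite xD; by rewrite -natrX -natrM ler_nat.
have x0 : 0 <= x := le_trans ler01 x1.
apply: (@le_trans _ _ ((D ^ size (primes g))%N%:R * (y%:R + 1))).
  by move: le; rewrite -(ler_nat R) natrM natrD.
apply: ler_pM => //.
  rewrite ler_nat leq_pexp2l//; apply: uniq_leq_size; first exact: primes_uniq.
  by move=> p; rewrite !mem_primes => /and3P[-> _ pg]; rewrite M0 (dvdn_trans pg gM).
by have := lerD yx x1; rewrite subrK.
Qed.

(** Fix [n] and put [M = |q n|]. Pairs whose reduced denominator exceeds [2 ^ j]
    by the factor [2 ^ X] are cheap by the first bound of [pair_cost]. For each of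
    the other reduced denominators [M / g], the number of [m] is bounded by
    [root_count], and [second_le] bounds their joint cost by about
    [2 ^ (j * sigma + X)], where [j * sigma] is [k * (1 - 4 * eps)] up to a
    constant. By the divisor bound the number of divisors [g], even weighted by
    the factor in [root_count], is at most of order [2 ^ X]. With [X = k * eps]
    the sum over [m] is therefore small compared with [2 ^ k]. *)
Lemma polynomial_cost : small_pair_cost s tau nu q.
Proof.
move=> eta eta0.
have [C [C0 [n0 grow]]] := poly_growth sP D0.
pose K := (Num.truncn (D%:R / eps)).+1.
have DK : D%:R <= eps * K%:R.
  rewrite mulrC -ler_pdivrMr//; exact: ltW (truncnS_gt _).
have [W hW] := divisor_weight_bound D0 (ltn0Sn (Num.truncn (D%:R / eps))).
pose A : R := (W * C * 2 ^ D).+1%:R.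
have A1 : 1 <= A by rewrite ler1n.
pose A' : R := A * (C * c).+1%:R * 2.
have A'0 : 0 <= A' by rewrite !mulr_ge0.
have eta20 : 0 < eta / 2 by rewrite divr_gt0.
have [k1 hk1] := pow2_decay 0 eps0 eta20 ler01.
have e2 : 0 < 2 * eps by rewrite mulr_gt0.
have [k2 hk2] := pow2_decay ((nu + 3) * sigma) e2 eta20 A'0.
exists (maxn n0 (maxn k1 k2)) => k; rewrite !geq_max => /and3P[n0k k1k k2k].
set j := lvl k; set N := (2 ^ k)%N; set qs := @block q k.
pose X := k%:R * eps; have X0 : 0 <= X by rewrite mulr_ge0// ltW.
have N0 : (0 < N)%N by rewrite expn_gt0.
have NR : N%:R = pow2 k%:R :> R by rewrite pow2_nat natrX.
pose F b := if b%:R <= pow2 (j%:R + X) then second j b else 0.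
have sec0 b : 0 <= second j b.
  by rewrite divr_ge0// mulr_ge0 ?pow2_ge0// addr_ge0 ?pow2_ge0 ?powR_ge0.
have F0 b : 0 <= F b by rewrite /F; case: ifP.
have pcF b : (0 < b)%N -> pc j b <= F b + pow2 (- X).
  move=> b0; rewrite /pc /pair_cost /F; case: ifPn => [bX|].
    by rewrite ge_min; apply/orP; right; rewrite lerDl pow2_ge0.
  rewrite -ltNge => bX; rewrite add0r ge_min; apply/orP; left.
  rewrite ler_pdivrMr ?ltr0n// mulrC pow2N ler_pdivlMr ?pow2_gt0//.
  by rewrite -pow2_nat -pow2D ltW.
have row n : \sum_(m < N | m != n) pc j (reduced_den qs n m) <=
    N%:R * pow2 (- X) + A' * (pow2 X * pow2 (j%:R * sigma) * pow2 X).
  have nk (i : 'I_N) : (n0 <= N + i)%N.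
    by rewrite (leq_trans n0k)// (leq_trans (ltnW (ltn_expl k (ltnSn 1))))// leq_addr.
  have pos (i : 'I_N) : (0 < N + i)%N by rewrite addn_gt0 N0.
  have [Mup Mlow] := grow _ (nk n).
  set M := absz _ in Mup Mlow.
  have M0 : (0 < M)%N.
    by rewrite lt0n; apply: contraTneq Mlow => ->; rewrite muln0 -ltnNge expn_gt0 pos.
  have quot_gt0 a : (0 < M %/ gcdn M a)%N.
    have g0 : (0 < gcdn M a)%N by rewrite gcdn_gt0 M0.
    by rewrite divn_gt0 // dvdn_leq // dvdn_gcdl.
  have redE m : reduced_den qs n m = (M %/ gcdn M (absz (P.[(N + m)%N%:Z])%R))%N.
    by rewrite /reduced_den /qs /block !hq ?pos.
  apply: (@le_trans _ _ (\sum_(m < N) (F (reduced_den qs n m) + pow2 (- X)))).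
    rewrite big_mkcond; apply: ler_sum => m _; case: ifP => _.
      by apply: pcF; rewrite redE quot_gt0.
    by rewrite addr_ge0 ?pow2_ge0.
  rewrite big_split/= sumr_const card_ord -[_ *+ _]mulr_natl addrC lerD2l.
  have -> : \sum_(m < N) F (reduced_den qs n m) =
      \sum_(m <- iota N N) F (M %/ gcdn M (absz (P.[m%:Z])%R))%N.
    have -> : iota N N = index_iota (0 + N) (N + N) by rewrite /index_iota add0n addnK.
    rewrite big_addn addnK big_mkord; apply: eq_bigr => m _.
    by rewrite redE addnC.
  apply: le_trans (sum_gcd_le _ (fun m => absz (P.[m%:Z])%R) M0 F0) _.
  pose w := (D ^ size (primes M))%N.
  apply: (@le_trans _ _ (\sum_(g <- divisors M)
      w%:R * (C * c).+1%:R * (2 * pow2 (j%:R * sigma) * pow2 X))).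
    rewrite big_seq [leRHS]big_seq; apply: ler_sum => g; rewrite -dvdn_divisors// => gM.
    have g0 : (0 < g)%N := dvdn_gt0 M0 gM.
    have b0 : (0 < M %/ g)%N by rewrite (divn_gt0 _ g0); exact: dvdn_leq gM.
    have cnt := root_count (leq_addr n N) Mlow gM.
    apply: le_trans (ler_wpM2l (F0 _) cnt) _.
    have -> : F (M %/ g)%N * (w%:R * ((C * c).+1%:R * (M %/ g)%N%:R `^ D%:R^-1)) =
      w%:R * (C * c).+1%:R * (F (M %/ g)%N * (M %/ g)%N%:R `^ D%:R^-1) by ring.
    rewrite ler_wpM2l ?mulr_ge0// /F; case: ifP => bX.
      exact: second_le.
    by rewrite mul0r !mulr_ge0 ?pow2_ge0.
  rewrite big_const_seq count_predT iter_addr_0 -[leLHS]mulr_natl.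
  have wb : (size (divisors M) * w)%N%:R <= A * pow2 X.
    apply: (pow_root_le (ltn0Sn (Num.truncn (D%:R / eps))) A1); rewrite ?pow2_ge0//.
    apply: (@le_trans _ _ ((W * C * 2 ^ D)%N%:R * pow2 (k%:R * D%:R))).
      have -> : pow2 (k%:R * D%:R) = (2 ^ (k * D))%N%:R :> R by rewrite natrX -natrM pow2_nat.
      rewrite -natrX -natrM ler_nat; apply: leq_trans (hW _ M0) _.
      rewrite -!mulnA leq_mul2l; apply/orP; right; apply: (leq_trans Mup).
      rewrite leq_mul2l; apply/orP; right; rewrite expnM -expnMn leq_exp2r// -/N.
      by rewrite mul2n -addnn leq_add2l ltnW.
    apply: ler_pM; rewrite ?pow2_ge0 ?ler_nat ?leqnSn//.
    rewrite -powR_mulrn ?pow2_ge0// -pow2M pow2_le// /X -mulrA ler_wpM2l//.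
  apply: (@le_trans _ _ ((A * pow2 X) * ((C * c).+1%:R * (2 * pow2 (j%:R * sigma) * pow2 X)))).
    rewrite natrM in wb; rewrite !mulrA ler_wpM2r ?pow2_ge0// ler_wpM2r ?pow2_ge0//.
    by rewrite ler_wpM2r// ler_wpM2r.
  by rewrite /A'; apply/le_of_eq; ring.
apply: (@le_trans _ _ (\sum_(n < N) (N%:R * pow2 (- X) + A' * (pow2 X * pow2 (j%:R * sigma) * pow2 X)))).
  by apply: ler_sum => n _.
rewrite sumr_const card_ord -[leLHS]mulr_natl.
have p1 : pow2 (- X) <= eta / 2.
  by have := hk1 k k1k; rewrite mul1r add0r.
have p2 : A' * (pow2 X * pow2 (j%:R * sigma) * pow2 X) <= N%:R * (eta / 2).
  apply: le_trans (ler_wpM2l _ (hk2 k k2k)); last by [].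
  rewrite [leRHS]mulrCA ler_wpM2l// NR -!pow2D pow2_le//.
  have := ler_wpM2r sigma0 (lvl_le k); rewrite -/j /X.
  have -> : k%:R * (2 * eps) = k%:R * ((1 - nu * sigma) / 2) by rewrite /eps; field.
  have -> : k%:R * eps = k%:R * ((1 - nu * sigma) / 4) by [].
  lra.
rewrite expr2 [leRHS]mulrCA ler_wpM2l//.
have -> : eta * N%:R = N%:R * (eta / 2) + N%:R * (eta / 2) by field.
by rewrite lerD// ler_wpM2l.
Qed.

End polynomials.
End block_costs.

(** * Hausdorff dimension on the circle *)

Section dimension.
Context {R : realType}.
Implicit Types (A G : set (circle R)) (t d : R).

Lemma hausdorff_measure_eq0 t A :
  (forall e eta : R, 0 < e -> 0 < eta -> exists F : nat -> set (circle R),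
    [/\ A `<=` \bigcup_k F k, forall k, (diam (F k) <= e%:E)%E &
        forall n, (\sum_(0 <= k < n) diam_pow t (F k) <= eta%:E)%E]) ->
  hausdorff_measure t A = 0%E.
Proof.
move=> h; apply/eqP; rewrite eq_le hausdorff_measure_ge0 andbT.
apply/lee_addgt0Pr => eta eta0; rewrite add0e.
apply: hausdorff_measure_le => e e0; have [F [AF Fe Feta]] := h _ _ e0 eta0.
apply: le_trans (hausdorff_content_le t AF Fe) _.
by apply: nneseries_le_bound => // k; exact: diam_pow_ge0.
Qed.

(** Countably many exponents around [d] decide, so that null sets of [x] found for
    each exponent can be united. *)
Lemma hausdorff_dim_eq A d : 0 <= d ->
  (forall i : nat, hausdorff_measure (d + i.+1%:R^-1) A = 0%E) ->
  (forall i : nat, 0 < d - i.+1%:R^-1 ->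
    hausdorff_measure (d - i.+1%:R^-1) A <> 0%E) ->
  hausdorff_dim A = d%:E.
Proof.
move=> d0 up low; apply/eqP; rewrite eq_le; apply/andP; split.
  apply/lee_addgt0Pr => e e0; pose i := Num.truncn e^-1.
  have ie : i.+1%:R^-1 <= e.
    by rewrite -[leRHS]invrK lef_pV2 ?posrE ?invr_gt0// ltW// truncnS_gt.
  apply: (@le_trans _ _ (d + i.+1%:R^-1)%:E); last by rewrite -EFinD lee_fin lerD2l.
  apply: ereal_inf_lbound; exists (d + i.+1%:R^-1) => //; split; last exact: up.
  by rewrite addr_ge0.
apply: le_ereal_inf_tmp => _ [t [t0 At] <-]; rewrite lee_fin leNgt; apply/negP => td.
have dt : 0 < d - t by rewrite subr_gt0.
pose i := Num.truncn (d - t)^-1.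
have id : i.+1%:R^-1 <= d - t.
  by rewrite -[leRHS]invrK lef_pV2 ?posrE ?invr_gt0// ltW// truncnS_gt.
have id2 : i.+2%:R^-1 < d - t.
  by apply: lt_le_trans id; rewrite ltf_pV2 ?posrE// ltr_nat.
have ti : t < d - i.+2%:R^-1 by rewrite ltrBrDr addrC -ltrBrDr.
apply: (low i.+1); first exact: le_lt_trans ti.
apply/eqP; rewrite eq_le hausdorff_measure_ge0 andbT -At.
by apply: hausdorff_measure_le_dim mdist_le1; rewrite t0 ltW.
Qed.

Variables (G : set (circle R)) (s c0 : R).
Hypotheses (hs : 0 < s <= 1) (c0_gt0 : 0 < c0).
Hypothesis hA : forall (x : circle R) (r : R), G x -> 0 < r <= 1 / 2 ->
  ((r `^ s / c0)%:E <= hausdorff_measure s (G `&` ball x r) <= (c0 * r `^ s)%:E)%E.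

Lemma ahlfors_dim : G !=set0 -> hausdorff_dim G = s%:E.
Proof.
move=> [g Gg]; have /andP[s0 s1] := hs.
apply: hausdorff_dim_eq => [|i|i si]; first exact: ltW.
  set t := s + _; have st : 0 < t - s by rewrite /t addrAC subrr add0r.
  apply: hausdorff_measure_eq0 => e eta e0 eta0.
  have C0 : 0 < 32 * c0 ^+ 2 by rewrite mulr_gt0// exprn_gt0.
  have x0 : 0 < eta / (32 * c0 ^+ 2) by rewrite divr_gt0.
  have [l1 h1] := pow2_small ltr01 e0.
  have [l2 h2] := pow2_small st x0.
  pose j := maxn l1 l2.
  pose F v := G `&` [set y | cell j y = v].
  have Fr v y z : F v y -> F v z -> mdist y z <= pow2 (- j%:R).
    move=> [_ yv] [_ zv]; rewrite pow2_natV ltW//; apply: cell_mdist; congruence.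
  exists F; split=> [y Gy|v|n].
  - by exists (cell j y).
  - apply: diam_le => y z Fy Fz; rewrite lee_fin (le_trans (Fr _ _ _ Fy Fz))//.
    by have := h1 j (leq_maxl _ _); rewrite mulr1 => /ltW.
  have t0 : 0 <= t by rewrite addr_ge0// ltW.
  pose f v : R := (gcell G j v)%:R * pow2 (- (j%:R * t)).
  apply: (@le_trans _ _ (\sum_(0 <= v < n) (f v)%:E)%E).
    apply: lee_sum => v _; rewrite /f; case: (boolP (gcell G j v)) => gv.
      rewrite mul1r -mulNr pow2M; apply: diam_pow_le => //; [exact: pow2_ge0|exact: Fr].
    rewrite (_ : F v = set0) ?diam_pow_set0 ?mul0r//.
    apply/seteqP; split => // y [Gy yv]; move/negP: gv; apply.
    by rewrite -yv; exact: gcell_cell.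
  rewrite sumEFin lee_fin.
  apply: (@le_trans _ _ ((gcount G j 0 0)%:R * pow2 (- (j%:R * t)))).
    rewrite -mulr_suml ler_wpM2r ?pow2_ge0// -natr_sum ler_nat.
    rewrite /gcount subn0.
    rewrite (eq_bigl (fun v : 'I_(2 ^ j) => gcell G j v)); last first.
      by move=> v; rewrite divn_small// eqxx andbT.
    have -> : (\sum_(v < 2 ^ j | gcell G j v) 1 = \sum_(0 <= v < 2 ^ j) gcell G j v)%N.
      by rewrite big_mkord big_mkcond; apply: eq_bigr => v _; case: (gcell G j v).
    apply: (@leq_trans (\sum_(0 <= v < n + 2 ^ j) (gcell G j v))%N).
      by rewrite (big_cat_nat _ (leq_addr _ n))//= leq_addr.
    rewrite (@big_cat_nat _ _ _ (2 ^ j)) ?leq_addl//=.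
    rewrite [X in (_ + X)%N]big_nat_cond [X in (_ + X)%N]big1 ?addn0.
      exact: leqnn.
    move=> v /andP[/andP[jv _] _]; case: (boolP (gcell G j v)) => // /gcell_lt.
    by rewrite ltnNge jv.
  apply: (@le_trans _ _ (32 * c0 ^+ 2 * pow2 ((j%:R - 0%:R) * s) * pow2 (- (j%:R * t)))).
    by rewrite ler_wpM2r ?pow2_ge0//; exact: (gcount_le hs c0_gt0 hA).
  rewrite -mulrA -pow2D mulrC -ler_pdivlMr//.
  have := h2 j (leq_maxr _ _) => /ltW; apply: le_trans; rewrite pow2_le//.
  by rewrite subr0; apply/le_of_eq; ring.
move=> h0; have h2 : 0 < (1 / 2 : R) <= 1 / 2 by rewrite lexx divr_gt0.
have /andP[+ _] := hA Gg h2; apply/negP; rewrite -ltNge.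
apply: (@le_lt_trans _ _ (hausdorff_measure (s - i.+1%:R^-1) G)); last first.
  by rewrite h0 lte_fin divr_gt0// powR_gt0.
apply: le_trans (hausdorff_measure_mono s (@subIsetl _ G _)) _.
apply: hausdorff_measure_le_dim mdist_le1.
by rewrite (ltW si)/= lerBlDr lerDl invr_ge0.
Qed.

End dimension.

(** * From averages over a grid to almost every point *)

Section grid.
Context {R : realType}.
Implicit Types (x : R) (L : nat) (P : pred nat).

Definition grid L x : nat := Num.truncn (L%:R * x).

Lemma grid_itv L x : 0 <= x -> (grid L x)%:R <= L%:R * x < (grid L x).+1%:R.
Proof. by move=> x0; apply: truncn_itv; rewrite mulr_ge0. Qed.

Lemma grid_lt L x : (0 < L)%N -> 0 <= x < 1 -> (grid L x < L)%N.
Proof.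
move=> L0 /andP[x0 x1]; rewrite -(ltr_nat R); have /andP[h _] := grid_itv L x0.
by apply: le_lt_trans h _; rewrite gtr_pMr// ltr0n.
Qed.

Definition grid_cell L v : set R := `[v%:R / L%:R, v.+1%:R / L%:R[%classic.

Definition grid_set L P : set R :=
  \big[setU/set0]_(v < L) (if P v then grid_cell L v else set0).

Lemma grid_setP L P x : (0 < L)%N -> 0 <= x < 1 -> P (grid L x) -> grid_set L P x.
Proof.
move=> L0 x01 Px; have /andP[x0 _] := x01; have /andP[h1 h2] := grid_itv L x0.
apply: (@in_bigsetU _ _ _ _ _ (Ordinal (grid_lt L0 x01))) => //=; first exact: mem_index_enum.
by rewrite Px /grid_cell /= in_itv /= ler_pdivrMr ?ltr0n// ltr_pdivlMr ?ltr0n// mulrC h1.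
Qed.

Lemma measurable_grid_cell L v : measurable (grid_cell L v).
Proof. exact: measurable_itv. Qed.

Lemma measure_grid_cell L v : (0 < L)%N ->
  lebesgue_measure (grid_cell L v) = (L%:R^-1)%:E.
Proof.
move=> L0; have := @lebesgue_measure_itv R `[v%:R / L%:R, v.+1%:R / L%:R[.
rewrite /grid_cell => -> /=; rewrite lte_fin ltr_pM2r ?invr_gt0 ?ltr0n// ltr_nat leqnn.
by rewrite -EFinB -mulrBl -natrB// subSnn mul1r.
Qed.

Lemma measurable_grid_set L P : measurable (grid_set L P).
Proof.
apply: bigsetU_measurable => v _; case: (P v) => //.
exact: measurable_grid_cell.
Qed.

(** Markov's inequality for functions of the position on the grid. *)
Lemma measure_grid_set_le L (f : nat -> R) (eta a : R) : (0 < L)%N -> 0 < eta ->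
  (forall v, 0 <= f v) -> \sum_(v < L) f v <= L%:R * a ->
  (lebesgue_measure (grid_set L (fun v => (eta <= f v)%R)) <= (a / eta)%:E)%E.
Proof.
move=> L0 eta0 f0 fa; set P := fun v => _.
have LR : 0 < L%:R :> R by rewrite ltr0n.
pose A v := if P v then grid_cell L v else set0.
apply: le_trans (@Boole_inequality _ _ _ lebesgue_measure A L _) _.
  by move=> v _; rewrite /A; case: (P v) => //; exact: measurable_grid_cell.
apply: (@le_trans _ _ (\sum_(v < L) (f v / (eta * L%:R))%:E)%E).
  apply: lee_sum => v _; rewrite /A /P; case: ifP => [ef|_].
    apply: (@le_trans _ _ (L%:R^-1)%:E).
      exact: (eq_ind_r (fun z => (z <= _)%E) (lexx _) (measure_grid_cell v L0)).
    rewrite lee_fin.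
    by rewrite invfM mulrA -[leLHS]mul1r ler_wpM2r ?invr_ge0// ler_pdivlMr// mul1r.
  by rewrite measure0 lee_fin divr_ge0// mulr_ge0// ltW.
rewrite sumEFin lee_fin -mulr_suml invfM mulrCA [leRHS]mulrC ler_wpM2l ?invr_ge0 ?(ltW eta0)//.
by rewrite ler_pdivrMr// mulrC.
Qed.

Lemma negligible_small (A : set R) :
  (forall e : R, 0 < e -> exists B : set R, [/\ measurable B, A `<=` B &
     (lebesgue_measure B <= e%:E)%E]) -> lebesgue_measure.-negligible A.
Proof.
move=> h; have h' (i : nat) : exists B : set R, [/\ measurable B, A `<=` B &
    (lebesgue_measure B <= (i.+1%:R^-1)%:E)%E].
  by apply: h; rewrite invr_gt0.
have {h h'} [B hB] := choice h'.
exists (\bigcap_i B i); split; last by move=> x Ax i _; have [_ + _] := hB i; exact.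
  by apply: bigcapT_measurable => i; have [] := hB i.
apply/eqP; rewrite eq_le measure_ge0 andbT; apply/lee_addgt0Pr => e e0; rewrite add0e.
pose i := Num.truncn e^-1.
have ie : i.+1%:R^-1 <= e.
  by rewrite -[leRHS]invrK lef_pV2 ?posrE ?invr_gt0// ltW// truncnS_gt.
have [mB _ Be] := hB i.
apply: (@le_trans _ _ (lebesgue_measure (B i))).
  apply: le_measure; rewrite ?inE//; last exact: bigcap_inf.
  by apply: bigcapT_measurable => k; have [] := hB k.
by apply: le_trans Be _; rewrite lee_fin.
Qed.

End grid.

Section approximation.
Context {R : realType}.
Implicit Types (x : R) (q : int) (y z : circle R).

Lemma dist_intDz (a : R) (k : int) : dist_int (a + k%:~R) = dist_int a.
Proof.
have le (b : R) (i : int) : dist_int (b + i%:~R) <= dist_int b.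
  apply/ler_addgt0Pr => e e0; have [m /ltW hm] := dist_int_adherent b e0.
  apply: le_trans (dist_int_le _ (m + i)) _.
  by rewrite intrD opprD addrACA subrr addr0.
by apply/eqP; rewrite eq_le le/= -{1}(addrK k%:~R a) -mulrNz le.
Qed.

(** Rounding [x] down to the grid moves [q * x] by at most [|q| / L], which is at
    most [2 ^- j]. *)
Lemma dist_dcell L j q x y : (0 < L)%N -> q != 0 -> (absz q * 2 ^ j %| L)%N -> 0 <= x ->
  cell j y = dcell L j q (grid L x) -> dist_int ((y : R) - q%:~R * x) <= 2 * 2 ^- j.
Proof.
move=> L0 q0 qL x0; set g := grid L x => yg.
have LR : 0 < L%:R :> R by rewrite ltr0n.
have J0 : 0 < 2 ^+ j :> R by rewrite exprn_gt0.
have jL : (2 ^ j %| L)%N by apply: dvdn_trans qL; exact: dvdn_mull.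
pose w := (L %/ 2 ^ j)%N; have Lw : (L = w * 2 ^ j)%N by rewrite divnK.
have w0 : (0 < w)%N by rewrite divn_gt0 ?expn_gt0// dvdn_leq.
pose r := resz L (q * g%:Z); pose c : int := (q * g%:Z %/ L%:Z)%Z.
have qg : q%:~R * g%:R = c%:~R * L%:R + r%:R :> R.
  have := congr1 (fun z : int => z%:~R : R) (divz_eq (q * g%:Z) L%:Z).
  rewrite -(reszE L0) rmorphM rmorphD rmorphM/= -!pmulrn; exact.
have rv : (r %/ w)%N%:R * w%:R <= (r%:R : R) < ((r %/ w)%N%:R + 1) * w%:R.
  rewrite natr1 -!natrM ler_nat ltr_nat leq_divM /= mulSn addnC.
  by rewrite {1}(divn_eq r w) ltn_add2l ltn_mod.
have Lw' : L%:R = w%:R * 2 ^+ j :> R by rewrite Lw natrM natrX.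
have wR : 0 < w%:R :> R by rewrite ltr0n.
have rJ : (cell j y)%:R <= (2 ^+ j * (r%:R / L%:R) : R) < (cell j y)%:R + 1.
  rewrite yg /dcell -/r -/w.
  have -> : 2 ^+ j * (r%:R / L%:R) = r%:R / w%:R :> R.
    have assoc (a b e : R) : 0 < a -> 0 < b -> a * (e / (b * a)) = e / b.
      by move=> a0 b0; field; rewrite !gt_eqF.
    by rewrite Lw' assoc.
  by rewrite ler_pdivlMr// ltr_pdivrMr.
have d1 : `|(y : R) - r%:R / L%:R| <= 2 ^- j.
  rewrite -(ler_pM2l J0) divff ?gt_eqF// -{1}(gtr0_norm J0) -normrM mulrBr.
  by have := cell_itv j y; rewrite ler_norml; move: rJ; set A := _ * (y : R); set B := _ * (_ / _); lra.
have d2 : `|q%:~R * (g%:R / L%:R) - q%:~R * x| <= 2 ^- j.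
  rewrite -mulrBr normrM.
  have /andP[h1 h2] := grid_itv L x0; rewrite -/g in h1 h2.
  have hx : `|g%:R / L%:R - x| <= L%:R^-1.
    rewrite -(ler_pM2l LR) divff ?gt_eqF// -{1}(gtr0_norm LR) -normrM mulrBr.
    rewrite mulrCA divff ?gt_eqF// mulr1 ler_norml.
    by move: h1 h2; rewrite -natr1; set A := L%:R * x; lra.
  apply: le_trans (ler_wpM2l (normr_ge0 _) hx) _.
  rewrite ler_pdivrMr// ler_pdivlMl// mulrC -intr_norm -abszE -natrX.
  rewrite -[(absz q)%:~R]/((absz q)%:R : R) -natrM ler_nat.
  exact: dvdn_leq.
have -> : (y : R) - q%:~R * x = ((y : R) - r%:R / L%:R) +
    (q%:~R * (g%:R / L%:R) - q%:~R * x) + (- c)%:~R.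
  have -> : q%:~R * (g%:R / L%:R) = c%:~R + r%:R / L%:R :> R.
    by rewrite mulrA qg mulrDl mulfK ?gt_eqF.
  by rewrite mulrNz; ring.
rewrite dist_intDz; apply: le_trans (dist_intD _ _) _.
have -> : 2 * 2 ^- j = 2 ^- j + 2 ^- j :> R by ring.
by apply: lerD; apply: le_trans (dist_int_le_norm _) _.
Qed.

End approximation.

(** * The lower bound *)

Lemma lebesgue_negligibleS {R : realType} (A B : set R) : B `<=` A ->
  lebesgue_measure.-negligible A -> lebesgue_measure.-negligible B.
Proof.
by move=> BA [C [mC C0 AC]]; exists C; split=> //; exact: (subset_trans BA).
Qed.

Section blocks.
Variable q : nat -> int.
Local Notation block := (@block q _).

(** A grid that is fine enough for all orbits of the block to be uniformly
    distributed over the cells of level [j]. *)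
Definition block_mod j k : nat := (2 ^ j * \prod_(n < 2 ^ k) absz (block n))%N.

Hypothesis q_neq0 : exists n0, forall n, (n0 <= n)%N -> q n != 0.

Lemma block_neq0 : exists k0, forall k, (k0 <= k)%N -> forall n : 'I_(2 ^ k), block n != 0.
Proof.
have [n0 h] := q_neq0; exists n0 => k n0k n; apply: h.
by rewrite (leq_trans n0k)// (leq_trans (ltnW (ltn_expl k (ltnSn 1))))// leq_addr.
Qed.

Lemma block_mod_gt0 j k : (forall n : 'I_(2 ^ k), block n != 0) -> (0 < block_mod j k)%N.
Proof.
by move=> h; rewrite muln_gt0 expn_gt0/= prodn_gt0// => n; rewrite absz_gt0 h.
Qed.

Lemma dvdn_block_mod j k (n : 'I_(2 ^ k)) : (absz (block n) * 2 ^ j %| block_mod j k)%N.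
Proof.
by rewrite mulnC dvdn_pmul2l ?expn_gt0// (bigD1 n)//= dvdn_mulr.
Qed.

End blocks.

Section lower_bound.
Context {R : realType}.
Variables (G : set (circle R)) (s c0 nu tau : R) (q : nat -> int).
Hypotheses (hs : 0 < s <= 1) (c0_gt0 : 0 < c0).
Hypothesis hA : forall (x : circle R) (r : R), G x -> 0 < r <= 1 / 2 ->
  ((r `^ s / c0)%:E <= hausdorff_measure s (G `&` ball x r) <= (c0 * r `^ s)%:E)%E.
Hypotheses (nu1 : 1 <= nu) (tau_gt0 : 0 < tau) (tau_s : tau < s).
Hypothesis hnu : nu * (1 - s + tau) < 1.
Hypothesis q_neq0 : exists n0, forall n, (n0 <= n)%N -> q n != 0.
Hypothesis small_cost : small_pair_cost s tau nu q.

Let L k := block_mod q (lvl nu k) k.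
Let weight k g := orbit_weight G s (lvl nu k) (L k) (@block q k) g.
Let disc k g := discrepancy G s tau (weight k g) (lvl nu k).

Let disc_ge0 k g : 0 <= disc k g.
Proof.
apply: sumr_ge0 => i _; rewrite mulr_ge0 ?pow2_ge0//.
by apply: sumr_ge0 => u _; exact: sqr_ge0.
Qed.

Lemma mean_discrepancy (eta : R) : 0 < eta -> exists k0 : nat, forall k, (k0 <= k)%N ->
  (forall n, @block q k n != 0) /\ \sum_(g < L k) disc k g <= (L k)%:R * eta.
Proof.
move=> eta0.
pose K := (32 * c0 ^+ 2 + 3 * (32 * c0 ^+ 2) ^+ 2) *
  ((1 - pow2 (- tau))^-1 + (1 - pow2 (- (s - tau)))^-1).
have K0 : 0 < K.
  have inv (a : R) : 0 < a -> 0 < (1 - pow2 (- a))^-1.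
    by move=> a0; rewrite invr_gt0 subr_gt0 -pow20 pow2_lt// oppr_lt0.
  have c2 : 0 < 32 * c0 ^+ 2 by rewrite mulr_gt0// exprn_gt0.
  apply: mulr_gt0; first by apply: addr_gt0 => //; rewrite mulr_gt0// exprn_gt0.
  by apply: addr_gt0; apply: inv => //; rewrite subr_gt0.
have e0 : 0 < eta / K / 2 by rewrite !divr_gt0.
have [k0 h0] := block_neq0 q_neq0.
have [k1 h1] := diagonal_cost hs tau_gt0 nu1 hnu e0.
have [k2 h2] := small_cost e0.
exists (maxn k0 (maxn k1 k2)) => k; rewrite !geq_max => /and3P[kk0 kk1 kk2].
have b0 := h0 k kk0; split=> //.
have N0 : (0 < 2 ^ k)%N by rewrite expn_gt0.
apply: le_trans (second_moment hs c0_gt0 hA tau_gt0 tau_s N0 (block_mod_gt0 _ b0) b0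
  (@dvdn_block_mod q (lvl nu k) k)) _.
rewrite -/K -/(L k) -mulrA ler_wpM2l// mulrC -ler_pdivlMr//.
have -> : eta / K = eta / K / 2 + eta / K / 2 by field; rewrite gt_eqF.
apply: lerD; first exact: h1.
by rewrite ler_pdivrMr ?exprn_gt0 ?ltr0n//; exact: h2.
Qed.

(** For each single [k] the exceptional set has measure at most the mean of the
    discrepancy over [eta], and these means tend to [0]. *)
Lemma ae_equidistributed (eta : R) (M : nat) : 0 < eta ->
  lebesgue_measure.-negligible [set x : R | 0 <= x < 1 /\
    forall k, (M <= k)%N -> eta <= disc k (grid (L k) x)].
Proof.
move=> eta0; apply: negligible_small => e e0.
have [k0 hk] := mean_discrepancy (mulr_gt0 e0 eta0).
pose k := maxn k0 M; have [b0 hD] := hk k (leq_maxl _ _).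
have L0 := block_mod_gt0 (lvl nu k) b0.
exists (grid_set (L k) (fun g => eta <= disc k g)); split.
- exact: measurable_grid_set.
- by move=> x [x01 h]; apply: grid_setP => //; apply: h; exact: leq_maxr.
apply: le_trans (measure_grid_set_le L0 eta0 (disc_ge0 k) hD) _.
by rewrite mulfK ?gt_eqF.
Qed.

(** By [lvl_ge] the target has radius at least [4 * 2 ^- lvl nu k], which leaves
    room for the error [2 * 2 ^- lvl nu k] of [dist_dcell]. *)
Lemma target_of_near_cell k g x y z v : 0 <= x -> (forall n, @block q k n != 0) ->
  g = grid (L k) x -> 0 < weight k g v -> cell (lvl nu k) y = v ->
  mdist y z <= 2 ^- lvl nu k ->
  exists n, [/\ (2 ^ k <= n)%N, (0 < n)%N & dist_int ((z : R) - (q n)%:~R * x) <= 1 / n%:R `^ nu].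
Proof.
move=> x0 b0 gx wv yv yz; set j := lvl nu k in yv yz *.
have [n cn] : exists n : 'I_(2 ^ k), dcell (L k) j (block q n) g = v.
  apply: contrapT => h; move: wv; rewrite /weight /orbit_weight big1 ?mulr0 ?ltxx//= => n _.
  by case: eqP => // cn; case: h; exists n.
have N0 : (0 < 2 ^ k)%N by rewrite expn_gt0.
have n0 : (0 < 2 ^ k + n)%N by rewrite addn_gt0 N0.
exists (2 ^ k + n)%N; split=> //; first exact: leq_addr.
have hy : dist_int ((y : R) - (block q n)%:~R * x) <= 2 * 2 ^- j.
  apply: (dist_dcell (block_mod_gt0 j b0) (b0 n) (dvdn_block_mod q j n) x0).
  by rewrite yv -cn gx.
have -> : (z : R) - (q (2 ^ k + n)%N)%:~R * x =
    ((z : R) - (y : R)) + ((y : R) - (block q n)%:~R * x) by rewrite /block; ring.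
apply: le_trans (dist_intD _ _) _.
apply: (@le_trans _ _ (4 * 2 ^- j)).
  have hz : dist_int ((z : R) - (y : R)) <= 2 ^- j by rewrite -dist_intN opprB -mdistE.
  have p0 : 0 < 2 ^- j :> R by rewrite invr_gt0 exprn_gt0.
  move: hy hz p0; move: (2 ^- j) (dist_int _) (dist_int _) => a b c; lra.
have nR : 0 < (2 ^ k + n)%N%:R :> R by rewrite ltr0n.
rewrite div1r -powRN -pow2_natV.
have -> : 4 = pow2 2 :> R by rewrite (pow2_nat 2); ring.
rewrite -pow2D; apply: (@le_trans _ _ (pow2 (k.+1%:R * - nu))).
  by rewrite pow2_le// mulrN; have := lvl_ge nu k; rewrite -/j; lra.
rewrite pow2M !powRN lef_pV2 ?posrE ?powR_gt0 ?pow2_gt0//.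
apply: ge0_ler_powR; rewrite ?nnegrE ?pow2_ge0 ?(le_trans ler01 nu1)//.
by rewrite pow2_nat -natrX ler_nat expnS mul2n -addnn leq_add2l ltnW.
Qed.

Lemma shrinking_targetsP x (z : circle R) :
  (forall M, exists n, [/\ (M <= n)%N, (0 < n)%N &
     dist_int ((z : R) - (q n)%:~R * x) <= 1 / n%:R `^ nu]) ->
  shrinking_targets q x nu z.
Proof.
move=> h; have /andP[z0 z1] := circle_valP z; split; first by rewrite z0 ltW.
move=> /finite_seqP[r]; set S := [set _ | _] => Sr.
pose B := (\max_(n <- r) n.+1)%N.
have [n [Bn n0 hn]] := h B.
have nr : n \in r by have : S n by []; rewrite Sr.
by have := @leq_bigmax_seq _ r xpredT (fun n => n.+1) n nr isT; rewrite -/B ltnNge Bn.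
Qed.

(** For almost every [x] the discrepancy is below any given bound in infinitely
    many blocks, and [hausdorff_limsup_neq0] applies to the unions [A k] of the
    targets with index at least [2 ^ k]. *)
Lemma ae_hausdorff_measure_neq0 t : 0 < t < tau -> G !=set0 -> compact G ->
  lebesgue_measure.-negligible [set x : R | 0 <= x < 1 /\
    hausdorff_measure t ((@circle_val R @^-1` shrinking_targets q x nu) `&` G) = 0%E].
Proof.
move=> /andP[t0 t_tau] Gn Gc.
pose bad i M := [set x : R | 0 <= x < 1 /\
    forall k, (M <= k)%N -> i.+1%:R^-1 <= disc k (grid (L k) x)].
apply: (@lebesgue_negligibleS _ (\bigcup_i \bigcup_M bad i M)); last first.
  apply: negligible_bigcup => i; apply: negligible_bigcup => M.
  by apply: ae_equidistributed; rewrite invr_gt0.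
move=> x [x01 Hx]; apply: contrapT => nbad.
have good (eta : R) M : 0 < eta -> exists2 k, (M <= k)%N & disc k (grid (L k) x) < eta.
  move=> eta0; apply: contrapT => h; apply: nbad; exists (Num.truncn eta^-1) => //.
  exists M => //; split=> // k Mk.
  apply: (@le_trans _ _ eta).
    by rewrite -[leRHS]invrK lef_pV2 ?posrE ?invr_gt0// ltW// truncnS_gt.
  by rewrite leNgt; apply/negP => lt; apply: h; exists k.
have [k0 b0] := block_neq0 q_neq0.
pose A k := [set z : circle R | exists n, [/\ (2 ^ k <= n)%N, (0 < n)%N &
  dist_int ((z : R) - (q n)%:~R * x) <= 1 / n%:R `^ nu]].
have /andP[x0 _] := x01.
have hD (eta : R) M : 0 < eta -> exists k j (w : nat -> R),
  [/\ (M <= k)%N, (M <= j)%N, forall v, 0 <= w v, forall v, 0 < w v ->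
     gcell G j v /\ (forall y z, cell j y = v -> mdist y z <= 2 ^- j -> A k z)
   & discrepancy G s tau w j < eta].
  move=> eta0; have [k Mk hk] := good eta (maxn k0 M) eta0.
  have [kk0 MK] : (k0 <= k)%N /\ (M <= k)%N by move: Mk; rewrite geq_max => /andP.
  exists k, (lvl nu k), (weight k (grid (L k) x)); split=> //.
  - by apply: leq_trans (leq_lvl nu1 k).
  - move=> v; rewrite mulr_ge0 ?sumr_ge0// divr_ge0 ?pow2_ge0//.
  move=> v wv; split.
    move: wv; apply: contraTT => gv; rewrite /weight /orbit_weight big1 ?mulr0 ?ltxx// => n _.
    by rewrite (negbTE gv) andbF.
  by move=> y z yv yz; apply: (target_of_near_cell x0 (b0 k kk0) erefl wv yv).
apply: (hausdorff_limsup_neq0 hs c0_gt0 hA t0 t_tau (ltW tau_s) hD Gn Gc).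
apply/eqP; rewrite eq_le hausdorff_measure_ge0 andbT -Hx setIC.
apply: hausdorff_measure_mono => z [hz Gz]; split=> //; apply: shrinking_targetsP => M.
have [k Mk [n [kn n0 hn]]] := hz M; exists n; split=> //.
by rewrite (leq_trans Mk)// (leq_trans (ltnW (ltn_expl k (ltnSn 1)))).
Qed.

End lower_bound.

(** * The upper bound *)

Section upper_bound.
Context {R : realType}.
Variables (G : set (circle R)) (s c0 nu t : R) (q : nat -> int).
Hypotheses (hs : 0 < s <= 1) (c0_gt0 : 0 < c0).
Hypothesis hA : forall (x : circle R) (r : R), G x -> 0 < r <= 1 / 2 ->
  ((r `^ s / c0)%:E <= hausdorff_measure s (G `&` ball x r) <= (c0 * r `^ s)%:E)%E.
Hypotheses (nu1 : 1 <= nu) (t0 : 0 <= t) (ht : 1 < nu * (1 - s + t)).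
Hypothesis q_neq0 : exists n0, forall n, (n0 <= n)%N -> q n != 0.

Let C : R := 32 * c0 ^+ 2.
(** Number of cells of level [lvl nu k] that make up the radius of a target, with
    room for the errors of discretisation. *)
Let m : nat := (Num.truncn (pow2 (nu + 3))).+4.
Let L k := block_mod q (lvl nu k) k.

Let C0 : 0 < C. Proof. by rewrite mulr_gt0// exprn_gt0. Qed.

(** Up to the errors of discretisation, the event that the target around
    [q n * g / L] meets [G]. *)
Definition hit k (n : 'I_(2 ^ k)) (g : nat) : bool :=
  has (gcell G (lvl nu k)) (near_cells (lvl nu k) m (dcell (L k) (lvl nu k) (block q n) g)).

Let hits k g : R := \sum_n (@hit k n g)%:R.

Let hits_ge0 k g : 0 <= hits k g. Proof. by apply: sumr_ge0. Qed.

Let cells_le j : (\sum_(v < 2 ^ j) gcell G j v)%N%:R <= C * pow2 (j%:R * s) :> R.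
Proof.
have := gcount_le hs c0_gt0 hA 0 (leq0n j); rewrite subr0; apply: le_trans.
rewrite ler_nat /gcount subn0 [leqRHS]big_mkcond; apply: leq_sum => v _.
by rewrite divn_small// eqxx andbT; case: (gcell G j v).
Qed.

(** By uniformity, the probability to land near one of the [2 ^ (j * s)] cells of
    [G] is at most of order [2 ^ (j * (s - 1))]. *)
Lemma sum_hit k (n : 'I_(2 ^ k)) : (forall n : 'I_(2 ^ k), block q n != 0) ->
  \sum_(g < L k) (hit n g)%:R <=
  (L k)%:R * (m.*2.+1%:R * C * pow2 (- (k%:R * (nu * (1 - s))))) :> R.
Proof.
move=> b0; set j := lvl nu k; have L0 := block_mod_gt0 j b0; rewrite -/(L k) in L0.
have qL := dvdn_block_mod q j n; rewrite -/(L k) in qL.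
have J0 : (0 < 2 ^ j)%N by rewrite expn_gt0.
have jL : (2 ^ j %| L k)%N by apply: dvdn_trans qL; exact: dvdn_mull.
have shift a : (2 ^ j * \sum_(g < L k) gcell G j ((dcell (L k) j (block q n) g + a) %% 2 ^ j) =
    L k * \sum_(v < 2 ^ j) gcell G j v)%N.
  have -> : (\sum_(g < L k) gcell G j ((dcell (L k) j (block q n) g + a) %% 2 ^ j) =
      \sum_(g < L k) \sum_(v < 2 ^ j) (dcell (L k) j (block q n) g == v) * gcell G j ((v + a) %% 2 ^ j))%N.
    apply: eq_bigr => g _; rewrite (bigD1 (Ordinal (dcell_lt L0 jL (block q n) g)))//= eqxx mul1n.
    rewrite big1 ?addn0// => v vn; rewrite [_ == _]negbTE//.
    by apply: contra vn => /eqP h; apply/eqP/val_inj.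
  rewrite exchange_big big_distrr/=.
  have -> : (\sum_(v < 2 ^ j) gcell G j v = \sum_(v < 2 ^ j) gcell G j ((v + a) %% 2 ^ j))%N.
    rewrite (sum_shift (f := fun v => gcell G j (v %% 2 ^ j) : nat)); last first.
      by move=> v; rewrite modnDr.
    by apply: eq_bigr => v _; rewrite modn_small.
  rewrite big_distrr/=; apply: eq_bigr => v _.
  by rewrite -big_distrl/= mulnA (dcell_uniform L0 jL (b0 n) qL (ltn_ord v)).
apply: (@le_trans _ _ ((m.*2.+1 * (L k * \sum_(v < 2 ^ j) gcell G j v))%N%:R * 2 ^- j)).
  rewrite ler_pdivlMr ?exprn_gt0// -natrX -natr_sum -natrM ler_nat mulnC.
  apply: (@leq_trans (2 ^ j * \sum_(g < L k) \sum_(l < m.*2.+1)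
     gcell G j ((dcell (L k) j (block q n) g + ((2 ^ j).-1 * m + l)) %% 2 ^ j))).
    rewrite leq_mul2l; apply/orP; right; apply: leq_sum => g _.
    rewrite /hit -/j; case: hasP => // -[v vn gv].
    move/mapP: vn => [l]; rewrite mem_iota add0n => /andP[_ lm] vE.
    by rewrite (bigD1 (Ordinal lm))//= addnA -vE gv.
  rewrite exchange_big big_distrr/= (eq_bigr _ (fun (l : 'I_(m.*2.+1)) _ => shift _)).
  by rewrite sum_nat_const card_ord.
rewrite (natrM R m.*2.+1) (natrM R (L k)) mulrCA -[leLHS]mulrA ler_wpM2l//.
apply: (@le_trans _ _ (m.*2.+1%:R * (C * pow2 (j%:R * s)) * 2 ^- j)).
  by rewrite ler_wpM2r ?invr_ge0 ?exprn_ge0// ler_wpM2l// cells_le.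
have mC0 : 0 <= m.*2.+1%:R * C by rewrite mulr_ge0// ltW.
rewrite -pow2_natV mulrA; move: mC0; set A := _ * C => A0.
rewrite -mulrA -pow2D ler_wpM2l// pow2_le//.
have s1 : 0 <= 1 - s by have /andP[_] := hs; rewrite subr_ge0.
have kj : k%:R * nu <= j%:R.
  by have := lvl_ge nu k; rewrite -natr1; have := nu1; rewrite -/j; lra.
have := ler_wpM2r s1 kj; lra.
Qed.

(** A surplus that is split evenly: half of it makes the exceptional measures
    summable, the other half the costs of the covers. *)
Let eps : R := (nu * (1 - s + t) - 1) / 2.

Let eps0 : 0 < eps. Proof. by rewrite divr_gt0// subr_gt0. Qed.

Let eta k : R := pow2 (k%:R * (1 - nu * (1 - s) + eps)).

Let radius_le k (n : 'I_(2 ^ k)) : 1 / (2 ^ k + n)%N%:R `^ nu <= pow2 (- (k%:R * nu)).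
Proof.
rewrite div1r pow2N pow2M lef_pV2 ?posrE ?powR_gt0 ?pow2_gt0 ?ltr0n ?addn_gt0 ?expn_gt0//.
apply: ge0_ler_powR; rewrite ?nnegrE ?pow2_ge0 ?(le_trans ler01 nu1)//.
by rewrite pow2_nat -natrX ler_nat leq_addr.
Qed.

Let hit_of_close k (n : 'I_(2 ^ k)) x z : 0 <= x -> (forall n : 'I_(2 ^ k), block q n != 0) ->
  G z -> dist_int ((z : R) - (block q n)%:~R * x) <= pow2 (- (k%:R * nu)) ->
  hit n (grid (L k) x).
Proof.
move=> x0 b0 Gz hz; set j := lvl nu k; have L0 := block_mod_gt0 j b0; rewrite -/(L k) in L0.
have qL := dvdn_block_mod q j n; rewrite -/(L k) in qL.
have jL : (2 ^ j %| L k)%N by apply: dvdn_trans qL; exact: dvdn_mull.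
pose v := dcell (L k) j (block q n) (grid (L k) x).
have J0 : 0 < 2 ^+ j :> R by rewrite exprn_gt0.
have v01 : 0 <= (v%:R / 2 ^+ j : R) < 1.
  rewrite divr_ge0 ?(ltW J0)//= ltr_pdivrMr// mul1r -natrX ltr_nat.
  exact: (dcell_lt L0 jL).
pose y := Circle v01.
have yv : cell j y = v.
  by apply: cell_uniq; rewrite /= mulrCA divff ?gt_eqF// mulr1 lexx ltrDl ltr01.
have hy := dist_dcell L0 (b0 n) qL x0 yv.
have yz : mdist y z < m%:R * 2 ^- j.
  rewrite mdistE.
  have -> : (y : R) - (z : R) = ((y : R) - (block q n)%:~R * x) +
     - ((z : R) - (block q n)%:~R * x) by ring.
  apply: le_lt_trans (dist_intD _ _) _; rewrite dist_intN.
  have h1 : pow2 (- (k%:R * nu)) <= pow2 (nu + 3) * 2 ^- j.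
    by rewrite -pow2_natV -pow2D pow2_le//; have := lvl_le nu1 k; rewrite -/j; lra.
  have p0 : 0 < 2 ^- j :> R by rewrite invr_gt0.
  have h2 : pow2 (nu + 3) * 2 ^- j <= (Num.truncn (pow2 (nu + 3))).+1%:R * 2 ^- j.
    by rewrite ler_wpM2r ?(ltW p0)// ltW// truncnS_gt.
  have h3 := le_trans hz (le_trans h1 h2).
  apply: le_lt_trans (lerD hy h3) _.
  by rewrite -mulrDl ltr_pM2r// -natrD /m ltr_nat !addSn add0n ltnSn.
apply/hasP; exists (cell j z); last exact: gcell_cell.
by rewrite -/v -yv; exact: near_cellsP.
Qed.

(** Cover by the targets of large index that meet [G]. In the block of index [k]
    there are fewer than [eta k] of them, with diameters at most
    [2 ^ (1 - k * nu)]. *)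
Lemma hausdorff_measure_targets_eq0 x k1 : 0 <= x ->
  (forall k, (k1 <= k)%N -> (forall n : 'I_(2 ^ k), block q n != 0) /\
    hits k (grid (L k) x) < eta k) ->
  hausdorff_measure t ((@circle_val R @^-1` shrinking_targets q x nu) `&` G) = 0%E.
Proof.
move=> x0 h; apply: hausdorff_measure_eq0 => e eta' e0 eta0.
have nu0 : 0 < nu := lt_le_trans ltr01 nu1.
have e20 : 0 < eps / 2 by rewrite divr_gt0.
pose K : R := pow2 t * (1 - pow2 (- (eps / 2)))^-1.
have K0 : 0 <= K.
  by rewrite mulr_ge0 ?pow2_ge0// invr_ge0 subr_ge0 pow2_le1// oppr_le0 ltW.
have [k2 h2] := pow2_decay 1 nu0 e0 ler01.
have [k3 h3] := pow2_decay 0 e20 eta0 K0.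
pose kk := maxn k1 (maxn k2 k3).
have [kk1 kk2 kk3] : [/\ (k1 <= kk)%N, (k2 <= kk)%N & (k3 <= kk)%N].
  by rewrite /kk !leq_max !leqnn !orbT.
pose F n : set (circle R) := if (2 ^ kk <= n)%N then
  G `&` [set z | dist_int ((z : R) - (q n)%:~R * x) <= 1 / n%:R `^ nu] else set0.
have Fr k (n : 'I_(2 ^ k)) y z : F (2 ^ k + n)%N y -> F (2 ^ k + n)%N z ->
    mdist y z <= pow2 (1 - k%:R * nu).
  rewrite /F; case: ifP => // _ [_ /= hy] [_ /= hz]; rewrite mdistE.
  have -> : (y : R) - (z : R) = ((y : R) - (q (2 ^ k + n)%N)%:~R * x) +
     - ((z : R) - (q (2 ^ k + n)%N)%:~R * x) by ring.
  apply: le_trans (dist_intD _ _) _; rewrite dist_intN.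
  apply: le_trans (lerD (le_trans hy (radius_le n)) (le_trans hz (radius_le n))) _.
  by rewrite pow2D pow21; apply/le_of_eq; ring.
have dyadic n : (0 < n)%N -> exists k, exists i : 'I_(2 ^ k), n = (2 ^ k + i)%N.
  move=> n0; pose k := trunc_log 2 n; have /andP[a b] := trunc_log_bounds (ltnSn 1) n0.
  have lt : (n - 2 ^ k < 2 ^ k)%N by rewrite ltn_subLR// addnn -mul2n -expnS.
  by exists k, (Ordinal lt); rewrite /= subnKC.
exists F; split.
- move=> z [[_ hz] Gz].
  have [n [kn [n0 hn]]] : exists n, (2 ^ kk <= n)%N /\ ((0 < n)%N /\
      dist_int ((z : R) - (q n)%:~R * x) <= 1 / n%:R `^ nu).
    apply: contrapT => no; apply: hz.
    apply: (@sub_finite_set _ _ `I_(2 ^ kk)); last exact: finite_II.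
    by move=> n hn /=; rewrite ltnNge; apply/negP => kn; apply: no; exists n.
  by exists n => //; rewrite /F kn.
- move=> n; apply: diam_le => y z Fy Fz; rewrite lee_fin.
  have kn : (2 ^ kk <= n)%N by move: Fy; rewrite /F; case: ifP.
  have n0 : (0 < n)%N by apply: leq_trans kn; rewrite expn_gt0.
  have [k [i nE]] := dyadic n n0; rewrite nE in Fy Fz.
  apply: le_trans (Fr k i y z Fy Fz) _.
  have kkk : (kk <= k)%N.
    rewrite -ltnS -(ltn_exp2l _ _ (ltnSn 1)); apply: leq_ltn_trans kn _.
    by rewrite nE expnS mul2n -addnn ltn_add2l.
  by have := h2 k (leq_trans kk2 kkk); rewrite mul1r.
pose b k : R := if (kk <= k)%N then pow2 t * pow2 (- (k%:R * eps)) else 0.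
have b0 k : 0 <= b k by rewrite /b; case: ifP => // _; rewrite mulr_ge0 ?pow2_ge0.
have blk k : (\sum_(i < 2 ^ k) diam_pow t (F (2 ^ k + i)%N) <= (b k)%:E)%E.
  rewrite /b; case: leqP => kkk; last first.
    rewrite big1// => i _; rewrite /F ifF ?diam_pow_set0//.
    apply/negbTE; rewrite -ltnNge (@leq_trans (2 ^ k.+1))//.
      by rewrite expnS mul2n -addnn ltn_add2l.
    by rewrite leq_exp2l.
  have [bn0 hk] := h k (leq_trans kk1 kkk).
  apply: (@le_trans _ _ (\sum_(i < 2 ^ k)
     ((hit i (grid (L k) x))%:R * pow2 ((1 - k%:R * nu) * t))%:E)%E).
    apply: lee_sum => i _; case: (boolP (hit i _)) => hi.
      rewrite mul1r pow2M; apply: diam_pow_le => //; [exact: pow2_ge0|exact: Fr].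
    rewrite (_ : F _ = set0) ?diam_pow_set0 ?mul0r//.
    apply/seteqP; split => // z; rewrite /F; case: ifP => // _ [Gz /= hz].
    by move/negP: hi; apply; exact: (hit_of_close x0 bn0 Gz (le_trans hz (radius_le i))).
  rewrite sumEFin lee_fin -mulr_suml -/(hits k _).
  apply: (@le_trans _ _ (eta k * pow2 ((1 - k%:R * nu) * t))).
    by rewrite ler_wpM2r ?pow2_ge0// ltW.
  rewrite /eta -!pow2D pow2_le// /eps; apply/le_of_eq; by field.
move=> n; apply: (@le_trans _ _ (\sum_(0 <= i < 2 ^ n) diam_pow t (F i))%E).
  rewrite [leRHS](@big_cat_nat _ _ _ n)//=; last by rewrite ltnW// ltn_expl.
  by rewrite leeDl// sume_ge0// => i _; exact: diam_pow_ge0.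
apply: (@le_trans _ _ (\sum_(k < n) b k)%:E).
  elim: n => [|n IH].
    by rewrite expn0 big_nat1 big_ord0 /F leqNgt expn_gt0/= diam_pow_set0.
  rewrite (@big_cat_nat _ _ _ (2 ^ n)) ?leq_exp2l//= big_ord_recr EFinD leeD//.
  rewrite -{1}[(2 ^ n)%N]add0n expnS mul2n -addnn big_addn addnK big_mkord.
  apply: le_trans (blk n); apply: lee_sum => i _.
  by rewrite addnC; exact: lexx.
rewrite lee_fin.
apply: (@le_trans _ _ (\sum_(k < n) pow2 t * pow2 (- (kk%:R * (eps / 2))) *
    pow2 (- (k%:R * (eps / 2))))).
  apply: ler_sum => k _; rewrite /b; case: ifP => [kkk|_]; last by rewrite !mulr_ge0 ?pow2_ge0.
  rewrite -!pow2D pow2_le//.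
  have := ler_wpM2r (ltW e20) (_ : kk%:R <= k%:R); rewrite ler_nat => /(_ kkk).
  move: (k%:R) (kk%:R) => a b'; lra.
rewrite -mulr_sumr; apply: (@le_trans _ _ (K * pow2 (- (kk%:R * (eps / 2))))).
  by rewrite /K [leRHS]mulrAC ler_wpM2l ?mulr_ge0 ?pow2_ge0//; exact: geometric_pow2.
by have := h3 kk kk3; rewrite add0r.
Qed.

(** Markov's inequality and the Borel-Cantelli lemma for the numbers of hits. *)
Lemma ae_hausdorff_measure_eq0 : lebesgue_measure.-negligible [set x : R | 0 <= x < 1 /\
  hausdorff_measure t ((@circle_val R @^-1` shrinking_targets q x nu) `&` G) <> 0%E].
Proof.
have [k0 b0] := block_neq0 q_neq0.
pose A : R := m.*2.+1%:R * C.
have A0 : 0 <= A by rewrite mulr_ge0// ltW.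
pose F k : set R := if (k0 <= k)%N then grid_set (L k) (fun g => eta k <= hits k g) else set0.
have mF k : measurable (F k).
  by rewrite /F; case: ifP => // _; exact: measurable_grid_set.
have Fle k : (lebesgue_measure (F k) <= (A * pow2 (- (k%:R * eps)))%:E)%E.
  rewrite /F; case: ifP => [kk|_]; last first.
    by rewrite measure0 lee_fin mulr_ge0 ?pow2_ge0.
  have bk := b0 k kk; have L0 : (0 < L k)%N := block_mod_gt0 _ bk.
  have sumh : \sum_(g < L k) hits k g <=
      (L k)%:R * (A * pow2 (k%:R * (1 - nu * (1 - s)))).
    rewrite exchange_big/=.
    apply: (@le_trans _ _ (\sum_(n < 2 ^ k) (L k)%:R * (A * pow2 (- (k%:R * (nu * (1 - s))))))).
      by apply: ler_sum => n _; exact: sum_hit.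
    rewrite sumr_const card_ord -[_ *+ _]mulr_natl natrX -pow2_nat mulrCA ler_wpM2l//.
    rewrite mulrCA ler_wpM2l// -pow2D pow2_le//; apply/le_of_eq; ring.
  apply: le_trans (measure_grid_set_le L0 (pow2_gt0 _) (hits_ge0 k) sumh) _.
  rewrite lee_fin -mulrA ler_wpM2l// -pow2B pow2_le//; apply/le_of_eq; ring.
exists (lim_sup_set F); split.
- by apply: bigcapT_measurable => n; apply: bigcup_measurable => k _; exact: mF.
- apply: lim_sup_set_cvg0 => //.
  apply: (@le_lt_trans _ _ (A * (1 - pow2 (- eps))^-1)%:E); last exact: ltry.
  apply: nneseries_le_bound => n //.
  apply: (@le_trans _ _ (\sum_(0 <= k < n) (A * pow2 (- (k%:R * eps)))%:E)%E).
    by apply: lee_sum => k _; exact: Fle.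
  rewrite sumEFin lee_fin -mulr_sumr ler_wpM2l// big_mkord; exact: geometric_pow2.
move=> x [x01 Hx] M _; apply: contrapT => no; apply: Hx.
have /andP[x0 _] := x01.
apply: (@hausdorff_measure_targets_eq0 x (maxn k0 M)) => // k.
rewrite geq_max => /andP[kk Mk]; have bk := b0 k kk; split=> //.
rewrite ltNge; apply/negP => hk; apply: no; exists k => //.
rewrite /F kk; apply: grid_setP => //; exact: block_mod_gt0.
Qed.

End upper_bound.

(** * The dimension formula *)

Section dimension_formula.
Context {R : realType}.
Variables (G : set (circle R)) (s c0 nu : R) (q : nat -> int).
Hypotheses (hs : 0 < s <= 1) (c0_gt0 : 0 < c0).
Hypothesis hA : forall (x : circle R) (r : R), G x -> 0 < r <= 1 / 2 ->
  ((r `^ s / c0)%:E <= hausdorff_measure s (G `&` ball x r) <= (c0 * r `^ s)%:E)%E.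
Hypotheses (Gn : G !=set0) (Gc : compact G).
Hypotheses (nu1 : 1 <= nu) (nu_s : 0 <= 1 / nu + s - 1).
Hypothesis q_neq0 : exists n0, forall n, (n0 <= n)%N -> q n != 0.
Hypothesis small_cost : forall tau : R, 0 < tau -> tau < s -> nu * (1 - s + tau) < 1 ->
  small_pair_cost s tau nu q.

Theorem ae_hausdorff_dim : lebesgue_measure.-negligible [set x : R | 0 <= x < 1 /\
  hausdorff_dim ((@circle_val R @^-1` shrinking_targets q x nu) `&` G) <>
  (1 / nu + s - 1)%:E].
Proof.
have := nu_s; set t0 := 1 / nu + s - 1 => t00.
have nu0 : 0 < nu := lt_le_trans ltr01 nu1.
have t0E a : nu * (1 - s + (t0 + a)) = 1 + nu * a.
  by rewrite /t0; field; rewrite gt_eqF.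
have t0s : t0 <= s.
  by have : 1 / nu <= 1 by [rewrite div1r invf_le1]; rewrite /t0; lra.
have i0 (i : nat) : 0 < i.+1%:R^-1 :> R by rewrite invr_gt0.
pose E x := (@circle_val R @^-1` shrinking_targets q x nu) `&` G.
pose U i := [set x : R | 0 <= x < 1 /\ hausdorff_measure (t0 + i.+1%:R^-1) (E x) <> 0%E].
pose W i := [set x : R | 0 <= x < 1 /\ 0 < t0 - i.+1%:R^-1 /\
  hausdorff_measure (t0 - i.+1%:R^-1) (E x) = 0%E].
apply: (@lebesgue_negligibleS _ (\bigcup_i U i `|` \bigcup_i W i)).
  move=> x [x01 hx]; apply: contrapT => no; apply: hx.
  apply: hausdorff_dim_eq => // i; first by apply: contrapT => h; apply: no; left; exists i.
  by move=> ti h; apply: no; right; exists i.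
apply: negligibleU; apply: negligible_bigcup => i.
  apply: (ae_hausdorff_measure_eq0 hs c0_gt0 hA nu1) => //.
    by rewrite addr_ge0// ltW.
  by rewrite t0E ltrDl mulr_gt0.
have [ti|ti] := ltP 0 (t0 - i.+1%:R^-1); last first.
  apply: (@lebesgue_negligibleS _ set0); last exact: negligible_set0.
  by move=> x [_ [ti' _]]; move: ti'; rewrite ltNge ti.
pose tau := t0 - i.+1%:R^-1 / 2.
have ii := i0 i.
have [h1 h2] : t0 - i.+1%:R^-1 < tau /\ tau < t0.
  by rewrite /tau; move: ii; move: (i.+1%:R^-1) => a a0; split; lra.
have tau0 : 0 < tau := lt_trans ti h1.
have taus : tau < s := lt_le_trans h2 t0s.
have hnu : nu * (1 - s + tau) < 1.
  by rewrite /tau t0E gtrDl mulrN oppr_lt0 mulr_gt0// divr_gt0.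
have t_tau : 0 < t0 - i.+1%:R^-1 < tau by rewrite ti h1.
have := ae_hausdorff_measure_neq0 hs c0_gt0 hA nu1 tau0 taus hnu q_neq0
  (small_cost tau0 taus hnu) t_tau Gn Gc.
by apply: lebesgue_negligibleS => x [x01 [_ h]]; split.
Qed.

End dimension_formula.

Theorem corollary1p6 (R : realType) (s : R) (G : set (circle R)) (nu : R)
    (q : nat -> int)
    (hs : 0 < s <= 1)
    (hG : ahlfors_regular s G)
    (hnu1 : 1 <= nu)
    (hnu2 : s < 1 -> nu <= 1 / (1 - s))
    (hq : [\/ (exists2 d : nat, nu <= d%:R &
                 forall n : nat, (0 < n)%N -> q n = (nth_prime n ^ d)%N%:Z),
              (exists2 d : nat, nu < d%:R &
                 forall n : nat, (0 < n)%N -> q n = (n ^ d)%N%:Z) |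
              (exists2 P : {poly int}, nu + 1 < (size P).-1%:R &
                 forall n : nat, (0 < n)%N -> q n = P.[n%:Z])]) :
  {ae lebesgue_measure, forall x : R, 0 <= x <= 1 ->
    hausdorff_dim ((@circle_val R @^-1` shrinking_targets q x nu) `&` G)
    = ((1 / nu)%:E + hausdorff_dim G - 1)%E}.
Proof.
have [Gn Gc [c0 c0_gt0 hA]] := hG.
have nu0 : 0 < nu := lt_le_trans ltr01 hnu1.
have nu_s : 0 <= 1 / nu + s - 1.
  have /andP[s0 s1] := hs; have [s1'|s1'] := ltP s 1; last first.
    by rewrite -addrA addr_ge0 ?divr_ge0 ?subr_ge0// ltW.
  have d0 : 0 < 1 - s by rewrite subr_gt0.
  have : 1 - s <= 1 / nu.
    by rewrite div1r -[leLHS]invrK lef_pV2 ?posrE ?invr_gt0// -div1r hnu2.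
  lra.
have [q_neq0 small_cost] : (exists n0, forall n, (n0 <= n)%N -> q n != 0) /\
  forall tau : R, 0 < tau -> tau < s -> nu * (1 - s + tau) < 1 ->
  small_pair_cost s tau nu q.
  have poly (P : {poly int}) : nu < (size P).-1%:R ->
      (forall n, (0 < n)%N -> q n = P.[n%:Z]) ->
      (exists n0, forall n, (n0 <= n)%N -> q n != 0) /\
      forall tau : R, 0 < tau -> tau < s -> nu * (1 - s + tau) < 1 ->
      small_pair_cost s tau nu q.
    move=> nuD hP; set D := (size P).-1 in nuD.
    have D0 : (0 < D)%N by rewrite -(ltr_nat R) (lt_trans nu0).
    have sP : size P = D.+1 by rewrite /D prednK// (leq_trans D0)// leq_pred.
    split.
      have [C [C0 [n0 grow]]] := poly_growth sP D0.
      exists (maxn n0 1) => n; rewrite geq_max => /andP[/grow[_ h] n1].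
      rewrite hP//; apply: contraTneq h => ->.
      by rewrite absz0 muln0 -ltnNge expn_gt0 n1.
    move=> tau tau0 taus hnu; exact: (polynomial_cost hs tau0 hnu1 hnu sP nuD hP).
  case: hq => [[d nud hq]|[d nud hq]|[P nuP hP]].
  - split; last first.
      by move=> tau tau0 taus hnu; exact: (prime_power_cost _ _ hnu1 nud hq).
    exists 1%N => n n0; rewrite hq// eqz_nat expn_eq0 negb_and -lt0n prime_gt0//.
    exact: nth_prime_prime.
  - apply: (poly 'X^d); first by rewrite size_polyXn.
    by move=> n n0; rewrite hq// hornerXn -[n%:Z]natz -natrX natz.
  - by apply: (poly P) hP; apply: le_lt_trans nuP; rewrite lerDl.
have dimG := ahlfors_dim hs c0_gt0 hA Gn.
have null := ae_hausdorff_dim hs c0_gt0 hA Gn Gc hnu1 nu_s q_neq0 small_cost.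
have one : lebesgue_measure.-negligible [set (1 : R)].
  by exists [set 1]; split=> //; exact: lebesgue_measure_set1.
apply: (lebesgue_negligibleS _ (negligibleU null one)) => x /=.
move/not_implyP => [/andP[x0 x1] hx]; have [->|x1'] := eqVneq x 1; first by right.
left; split; first by rewrite x0 lt_neqAle x1' x1.
by rewrite dimG in hx.
Qed.
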